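(* Suppose that Assumptions (A1) and (A2) of the context hold. Fix $k\in I_U$, let $f\in Y_k$ and $g\in\mathcal H$ have compact support, and let $0<a<b<+\infty$. Then for any function $h$ holomorphic on the complex plane, $$(h(H)E(a,b)f,g)_{\mathcal H}=-\frac1\pi\int_{\mathcal R}\left(\int_{(a,b)}h(\lambda)\int_{e_k}\Im K_k(x,x',\lambda)\,f_k(x')\,dx'\,d\lambda\right)\bar g(x)\,dx .$$
   Context: $E$ is the resolution of the identity (spectral measure) of $H$ and $E(a,b)$ the spectral projection on $(a,b)$. Graph and operator. Let $\mathcal R$ be a connected metric graph with edges $e_k$, $k\in I=I_B\cup I_U$, where $I_B,I_U$ are (disjoint) finite sets of positive integers and $I_U\neq\emptyset$. For $k\in I_B$, $e_k$ has finite length $\ell_k$ and is identified with $(0,\ell_k)$; for $k\in I_U$, $e_k$ is infinite and identified with $(0,+\infty)$. $\mathcal R_B$ is the subgraph made of the $e_k$, $k\in I_B$, and $\mathcal R_U=\mathcal R\setminus\mathcal R_B$. $V$ is the set of vertices, $I_v$ the set of edges having $v$ as a vertex (a loop is counted with both ends), $V_{\rm ext}=\{v:\#I_v=1\}$, $V_{\rm int}=\{v:\#I_v\ge2\}$, $V_{\rm connecting}=\{v\in V_{\rm int}:I_v\cap I_U\ne\emptyset\}$; $V_{\rm connecting}$ is nonempty and $\#I_v\ge3$ for $v\in V_{\rm connecting}$. The vertices in $V_{\rm int}$ are regarded as interior vertices of $\mathcal R_B$. Put $\mathcal H=L^2(\mathcal R)=\prod_{k\in I}L^2(e_k)$. $H$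 is the nonnegative self-adjoint operator $Hu=(-u_k'')_{k\in I}$ on $\mathcal H$ with domain the set of $u=(u_k)\in C(\mathcal R)\cap\prod_{k\in I}H^2(e_k)$ with $u(v)=0$ for $v\in V_{\rm ext}$ and $\sum_{k\in I_v}\frac{du_k}{dn_k}(v)=0$ for $v\in V_{\rm int}$ (outward normal derivatives). The set $S_d$. $-\Delta^{\rm Dir}_{\mathcal R_B}$ is the operator $(-u_k'')_{k\in I_B}$ on $L^2(\mathcal R_B)$ with the same type of vertex conditions on $\mathcal R_B$ (continuity, Dirichlet at $V_{\rm ext}$, Kirchhoff at $V_{\rm int}$). $S_d$ is the set of its eigenvalues having an eigenvector $\varphi$ with $\varphi(v)=0$ for all $v\in V_{\rm connecting}$. One has $0\notin S_d$; if $S_d\ne\emptyset$, write $S_d=\{\lambda_m^2\}_{m\in\mathbb N}$, $\lambda_m>0$, repeated according to the number of linearly independent such eigenvectors, with corresponding independent eigenvectors $\varphi^{(m)}$, extended by zero to $\mathcal R_U$. The matrix $\mathcal D(z)$. Let $\mathbb C_+=\{\Im z>0\}$, $\mathbb R^*=\mathbb R\setminus\{0\}$, $N=2\#I_B+\#I_U$. For $z\in\mathbb C_+\cup\mathbb R^*$ one looks for $u$ with $u_k''+z^2u_k=f_k$ on every edge in the form ( * ): $u_k(x)=c_ke^{-izx}+d_ke^{izx}+\frac1{2iz}\int_0^{\ell_k}e^{iz|x-y|}f_k(y)dy$ ($k\in I_B$), $u_k(x)=d_ke^{izx}+\frac1{2iz}\int_0^\infty e^{iz|x-y|}f_k(y)dy$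 ($k\in I_U$). The vertex conditions of $D(H)$ (Kirchhoff conditions divided by $iz$), written in a fixed order, are a linear system $\mathcal D(z)\big((c_k,d_k)_{k\in I_B},(d_k)_{k\in I_U}\big)^\top=b(z,f)=RF(z,f)$, where $\mathcal D(z)$ is $N\times N$ with entries $0$, $\pm1$, $\pm e^{\pm iz\ell_k}$ or $\pm1\pm e^{\pm iz\ell_k}$ ($k\in I_B$), $R$ is a constant $N\times N$ matrix with entries $0,\pm1$, and $F(z,f)=\big((F_{k+},F_{k-})_{k\in I_B},(F_{k+})_{k\in I_U}\big)^\top$ with $F_{k+}=\frac1{2iz}\int_0^{\ell_k}e^{izy}f_k\,dy$, $F_{k-}=\frac1{2iz}\int_0^{\ell_k}e^{iz(\ell_k-y)}f_k\,dy$ for $k\in I_B$, and $F_{k+}=\frac1{2iz}\int_0^\infty e^{izy}f_k\,dy$ for $k\in I_U$. Put $d(z)=\det\mathcal D(z)$. Assumption (A1). $d(z)=d_d(z)d_c(z)$ for all $z\in\mathbb C_+\cup\mathbb R$, with $d_d,d_c$ holomorphic on $\mathbb C$, polynomials in the variables $e^{izr_j^+\ell_j},e^{-izr_j^-\ell_j}$, $j\in I_B$, for some positive $r_j^+,r_j^-\in\mathbb Q$, with coefficients independent of $z$, such that $d_d(z)=0\Leftrightarrow z^2\in S_d$, and $d_c(z)\ne0$ for all $z\in\mathbb R$. There exist $\mathcal M_c,\mathcal M_p:\mathbb C_+\cup\mathbb R^*\to\mathbb C^{N\times N}$ with entries polynomials of the same kind such that $\operatorname{adj}(\mathcal D(z))=\mathcal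 M_p(z)+d_d(z)\mathcal M_c(z)$ for all $z\in\mathbb C_+\cup\mathbb R^*$. For all $m\in\mathbb N$ there is a matrix $\mathcal M_m$ such that $\mathcal D(z)^{-1}=\frac1{z-\lambda_m}\mathcal M_m+\mathcal R_m(z)$ for $z$ near $\lambda_m$, with $\mathcal R_m$ holomorphic at $\lambda_m$. (If $S_d=\emptyset$ this is understood with $d_d=1$, $\mathcal M_p=0$, the last condition being void.) For $k\in I_U$, $Y_k$ is the closed subspace of functions in $L^2(\mathcal R)$ vanishing on all edges other than $e_k$. Assumption (A2). For all $k\in I_U$ there is a map $X_k:\mathbb C_+\cup(0,\infty)\to\mathbb C^N$ whose entries are polynomials in the variables $e^{izr_j^+\ell_j},e^{-izr_j^-\ell_j}$, $j\in I_B$, and $e^{\pm iz}$, for some positive $r_j^\pm\in\mathbb Q$, with coefficients independent of $z$, such that $\frac1{d(z)}\mathcal M_p(z)RF(z,f)=\frac1{2iz\,d_c(z)}\left(\int_0^\infty e^{izy}f_k(y)dy\right)X_k(z)$ for all $f\in Y_k$. Kernel $K_k$ ($k\in I_U$). Under (A1)–(A2), for $f\in Y_k$ the coefficient vector is $\mathcal D(z)^{-1}RF(z,f)=\frac1{d_c(z)}\mathcal M_c(z)RF(z,f)+\frac1{2izd_c(z)}\left(\int_0^\infty e^{izy}f_k\,dy\right)X_k(z)$. Inserting the right-hand side in ( * ) defines a kernel $K_k(x,y,z^2)$, $x\in\mathcal R$, $y\in e_k$, with $[(z^2\mathbb I-H)^{-1}f](x)=\int_{e_k}K_k(x,y,z^2)f_k(y)dy$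 for $z\in\mathbb C_+$, $f\in Y_k$. It has the form: $K_k=\frac1{2iz}\big(e^{iz|x-y|}+\frac{c^c_k(z)}{d_c(z)}e^{iz(x+y)}\big)$ for $x,y\in e_k$; $K_k=\frac{1}{2izd_c(z)}c^c_{k',k}(z)e^{iz(x+y)}$ for $x\in e_{k'}$, $k'\in I_U\setminus\{k\}$, $y\in e_k$; $K_k=\frac1{2izd_c(z)}\sum_{\sigma=\pm}c^c_{k',k,\sigma}(z)e^{iz(\sigma x+y)}$ for $x\in e_{k'}$, $k'\in I_B$, $y\in e_k$, with coefficients $c^c$ holomorphic in $z$, polynomials in exponentials. For $\lambda>0$, $K_k(x,y,\lambda)$ is given by these formulas with $z=\sqrt\lambda>0$. *)

(* Defs.v *)
From HB Require Import structures.
From mathcomp Require Import all_boot all_order all_algebra.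
From mathcomp Require Import complex.
From mathcomp Require Import all_classical all_reals all_analysis.
(* Not imported: the notations of mpoly clash with those of mathcomp-analysis. *)
From mathcomp Require mpoly.
Set Implicit Arguments.
Unset Strict Implicit.
Unset Printing Implicit Defensive.
Import Order.TTheory GRing.Theory Num.Theory.
Import numFieldNormedType.Exports.
Local Open Scope classical_set_scope.
Local Open Scope ring_scope.
Local Open Scope complex_scope.

Section ComplexAnalysis.
Context {R : realType}.

Definition Ci : R[i] := 0 +i* 1.

Definition Cexp (z : R[i]) : R[i] :=
  (expR (complex.Re z) * cos (complex.Im z)) +i*
  (expR (complex.Re z) * sin (complex.Im z)).

Definition sqmod (z : R[i]) : R := complex.Re z ^+ 2 + complex.Im z ^+ 2.

(* [mu] is a bare set function so that it can be applied to
   [A |-> (E A u, u)], which is a measure only when [u] is in L^2. *)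
Definition cint (mu : set R -> \bar R) (D : set R) (f : R -> R[i]) : R[i] :=
  fine (\int[mu]_(x in D) (complex.Re (f x))%:E)%E +i*
  fine (\int[mu]_(x in D) (complex.Im (f x))%:E)%E.

Definition cmeasurable (D : set R) (f : R -> R[i]) : Prop :=
  measurable_fun D (fun x => complex.Re (f x)) /\
  measurable_fun D (fun x => complex.Im (f x)).

Definition cintegrable (D : set R) (f : R -> R[i]) : Prop :=
  (@lebesgue_measure R).-integrable D (fun x => (complex.Re (f x))%:E) /\
  (@lebesgue_measure R).-integrable D (fun x => (complex.Im (f x))%:E).

Definition cderivable (f : R[i] -> R[i]) (z : R[i]) : Prop :=
  derivable (f : R[i]^o -> R[i]^o) z 1.

Definition entire (f : R[i] -> R[i]) : Prop := forall z, cderivable f z.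

Definition Cplus : set R[i] := [set z | 0 < complex.Im z].
Definition Creal : set R[i] := [set z | complex.Im z = 0].
Definition Creal_star : set R[i] := [set z | complex.Im z = 0 /\ z != 0].
Definition Creal_pos : set R[i] :=
  [set z | complex.Im z = 0 /\ 0 < complex.Re z].

(* On Z, F is a polynomial in the variables exp(i z (c j)), j : J. *)
Definition poly_in_exp (J : finType) (c : J -> R) (Z : set R[i])
    (F : R[i] -> R[i]) : Prop :=
  exists p : mpoly.mpoly #|J| R[i], forall z, Z z ->
    F z = mpoly.meval (fun n => Cexp (Ci * z * (c (enum_val n))%:C)) p.

End ComplexAnalysis.

(* The vertex set and the edges (bounded edges [eB], unbounded edges [eU]) of
   a metric graph.  [vtx] attaches the edge ends to the vertices:
   [inl (k, true)] is the end x = 0 of the bounded edge k, [inl (k, false)] its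
   end x = len k, and [inr k] is the end x = 0 of the unbounded edge k. *)
Record metric_graph (R : realType) := MetricGraph {
  eB : finType;
  eU : finType;
  vert : finType;
  len : eB -> R;
  len_gt0 : forall k, 0 < len k;
  vtx : (eB * bool) + eU -> vert
}.

Section Graph.
Context {R : realType} (G : metric_graph R).
Local Notation C := R[i].
Local Notation leb := (@lebesgue_measure R).

Definition edge : finType := (eB G + eU G)%type.
Definition eend : finType := ((eB G * bool) + eU G)%type.

Definition edge_of (e : eend) : edge :=
  match e with inl (k, _) => inl k | inr k => inr k end.

Definition epos (e : eend) : R :=
  match e with inl (k, false) => len k | _ => 0 end.

Definition edge_set (k : edge) : set R :=
  match k with inl k => `]0, len k[ | inr _ => `]0, +oo[ end.

Definition cl_edge_set (k : edge) : set R :=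
  match k with inl k => `[0, len k] | inr _ => `[0, +oo[ end.

(* #I_v; a loop contributes both of its ends. *)
Definition vdeg (v : vert G) : nat := #|[set e : eend | vtx e == v]%SET|.
Definition vext (v : vert G) : bool := vdeg v == 1%N.
Definition vint (v : vert G) : bool := (2 <= vdeg v)%N.
Definition vconnecting (v : vert G) : bool :=
  vint v && [exists k : eU G, vtx (inr k) == v].

Definition vadj : rel (vert G) := fun v w =>
  [exists k : eB G, exists b : bool,
     (vtx (inl (k, b)) == v) && (vtx (inl (k, ~~ b)) == w)].

Definition graph_hyp : Prop :=
  [/\ forall v w : vert G, connect vadj v w,
      (0 < #|eU G|)%N,
      exists v : vert G, vconnecting v
    & forall v : vert G, vconnecting v -> (3 <= vdeg v)%N].

(* A function on the graph is a family indexed by the edges; an element of L^2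
   is handled through its representatives, equality being [ae_eqf]. *)
Definition gfun := edge -> R -> C.

Definition bounded_edges : pred edge := fun k => if k is inl _ then true else false.

Definition inL2 (P : pred edge) (u : gfun) : Prop := forall k, P k ->
  cmeasurable (edge_set k) (u k) /\
  (\int[leb]_(x in edge_set k) (sqmod (u k x))%:E < +oo)%E.

Definition ae_eqf (P : pred edge) (u v : gfun) : Prop := forall k, P k ->
  {ae leb, forall x, edge_set k x -> u k x = v k x}.

Definition ginner (u v : gfun) : C :=
  \sum_(k : edge) cint leb (edge_set k) (fun x => u k x * (v k x)^*).

Definition compact_support (u : gfun) : Prop :=
  exists r : R, forall k,
    {ae leb, forall x, edge_set k x -> r < x -> u k x = 0}.

Definition inY (k : eU G) (f : gfun) : Prop :=
  inL2 predT f /\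
  forall j, j != inr k -> {ae leb, forall x, edge_set j x -> f j x = 0}.

(* Continuity, Dirichlet and Kirchhoff conditions on the subgraph made of the
   edges in [P], for the values [a e] and the outward normal derivatives [b e]
   at the edge ends.  Exterior and interior vertices are those of the whole
   graph. *)
Definition vertex_conditions (P : pred edge) (a b : eend -> C) : Prop :=
  [/\ forall e e', P (edge_of e) -> P (edge_of e') -> vtx e = vtx e' ->
        a e = a e',
      forall e, P (edge_of e) -> vext (vtx e) -> a e = 0
    & forall v, vint v -> \sum_(e | P (edge_of e) && (vtx e == v)) b e = 0].

Definition outsign (e : eend) : C :=
  match e with inl (_, false) => 1 | _ => -1 end.

Definition trace_val (u : gfun) (e : eend) : C := u (edge_of e) (epos e).
Definition trace_nder (p : gfun) (e : eend) : C :=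
  outsign e * p (edge_of e) (epos e).

(* u is (the continuous representative of) an H^2 function on every edge in P,
   p = u', w = - u'', and u satisfies the vertex conditions. *)
Definition laplace (P : pred edge) (u p w : gfun) : Prop :=
  [/\ inL2 P u, inL2 P p, inL2 P w,
      forall k x, P k -> cl_edge_set k x ->
        u k x = u k 0 + cint leb `]0, x[ (p k) /\
        p k x = p k 0 - cint leb `]0, x[ (w k)
    & vertex_conditions P (trace_val u) (trace_nder p)].

(* The graph of H: u is in D(H) and Hu = w, as elements of L^2. *)
Definition opH (u w : gfun) : Prop :=
  exists u' p : gfun, [/\ inL2 predT u, ae_eqf predT u u' & laplace predT u' p w].

(* The set S_d.  The eigenfunction phi is continuous on the closed edges, so
   that it is nonzero in L^2 iff it is nonzero at some point. *)
Definition Sd : set C := [set l | exists phi p : gfun,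
  [/\ laplace bounded_edges phi p (fun k x => l * phi k x),
      exists k x, [/\ bounded_edges k, edge_set k x & phi k x != 0]
    & forall e, bounded_edges (edge_of e) -> vconnecting (vtx e) ->
        trace_val phi e = 0]].

Record is_pvm (E : set R -> gfun -> gfun) : Prop := {
  pvm_L2 : forall A u, measurable A -> inL2 predT u -> inL2 predT (E A u);
  pvm_ae : forall A u v, measurable A -> inL2 predT u -> inL2 predT v ->
    ae_eqf predT u v -> ae_eqf predT (E A u) (E A v);
  pvm_linear : forall A (c : C) u v, measurable A ->
    inL2 predT u -> inL2 predT v ->
    ae_eqf predT (E A (fun k x => c * u k x + v k x))
                 (fun k x => c * E A u k x + E A v k x);
  pvm_selfadj : forall A u v, measurable A -> inL2 predT u -> inL2 predT v ->
    ginner (E A u) v = ginner u (E A v);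
  pvm_mul : forall A B u, measurable A -> measurable B -> inL2 predT u ->
    ae_eqf predT (E A (E B u)) (E (A `&` B) u);
  pvm_set0 : forall u, inL2 predT u -> ae_eqf predT (E set0 u) (fun _ _ => 0);
  pvm_setT : forall u, inL2 predT u -> ae_eqf predT (E setT u) u;
  pvm_sigma_additive : forall u, inL2 predT u ->
    semi_sigma_additive (fun A => (complex.Re (ginner (E A u) u))%:E)
}.

Definition spec_meas (E : set R -> gfun -> gfun) (u : gfun) (A : set R) : \bar R :=
  (complex.Re (ginner (E A u) u))%:E.

(* The integral of h against the complex measure A |-> (E(A)u, v), defined by
   polarization. *)
Definition spec_int (E : set R -> gfun -> gfun) (h : R -> C) (u v : gfun) : C :=
  4^-1 * \sum_(n < 4) Ci ^+ n *
    cint (spec_meas E (fun k x => u k x + Ci ^+ n * v k x)) setT h.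

(* The domain of the operator \int h dE. *)
Definition calc_dom (E : set R -> gfun -> gfun) (h : R -> C) (u : gfun) : Prop :=
  inL2 predT u /\ (\int[spec_meas E u]_(l in setT) (sqmod (h l))%:E < +oo)%E.

(* The graph of the operator \int h dE: u is in its domain and is mapped to w.
   The vector w is tested against the v in the domain only, which is dense;
   there h is integrable for all the measures occurring in [spec_int]. *)
Definition calc (E : set R -> gfun -> gfun) (h : R -> C) (u w : gfun) : Prop :=
  [/\ calc_dom E h u, inL2 predT w
    & forall v, calc_dom E h v -> ginner w v = spec_int E h u v].

(* E is the resolution of the identity of H: H = \int l dE(l). *)
Definition resolution_of_identity (E : set R -> gfun -> gfun) : Prop :=
  is_pvm E /\ forall u w, opH u w <-> calc E (fun l => l%:C) u w.

Definition dimN : nat := #|eend|.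

Lemma dimNE : dimN = (2 * #|eB G| + #|eU G|)%N.
Proof. by rewrite /dimN card_sum card_prod card_bool mulnC. Qed.

Inductive vcond :=
  | Dirichlet of eend
  | Continuity of eend & eend
  | Kirchhoff of vert G.

Definition vcond_wf (c : vcond) : bool :=
  match c with
  | Dirichlet e => vext (vtx e)
  | Continuity e e' => vtx e == vtx e'
  | Kirchhoff v => vint v
  end.

Definition vcond_form (c : vcond) (a b : eend -> C) : C :=
  match c with
  | Dirichlet e => a e
  | Continuity e e' => a e - a e'
  | Kirchhoff v => \sum_(e | vtx e == v) b e
  end.

(* s lists, in some order, the vertex conditions of D(H) as N = dimN scalar
   equations.  Since N is their rank, s contains the Dirichlet condition of
   every exterior vertex, the Kirchhoff condition of every interior vertex, and
   #I_v - 1 equalities expressing continuity at each vertex v. *)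
Definition vertex_system (s : 'I_dimN -> vcond) : Prop :=
  (forall n, vcond_wf (s n)) /\
  forall a b, (forall n, vcond_form (s n) a b = 0) ->
    vertex_conditions predT a b.

(* The coefficients are indexed by the same type as the edge ends:
   [inl (k, true)] stands for c_k, [inl (k, false)] for d_k, and [inr k] for
   d_k; the enumeration is thus ((c_k, d_k)_k, (d_k)_k).  The solution attached
   to the coefficient j is exp(expsign j * i z x) on the edge of j. *)
Definition expsign (j : eend) : C :=
  match j with inl (_, true) => -1 | _ => 1 end.

Definition basis_fun (z : C) (j : eend) (x : R) : C :=
  Cexp (expsign j * Ci * z * x%:C).

Definition basis_val (z : C) (j e : eend) : C :=
  if edge_of e == edge_of j then basis_fun z j (epos e) else 0.

(* The outward normal derivative divided by iz. *)
Definition basis_nder (z : C) (j e : eend) : C :=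
  if edge_of e == edge_of j
  then outsign e * expsign j * basis_fun z j (epos e) else 0.

Definition Dmx (s : 'I_dimN -> vcond) (z : C) : 'M[C]_dimN :=
  \matrix_(n, j) vcond_form (s n) (basis_val z (enum_val j))
                                  (basis_nder z (enum_val j)).

(* The particular solution (2iz)^-1 \int exp(iz|x-y|) f_k(y) dy has at the edge
   end e the value F_e(z, f) and the outward normal derivative iz F_e(z, f);
   hence a vertex condition, applied to value and derivative / (iz), contributes
   to the right-hand side minus the condition evaluated at (F, F). *)
Definition Rmx (s : 'I_dimN -> vcond) : 'M[C]_dimN :=
  \matrix_(n, j) - vcond_form (s n) (fun e => (e == enum_val j)%:R)
                                    (fun e => (e == enum_val j)%:R).

(* F_{k+} at [inl (k, true)] and [inr k], F_{k-} at [inl (k, false)]. *)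
Definition Fvec (z : C) (f : gfun) : 'cV[C]_dimN :=
  \col_n (let e := enum_val n in
    (2 * Ci * z)^-1 * cint leb (edge_set (edge_of e))
      (fun y => Cexp (Ci * z * `|epos e - y|%:C) * f (edge_of e) y)).

Definition expo (r : eB G * bool -> rat) (j : eB G * bool) : R :=
  if j.2 then ratr (r j) * len j.1 else - (ratr (r j) * len j.1).

Definition exp_poly (Z : set C) (F : C -> C) : Prop :=
  exists2 r : eB G * bool -> rat, (forall j, 0 < r j) & poly_in_exp (expo r) Z F.

(* The extra variables are exp(iz) and exp(-iz). *)
Definition expo_pm (r : eB G * bool -> rat) (j : (eB G * bool) + bool) : R :=
  match j with
  | inl j => expo r j
  | inr b => if b then 1 else -1
  end.

Definition exp_poly_pm (Z : set C) (F : C -> C) : Prop :=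
  exists2 r : eB G * bool -> rat, (forall j, 0 < r j) &
    poly_in_exp (expo_pm r) Z F.

Definition simple_pole_inverse (s : 'I_dimN -> vcond) (l : R) : Prop :=
  exists (Ml : 'M[C]_dimN) (Rl : C -> 'M[C]_dimN),
    (\forall z \near ((l%:C : C^o)^'),
        Dmx s z \in unitmx /\
        invmx (Dmx s z) = (z - l%:C)^-1 *: Ml + Rl z) /\
    (forall n j, \forall z \near (l%:C : C^o),
        cderivable (fun z => Rl z n j) z).

Record A1 (s : 'I_dimN -> vcond) (dd dc : C -> C)
    (Mc Mp : C -> 'M[C]_dimN) : Prop := {
  A1_det : forall z, (Cplus `|` Creal) z -> \det (Dmx s z) = dd z * dc z;
  A1_dd_entire : entire dd;
  A1_dc_entire : entire dc;
  A1_dd_poly : exp_poly setT dd;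
  A1_dc_poly : exp_poly setT dc;
  A1_dd_zeros : forall z, (Cplus `|` Creal_star) z -> dd z = 0 <-> Sd (z ^+ 2);
  A1_dc_neq0 : forall z, Creal z -> dc z != 0;
  A1_Mc_poly : forall n j,
    exp_poly (Cplus `|` Creal_star) (fun z => Mc z n j);
  A1_Mp_poly : forall n j,
    exp_poly (Cplus `|` Creal_star) (fun z => Mp z n j);
  A1_adj : forall z, (Cplus `|` Creal_star) z ->
    \adj (Dmx s z) = Mp z + dd z *: Mc z;
  A1_pole : forall l : R, 0 < l -> Sd (l ^+ 2)%:C -> simple_pole_inverse s l;
  A1_Sd0 : Sd = set0 ->
    (forall z, dd z = 1) /\
    (forall z, (Cplus `|` Creal_star) z -> Mp z = 0)
}.

(* The identity is meaningless where d(z) = 0 and, on the real axis, for those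
   f whose Fourier integral diverges. *)
Definition A2 (s : 'I_dimN -> vcond) (dc : C -> C) (Mp : C -> 'M[C]_dimN)
    (X : eU G -> C -> 'cV[C]_dimN) : Prop :=
  forall k : eU G,
    (forall n, exp_poly_pm (Cplus `|` Creal_pos) (fun z => X k z n 0)) /\
    forall z f, (Cplus `|` Creal_pos) z -> \det (Dmx s z) != 0 -> inY k f ->
      cintegrable `]0, +oo[ (fun y => Cexp (Ci * z * y%:C) * f (inr k) y) ->
      (\det (Dmx s z))^-1 *: (Mp z *m Rmx s *m Fvec z f) =
      ((2 * Ci * z * dc z)^-1 *
        cint leb `]0, +oo[ (fun y => Cexp (Ci * z * y%:C) * f (inr k) y))
      *: X k z.

(* The kernel K_k.  For f in Y_k only the component F_{k+} of F(z, f) is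
   nonzero, whence the coefficient vector is
     (2 i z d_c(z))^-1 * (\int_0^oo exp(izy) f_k(y) dy) * kcoef k z. *)
Definition kcoef (s : 'I_dimN -> vcond) (Mc : C -> 'M[C]_dimN)
    (X : eU G -> C -> 'cV[C]_dimN) (k : eU G) (z : C) : 'cV[C]_dimN :=
  Mc z *m Rmx s *m delta_mx (enum_rank (inr k : eend)) 0 + X k z.

(* [Kkernel_z .. k j x y z] is K_k(x, y, z^2) for x on the edge j, y on the
   edge k. *)
Definition Kkernel_z (s : 'I_dimN -> vcond) (dc : C -> C) (Mc : C -> 'M[C]_dimN)
    (X : eU G -> C -> 'cV[C]_dimN) (k : eU G) (j : edge) (x y : R) (z : C) : C :=
  (2 * Ci * z)^-1 *
  ((if j == inr k then Cexp (Ci * z * `|x - y|%:C) else 0) +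
   \sum_(e : eend | edge_of e == j)
      kcoef s Mc X k z (enum_rank e) 0 / dc z *
      Cexp (Ci * z * (expsign e * x%:C + y%:C))).

Definition Kkernel (s : 'I_dimN -> vcond) (dc : C -> C) (Mc : C -> 'M[C]_dimN)
    (X : eU G -> C -> 'cV[C]_dimN) (k : eU G) (j : edge) (x y l : R) : C :=
  Kkernel_z s dc Mc X k j x y (Num.sqrt l)%:C.

End Graph.

(* Main.v *)
Require Import Defs.
From HB Require Import structures.
From mathcomp Require Import all_boot all_order all_algebra.
From mathcomp Require Import complex.
From mathcomp Require Import all_classical all_reals all_analysis.
From mathcomp Require Import measurable_realfun.
From mathcomp Require mpoly.
From mathcomp Require Import ring lra.
Set Implicit Arguments.
Unset Strict Implicit.
Unset Printing Implicit Defensive.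
Import Order.TTheory GRing.Theory Num.Theory.
Import numFieldNormedType.Exports.
Local Open Scope classical_set_scope.
Local Open Scope ring_scope.
Local Open Scope complex_scope.
Local Notation Re := complex.Re.
Local Notation Im := complex.Im.
Local Notation normc := ComplexField.Normc.normc.

(* For l > 0 and e > 0 put z = sqrt (l + i e), in the upper half-plane.  The
   kernel K_k(., ., z^2) solves the boundary value problem, so that its integral
   against f is (z^2 - H)^-1 f, and its complex conjugate gives (conj z^2 - H)^-1 f;
   here D(z) is invertible because a vector in its kernel would be an
   eigenfunction of H with the nonreal eigenvalue z^2.  Hence Im K_k at l + i e
   is, up to the factor - pi, the average of E by the Poisson kernel of width e.
   Averaging a continuous cutoff of h and letting e tend to 0 on both sides
   (Stone's formula) gives the measure (E(dl) f, g) on (a, b): on the left the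
   Poisson averages converge boundedly, on the right K_k is bounded and
   continuous up to the real axis, since d_c has no real zero and f, g have
   compact support.  Fubini's theorem exchanges the integrals. *)

(** The interval (a, b) may contain elements of S_d, at which D(z)^-1 may have poles. What saves the
    limit on the real axis is that f lives on one infinite edge: D^-1 is (M_p + d_d M_c) / (d_d
    d_c), the factor d_d cancels in the second term and (A2) removes it from the first, so that only
    d_c is left in the denominator. The link between E and H is an equality of graphs, H = \int l
    dE(l), tested on vectors of the domain only. It is therefore always used through spectral
    projections on bounded sets, for the resolvent as well as for h, which is unbounded in general.
    An atom of E at a or b would be counted by half in the limit of the Poisson averages of the
    indicator of (a, b); this is why the cutoff is continuous and vanishes at the endpoints. The
    square root of l + i e is taken as an explicit continuous function of (l, e) down to e = 0, and
    f, g are replaced by truncated representatives, measurable on the whole line, so that domination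
    and Fubini hold without exceptional sets. *)

(* The library puts Lebesgue measure on [measurableTypeR R], whose display
   differs from that of the measurable structure of [R] used by [cint]; [lebR]
   is the same set function, as a measure on [R]. *)
Section LebesgueOnR.
Context {R : realType}.

Definition lebR : set R -> \bar R := @lebesgue_measure R.

HB.instance Definition _ := isMeasure.Build default_measure_display R R lebR
  (@measure0 _ _ _ (@lebesgue_measure R)) (@measure_ge0 _ _ _ (@lebesgue_measure R))
  (@measure_semi_sigma_additive _ _ _ (@lebesgue_measure R)).

HB.instance Definition _ := @Measure_isSigmaFinite.Build _ _ _ lebR
  (@sigma_finiteT _ _ _ (@lebesgue_measure R)).

Lemma ge0_integral_lebR (D : set R) (f : R -> \bar R) :
  measurable D -> measurable_fun D f -> (forall x, D x -> 0 <= f x)%E ->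
  (\int[lebR]_(x in D) f x = \int[@lebesgue_measure R]_(x in D) f x)%E.
Proof.
move=> mD mf f0.
have mid : measurable_fun setT (id : measurableTypeR R -> R) by [].
have /(_ mf) := @ge0_integral_pushforward _ _ (measurableTypeR R) R R
  (id : measurableTypeR R -> R) mid (@lebesgue_measure R) D f mD.
rewrite preimage_id /= => <-; first by apply: eq_measure_integral.
by move=> x /set_mem /f0.
Qed.

Lemma integral_lebR (D : set R) (f : R -> \bar R) :
  measurable D -> measurable_fun D f ->
  (\int[lebR]_(x in D) f x = \int[@lebesgue_measure R]_(x in D) f x)%E.
Proof.
move=> mD mf; rewrite integralE [RHS]integralE; congr (_ - _)%E.
- by apply: ge0_integral_lebR => //; exact: measurable_funepos.
- by apply: ge0_integral_lebR => //; exact: measurable_funeneg.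
Qed.

Lemma integrable_lebR (D : set R) (f : R -> \bar R) : measurable D ->
  lebR.-integrable D f <-> (@lebesgue_measure R).-integrable D f.
Proof.
move=> mD; split => /integrableP[mf fi]; apply/integrableP; split => //.
- by rewrite -ge0_integral_lebR//; exact: measurableT_comp.
- by rewrite ge0_integral_lebR//; exact: measurableT_comp.
Qed.

End LebesgueOnR.

(** * Complex numbers and complex-valued integrals *)

Section ComplexBasics.
Context {R : realType}.
Local Notation C := R[i].
Implicit Types x y z : C.

Lemma ReD x y : Re (x + y) = Re x + Re y. Proof. by case: x; case: y. Qed.
Lemma ImD x y : Im (x + y) = Im x + Im y. Proof. by case: x; case: y. Qed.
Lemma ReN x : Re (- x) = - Re x. Proof. by case: x. Qed.
Lemma ImN x : Im (- x) = - Im x. Proof. by case: x. Qed.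
Lemma ReB x y : Re (x - y) = Re x - Re y. Proof. by rewrite ReD ReN. Qed.
Lemma ImB x y : Im (x - y) = Im x - Im y. Proof. by rewrite ImD ImN. Qed.
Lemma ReM x y : Re (x * y) = Re x * Re y - Im x * Im y.
Proof. by case: x; case: y. Qed.
Lemma ImM x y : Im (x * y) = Re x * Im y + Im x * Re y.
Proof. by case: x; case: y. Qed.
Lemma ReJ x : Re (x^*)%R = Re x. Proof. by case: x. Qed.
Lemma ImJ x : Im (x^*)%R = - Im x. Proof. by case: x. Qed.
Lemma ceqP x y : Re x = Re y -> Im x = Im y -> x = y.
Proof. by case: x => a b; case: y => c d /= -> ->. Qed.
Lemma ReV x : Re x^-1 = Re x / sqmod x. Proof. by case: x. Qed.
Lemma ImV x : Im x^-1 = - Im x / sqmod x. Proof. by case: x => a b /=; rewrite mulNr. Qed.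
Lemma sqmod_ge0 x : 0 <= sqmod x. Proof. by rewrite addr_ge0 ?sqr_ge0. Qed.
Lemma sqmod_gt0 x : (0 < sqmod x) = (x != 0).
Proof.
rewrite lt_neqAle sqmod_ge0 andbT eq_sym; congr (~~ _).
rewrite /sqmod paddr_eq0 ?sqr_ge0// !sqrf_eq0.
by case: x => a b; rewrite eq_complex.
Qed.
Lemma normcE' x : normc x = Num.sqrt (sqmod x). Proof. by case: x. Qed.
Lemma sqr_normc' x : normc x ^+ 2 = sqmod x.
Proof. by rewrite normcE' sqr_sqrtr ?sqmod_ge0. Qed.
Lemma normc_ge0 x : 0 <= normc x. Proof. by rewrite normcE' sqrtr_ge0. Qed.
Lemma normcM' x y : normc (x * y) = normc x * normc y.
Proof. exact: ComplexField.Normc.normcM. Qed.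
Lemma normcV' x : normc x^-1 = (normc x)^-1.
Proof. exact: ComplexField.Normc.normcV. Qed.
Lemma normcD' x y : normc (x + y) <= normc x + normc y.
Proof. exact: le_normcD. Qed.
Lemma normcN' x : normc (- x) = normc x. Proof. by case: x => a b; rewrite /= !sqrrN. Qed.
Lemma normcB' x y : normc (x - y) <= normc x + normc y.
Proof. by rewrite (le_trans (normcD' _ _))// normcN'. Qed.
Lemma normcJ' x : normc (x^*)%R = normc x.
Proof. by rewrite !normcE' /sqmod ReJ ImJ sqrrN. Qed.
Lemma normcR (r : R) : normc r%:C = `|r|.
Proof. by rewrite normcE' /sqmod /= expr0n addr0 sqrtr_sqr. Qed.
Lemma normc0' : normc (0 : C) = 0. Proof. exact: ComplexField.Normc.normc0. Qed.
Lemma normc1' : normc (1 : C) = 1. Proof. exact: ComplexField.Normc.normc1. Qed.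
Lemma normc_eq0' x : (normc x == 0) = (x == 0).
Proof.
apply/eqP/eqP => [/ComplexField.Normc.eq0_normc//|->]; exact: normc0'.
Qed.
Lemma normc_gt0 x : (0 < normc x) = (x != 0).
Proof. by rewrite lt_neqAle normc_ge0 andbT eq_sym normc_eq0'. Qed.
Lemma absRe_le x : `|Re x| <= normc x.
Proof. by rewrite normcE' -sqrtr_sqr ler_wsqrtr// lerDl sqr_ge0. Qed.
Lemma absIm_le x : `|Im x| <= normc x.
Proof. by rewrite normcE' -sqrtr_sqr ler_wsqrtr// lerDr sqr_ge0. Qed.
Lemma normc_le_abs x : normc x <= `|Re x| + `|Im x|.
Proof.
rewrite -ler_sqr ?nnegrE ?normc_ge0 ?addr_ge0// sqr_normc' /sqmod.
by rewrite sqrrD !real_normK ?num_real// addrAC lerDl mulrn_wge0// mulr_ge0.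
Qed.
Lemma sqmodM x y : sqmod (x * y) = sqmod x * sqmod y.
Proof. by rewrite -!sqr_normc' normcM' exprMn. Qed.
Lemma sqmodD x y : sqmod (x + y) <= 2 * sqmod x + 2 * sqmod y.
Proof.
rewrite /sqmod ReD ImD -subr_ge0.
have -> : 2 * (Re x ^+ 2 + Im x ^+ 2) + 2 * (Re y ^+ 2 + Im y ^+ 2) -
  ((Re x + Re y) ^+ 2 + (Im x + Im y) ^+ 2) =
  (Re x - Re y) ^+ 2 + (Im x - Im y) ^+ 2 by ring.
by rewrite addr_ge0 ?sqr_ge0.
Qed.
Lemma sqmodJ x : sqmod (x^*)%R = sqmod x.
Proof. by rewrite -!sqr_normc' normcJ'. Qed.
Lemma mulcJ x : x * (x^*)%R = (sqmod x)%:C.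
Proof. by apply: ceqP; rewrite ?ReM ?ImM ?ReJ ?ImJ /sqmod/=; ring. Qed.
Lemma normcX' x n : normc (x ^+ n) = normc x ^+ n.
Proof. by elim: n => [|n ih]; rewrite ?expr0 ?normc1'// !exprS normcM' ih. Qed.
Lemma normc_sum (I : Type) (r : seq I) (P : pred I) (F : I -> C) :
  normc (\sum_(i <- r | P i) F i) <= \sum_(i <- r | P i) normc (F i).
Proof.
elim/big_rec2: _ => [|i y1 y2 _ h]; first by rewrite normc0'.
by rewrite (le_trans (normcD' _ _))// lerD2l.
Qed.
Lemma normcCi : normc (Ci : C) = 1.
Proof. by rewrite normcE' /sqmod /= expr0n add0r expr1n sqrtr1. Qed.
Lemma Ci_neq0 : (Ci : C) != 0. Proof. by rewrite -normc_eq0' normcCi oner_eq0. Qed.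
Lemma CiJ : ((Ci : C)^*)%R = - Ci.
Proof. by apply: ceqP; rewrite ?ReJ ?ImJ ?ReN ?ImN/= ?oppr0. Qed.
Lemma Ci2 : (Ci : C) * Ci = -1.
Proof. by apply: ceqP; rewrite ?ReM ?ImM /=; ring. Qed.

Lemma CexpD x y : Cexp (x + y) = Cexp x * Cexp y.
Proof.
rewrite /Cexp ReD ImD; apply: ceqP; rewrite ?ReM ?ImM/= expRD ?cosD ?sinD; ring.
Qed.
Lemma Cexp0 : Cexp 0 = 1 :> C.
Proof. by apply: ceqP; rewrite /= expR0 ?cos0 ?sin0 ?mulr1 ?mulr0. Qed.
Lemma sqmod_Cexp x : sqmod (Cexp x) = expR (Re x) ^+ 2.
Proof. by rewrite /sqmod/= !exprMn -mulrDr cos2Dsin2 mulr1. Qed.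
Lemma normc_Cexp x : normc (Cexp x) = expR (Re x).
Proof. by rewrite normcE' sqmod_Cexp sqrtr_sqr gtr0_norm ?expR_gt0. Qed.
End ComplexBasics.

Section ComplexConvergence.
Context {R : realType}.
Local Notation C := R[i].

(** Convergence by components reduces the closure properties to limits of real functions;
    [ccvg_normcP] recovers the epsilon form. *)
Definition ccvg {T : Type} (F : set_system T) (f : T -> C) (l : C) : Prop :=
  (Re (f t) @[t --> F] --> Re l) /\ (Im (f t) @[t --> F] --> Im l).

Section closure.
Context {T : Type} {F : set_system T} {FF : Filter F}.
Implicit Types (f g : T -> C) (l m : C).

Lemma ccvg_cst l : ccvg F (fun=> l) l.
Proof. by split; exact: cvg_cst. Qed.

Lemma ccvg_ext f g l : (forall t, f t = g t) -> ccvg F f l -> ccvg F g l.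
Proof. by move=> /funext ->. Qed.

Lemma ccvg_near f g l : (\forall t \near F, f t = g t) -> ccvg F f l -> ccvg F g l.
Proof.
move=> fg [f1 f2]; split.
- apply: cvg_trans f1; apply: near_eq_cvg.
  by apply: filterS fg => t ->.
- apply: cvg_trans f2; apply: near_eq_cvg.
  by apply: filterS fg => t ->.
Qed.

Lemma ccvg_squeeze f l (e : T -> R) : (\forall t \near F, normc (f t - l) <= e t) ->
  e t @[t --> F] --> 0 -> ccvg F f l.
Proof.
move=> fe e0.
have key (p : C -> R) : (forall z, `|p z| <= normc z) ->
    (forall z z', p (z - z') = p z - p z') -> p (f t) @[t --> F] --> p l.
  move=> pn pB; apply: cvg_zero.
  apply: norm_cvg0; apply: (@squeeze_cvgr _ _ _ _ (fun=> 0) e) => //; last exact: cvg_cst.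
  apply: filterS fe => t ft; rewrite /= normr_ge0/=.
  by apply: le_trans ft; apply: le_trans (pn _); rewrite pB.
split; apply: key; [exact: absRe_le|exact: ReB|exact: absIm_le|exact: ImB].
Qed.

Lemma ccvg_normcP f l : ccvg F f l <->
  forall e, 0 < e -> \forall t \near F, normc (f t - l) <= e.
Proof.
split=> [[/cvgrPdist_le f1 /cvgrPdist_le f2] e e0|fe].
  have e2 : 0 < e / 2 by rewrite divr_gt0.
  apply: filterS2 (f1 _ e2) (f2 _ e2) => t h1 h2.
  rewrite (le_trans (normc_le_abs _))// ReB ImB (splitr e).
  by rewrite lerD// distrC.
split; apply/cvgrPdist_le => e e0; apply: filterS (fe e e0) => t h.
- by rewrite distrC -ReB (le_trans (absRe_le _)).
- by rewrite distrC -ImB (le_trans (absIm_le _)).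
Qed.

Lemma ccvg_real (r : T -> R) (a : R) : r t @[t --> F] --> a ->
  ccvg F (fun t => (r t)%:C) a%:C.
Proof. by move=> ra; split => //=; exact: cvg_cst. Qed.

Lemma ccvgD f g l m : ccvg F f l -> ccvg F g m ->
  ccvg F (fun t => f t + g t) (l + m).
Proof.
move=> [f1 f2] [g1 g2]; split.
- rewrite ReD; under eq_cvg do rewrite ReD; exact: cvgD.
- rewrite ImD; under eq_cvg do rewrite ImD; exact: cvgD.
Qed.

Lemma ccvgM f g l m : ccvg F f l -> ccvg F g m ->
  ccvg F (fun t => f t * g t) (l * m).
Proof.
move=> [f1 f2] [g1 g2]; split.
- rewrite ReM; under eq_cvg do rewrite ReM.
  by apply: cvgB; exact: cvgM.
- rewrite ImM; under eq_cvg do rewrite ImM.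
  by apply: cvgD; exact: cvgM.
Qed.

Lemma ccvgN f l : ccvg F f l -> ccvg F (fun t => - f t) (- l).
Proof.
move=> [f1 f2]; split.
- rewrite ReN; under eq_cvg do rewrite ReN; exact: cvgN.
- rewrite ImN; under eq_cvg do rewrite ImN; exact: cvgN.
Qed.

Lemma ccvg_sum (I : Type) (r : seq I) (P : pred I) (f : I -> T -> C) (l : I -> C) :
  (forall i, P i -> ccvg F (f i) (l i)) ->
  ccvg F (fun t => \sum_(i <- r | P i) f i t) (\sum_(i <- r | P i) l i).
Proof.
move=> fl; elim: r => [|i r ih].
  by rewrite big_nil; under [X in ccvg _ X]eq_fun do rewrite big_nil;
    exact: ccvg_cst.
rewrite big_cons; under [X in ccvg _ X]eq_fun do rewrite big_cons.
by case: ifPn => // Pi; apply: ccvgD => //; exact: fl.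
Qed.

Lemma ccvg_prod (I : Type) (r : seq I) (P : pred I) (f : I -> T -> C) (l : I -> C) :
  (forall i, P i -> ccvg F (f i) (l i)) ->
  ccvg F (fun t => \prod_(i <- r | P i) f i t) (\prod_(i <- r | P i) l i).
Proof.
move=> fl; elim: r => [|i r ih].
  by rewrite big_nil; under [X in ccvg _ X]eq_fun do rewrite big_nil;
    exact: ccvg_cst.
rewrite big_cons; under [X in ccvg _ X]eq_fun do rewrite big_cons.
by case: ifPn => // Pi; apply: ccvgM => //; exact: fl.
Qed.

Lemma ccvgX f l n : ccvg F f l -> ccvg F (fun t => f t ^+ n) (l ^+ n).
Proof.
move=> fl; elim: n => [|n ih].
  by rewrite expr0; under [X in ccvg _ X]eq_fun do rewrite expr0; exact: ccvg_cst.
by rewrite exprS; under [X in ccvg _ X]eq_fun do rewrite exprS; exact: ccvgM.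
Qed.

Lemma ccvg_Cexp f l : ccvg F f l -> ccvg F (fun t => Cexp (f t)) (Cexp l).
Proof.
move=> [f1 f2]; split => /=; apply: cvgM.
- exact: (cvg_comp _ _ f1 (@continuous_expR R _)).
- exact: (cvg_comp _ _ f2 (@continuous_cos R _)).
- exact: (cvg_comp _ _ f1 (@continuous_expR R _)).
- exact: (cvg_comp _ _ f2 (@continuous_sin R _)).
Qed.

Lemma cvg_sqmod f l : ccvg F f l -> sqmod (f t) @[t --> F] --> sqmod l.
Proof. by move=> [f1 f2]; rewrite /sqmod; apply: cvgD; apply: cvgM. Qed.

Lemma cvg_normc f l : ccvg F f l -> (normc (f t) : R) @[t --> F] --> (normc l : R).
Proof.
move=> fl; rewrite normcE' (_ : (fun t => normc (f t)) = fun t => Num.sqrt (sqmod (f t))).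
  by apply: continuous_cvg; [exact: sqrt_continuous|exact: cvg_sqmod].
by apply/funext => t; rewrite normcE'.
Qed.

Lemma ccvgV f l : l != 0 -> ccvg F f l -> ccvg F (fun t => (f t)^-1) l^-1.
Proof.
move=> l0 fl; have sl := cvg_sqmod fl; have [f1 f2] := fl.
have s0 : sqmod l != 0 by rewrite gt_eqF// sqmod_gt0.
split.
- rewrite ReV; under eq_cvg do rewrite ReV.
  by apply: cvgM => //; exact: cvgV.
- rewrite ImV; under eq_cvg do rewrite ImV.
  by apply: cvgM; [exact: cvgN|exact: cvgV].
Qed.

End closure.

Lemma ccvg_unique {T : Type} {F : set_system T} {FF : ProperFilter F}
  (f : T -> C) l m : ccvg F f l -> ccvg F f m -> l = m.
Proof.
move=> [f1 f2] [g1 g2]; apply: ceqP; exact: (cvg_unique _ f1 g1) || exact: (cvg_unique _ f2 g2).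
Qed.

Lemma normc_lim_le (f : nat -> C) l (M : R) : ccvg \oo f l ->
  (forall n, normc (f n) <= M) -> normc l <= M.
Proof.
move=> /cvg_normc fl fM.
have h : \forall n \near \oo, (normc (f n) : R) <= M by apply: nearW => n; exact: fM.
exact: (cvgr_to_le fl h).
Qed.

Definition ccont {T : topologicalType} (f : T -> C) : Prop :=
  forall t, ccvg (nbhs t) f (f t).

Lemma ccont_Re {T : topologicalType} (f : T -> C) : ccont f -> continuous (fun t => Re (f t) : R).
Proof. by move=> cf t; case: (cf t). Qed.
Lemma ccont_Im {T : topologicalType} (f : T -> C) : ccont f -> continuous (fun t => Im (f t) : R).
Proof. by move=> cf t; case: (cf t). Qed.

End ComplexConvergence.

Section ComplexMeasurable.
Context {R : realType} {d} {T : measurableType d} (D : set T).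
Local Notation C := R[i].
Implicit Types f g : T -> C.

(** The domain is an arbitrary measurable space, so that the notion also applies on the products
    that occur in Fubini's theorem. *)
Definition cmfun f : Prop :=
  measurable_fun D (fun x => Re (f x)) /\ measurable_fun D (fun x => Im (f x)).

Lemma cmfun_cst c : cmfun (fun=> c).
Proof. by split; exact: measurable_cst. Qed.

Lemma cmfun_real (r : T -> R) : measurable_fun D r -> cmfun (fun x => (r x)%:C).
Proof. by move=> mr; split => //=; exact: measurable_cst. Qed.

Lemma cmfunD f g : cmfun f -> cmfun g -> cmfun (fun x => f x + g x).
Proof.
move=> [f1 f2] [g1 g2]; split.
- under eq_fun do rewrite ReD; exact: measurable_funD.
- under eq_fun do rewrite ImD; exact: measurable_funD.
Qed.

Lemma cmfunM f g : cmfun f -> cmfun g -> cmfun (fun x => f x * g x).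
Proof.
move=> [f1 f2] [g1 g2]; split.
- under eq_fun do rewrite ReM.
  by apply: measurable_funB; exact: measurable_funM.
- under eq_fun do rewrite ImM.
  by apply: measurable_funD; exact: measurable_funM.
Qed.

Lemma cmfunN f : cmfun f -> cmfun (fun x => - f x).
Proof.
move=> mf; have := cmfunM (cmfun_cst (-1)) mf.
by under eq_fun do rewrite mulN1r.
Qed.

Lemma cmfunB f g : cmfun f -> cmfun g -> cmfun (fun x => f x - g x).
Proof. by move=> mf mg; apply: cmfunD => //; exact: cmfunN. Qed.

Lemma cmfunJ f : cmfun f -> cmfun (fun x => (f x)^*%R).
Proof.
move=> [f1 f2]; split.
- by under eq_fun do rewrite ReJ.
- by under eq_fun do rewrite ImJ; exact: measurable_funN.
Qed.

Lemma cmfun_sum (I : Type) (r : seq I) (P : pred I) (f : I -> T -> C) :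
  (forall i, P i -> cmfun (f i)) -> cmfun (fun t => \sum_(i <- r | P i) f i t).
Proof.
move=> mf; elim: r => [|i r ih].
  by under eq_fun do rewrite big_nil; exact: cmfun_cst.
under eq_fun do rewrite big_cons.
by case Pi: (P i) => //; apply: cmfunD => //; exact: mf.
Qed.

Lemma cmfun_Cexp f : cmfun f -> cmfun (fun x => Cexp (f x)).
Proof.
move=> [f1 f2]; split => /=; apply: measurable_funM.
- exact: (measurableT_comp (@measurable_expR R)).
- apply: measurableT_comp => //.
  by apply: continuous_measurable_fun; exact: continuous_cos.
- exact: (measurableT_comp (@measurable_expR R)).
- apply: measurableT_comp => //.
  by apply: continuous_measurable_fun; exact: continuous_sin.
Qed.

Lemma measurable_sqmod f : cmfun f -> measurable_fun D (fun x => sqmod (f x)).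
Proof.
move=> [f1 f2]; apply: measurable_funD; exact: measurable_funX.
Qed.

Lemma measurable_normc f : cmfun f -> measurable_fun D (fun x => normc (f x)).
Proof.
move=> mf; under eq_fun do rewrite normcE'.
apply: measurableT_comp; last exact: measurable_sqmod.
by apply: continuous_measurable_fun => x; exact: sqrt_continuous.
Qed.

Lemma cmfunV f : cmfun f -> cmfun (fun x => (f x)^-1).
Proof.
move=> mf; have [f1 f2] := mf.
(* The inverse is the power of exponent -1, a measurable function on the whole line, with value 0 at
   0. *)
have mV : measurable_fun D (fun x => (sqmod (f x))^-1).
  under eq_fun do rewrite -(powR_inv1 (sqmod_ge0 _)).
  exact: (measurableT_comp (measurable_powR (-1)) (measurable_sqmod mf)).
split.
- by under eq_fun do rewrite ReV; exact: measurable_funM.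
- under eq_fun do rewrite ImV.
  by apply: measurable_funM => //; exact: measurable_funN.
Qed.

End ComplexMeasurable.

Lemma cmfunTS {R : realType} d (T : measurableType d) (D : set T) (f : T -> R[i]) :
  cmfun setT f -> cmfun D f.
Proof. by move=> [f1 f2]; split; exact: measurable_funTS. Qed.

Lemma cmfun_comp {R : realType} d (T : measurableType d) d' (T' : measurableType d')
  (f : T -> R[i]) (g : T' -> T) :
  cmfun setT f -> measurable_fun setT g -> cmfun setT (fun x => f (g x)).
Proof. by move=> [f1 f2] mg; split; [exact: (measurableT_comp f1)|exact: (measurableT_comp f2)]. Qed.

(** * Integrals of complex-valued functions *)

Section ComplexIntegral.
Context {R : realType}.
Local Notation C := R[i].

Section one_measure.
Variable mu : {measure set R -> \bar R}.
Variables (D : set R) (mD : measurable D).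
Implicit Types f g : R -> C.

Definition cig f : Prop :=
  mu.-integrable D (fun x => (Re (f x))%:E) /\
  mu.-integrable D (fun x => (Im (f x))%:E).

Lemma cig_cmfun f : cig f -> cmfun D f.
Proof.
by move=> [f1 f2]; split; apply/measurable_EFinP; exact: (measurable_int mu).
Qed.

Lemma cig_dom f (A : R -> R) : cmfun D f -> mu.-integrable D (EFin \o A) ->
  (forall x, D x -> normc (f x) <= A x) -> cig f.
Proof.
move=> [f1 f2] iA fA; split.
- apply: (le_integrable mD _ _ iA); first exact/measurable_EFinP.
  move=> x Dx; rewrite /= lee_fin (le_trans (absRe_le _))//.
  by rewrite (le_trans (fA x Dx))// ler_norm.
- apply: (le_integrable mD _ _ iA); first exact/measurable_EFinP.
  move=> x Dx; rewrite /= lee_fin (le_trans (absIm_le _))//.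
  by rewrite (le_trans (fA x Dx))// ler_norm.
Qed.

Lemma cig_normc f : cig f -> mu.-integrable D (EFin \o (fun x => normc (f x))).
Proof.
move=> cf; have [f1 f2] := cf.
have i1 := integrable_abse f1; have i2 := integrable_abse f2.
apply: (le_integrable mD _ _ (integrableD mD i1 i2)).
  by apply/measurable_EFinP; apply: measurable_normc; exact: cig_cmfun.
move=> x Dx; rewrite /= lee_fin ger0_norm ?normc_ge0//.
by rewrite ger0_norm ?addr_ge0// normc_le_abs.
Qed.

Lemma cigD f g : cig f -> cig g -> cig (fun x => f x + g x).
Proof.
move=> [f1 f2] [g1 g2]; split.
- by under eq_fun do rewrite ReD EFinD; exact: integrableD.
- by under eq_fun do rewrite ImD EFinD; exact: integrableD.
Qed.

Lemma cigZ c f : cig f -> cig (fun x => c * f x).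
Proof.
move=> cf.
have ic : mu.-integrable D (EFin \o (fun x => normc c * normc (f x))).
  have := integrableZl mD (normc c) (cig_normc cf).
  by apply: eq_integrable => // x _ /=; rewrite EFinM.
apply: (cig_dom _ ic).
  by apply: cmfunM; [exact: cmfun_cst|exact: cig_cmfun].
by move=> x _; rewrite normcM'.
Qed.

Lemma cig0 : cig (fun=> 0).
Proof. by split; exact: integrable0. Qed.

Lemma cig_sum (I : Type) (r : seq I) (P : pred I) (f : I -> R -> C) :
  (forall i, P i -> cig (f i)) -> cig (fun x => \sum_(i <- r | P i) f i x).
Proof.
move=> cf; elim: r => [|i r ih].
  by under [X in cig X]eq_fun do rewrite big_nil; exact: cig0.
under [X in cig X]eq_fun do rewrite big_cons.
by case Pi: (P i) => //; apply: cigD => //; exact: cf.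
Qed.

Lemma eq_cig f g : (forall x, D x -> f x = g x) -> cig f -> cig g.
Proof.
move=> fg [f1 f2]; split.
- by apply: eq_integrable f1 => // x /set_mem Dx; rewrite fg.
- by apply: eq_integrable f2 => // x /set_mem Dx; rewrite fg.
Qed.

Lemma eq_cint f g : (forall x, D x -> f x = g x) -> cint mu D f = cint mu D g.
Proof.
move=> fg; rewrite /cint; congr (fine _ +i* fine _);
by apply: eq_integral => x /set_mem Dx; rewrite fg.
Qed.

Lemma ae_eq_cint f g : cmfun D f -> cmfun D g ->
  {ae mu, forall x, D x -> f x = g x} -> cint mu D f = cint mu D g.
Proof.
move=> [f1 f2] [g1 g2] fg; rewrite /cint; congr (fine _ +i* fine _).
- apply: ae_eq_integral => //; [exact/measurable_EFinP|exact/measurable_EFinP|].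
  by apply: filterS fg => x fg Dx; rewrite fg.
- apply: ae_eq_integral => //; [exact/measurable_EFinP|exact/measurable_EFinP|].
  by apply: filterS fg => x fg Dx; rewrite fg.
Qed.

Lemma cintD f g : cig f -> cig g ->
  cint mu D (fun x => f x + g x) = cint mu D f + cint mu D g.
Proof.
move=> [f1 f2] [g1 g2]; apply: ceqP; rewrite ?ReD ?ImD /=.
- by under eq_integral do rewrite ReD; exact: RintegralD.
- by under eq_integral do rewrite ImD; exact: RintegralD.
Qed.

Lemma cintZ c f : cig f -> cint mu D (fun x => c * f x) = c * cint mu D f.
Proof.
move=> [f1 f2].
have iZ (r : R) (h : R -> R) : mu.-integrable D (EFin \o h) ->
    mu.-integrable D (EFin \o (fun x => r * h x)).
  by move=> ih; have := integrableZl mD r ih; apply: eq_integrable => // x _ /=; rewrite EFinM.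
apply: ceqP; rewrite ?ReM ?ImM /=.
- under eq_integral do rewrite ReM.
  by rewrite -!(@RintegralZl _ _ _ mu)// -RintegralB//; exact: iZ.
- under eq_integral do rewrite ImM.
  by rewrite -!(@RintegralZl _ _ _ mu)// -RintegralD//; exact: iZ.
Qed.

Lemma cint0 : cint mu D (fun=> 0) = 0.
Proof. by apply: ceqP => /=; rewrite integral0. Qed.

Lemma cintN f : cig f -> cint mu D (fun x => - f x) = - cint mu D f.
Proof.
by move=> cf; rewrite -mulN1r -cintZ//; apply: eq_cint => x _; rewrite mulN1r.
Qed.

Lemma cintB f g : cig f -> cig g ->
  cint mu D (fun x => f x - g x) = cint mu D f - cint mu D g.
Proof.
move=> cf cg; rewrite cintD// ?cintN//.
by apply: eq_cig (cigZ (-1) cg) => x _; rewrite mulN1r.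
Qed.

Lemma cintJ f : cig f -> cint mu D (fun x => (f x)^*%R) = (cint mu D f)^*%R.
Proof.
move=> [f1 f2]; apply: ceqP; rewrite ?ReJ ?ImJ /=.
- by under eq_integral do rewrite ReJ.
- under eq_integral do rewrite ImJ -mulN1r.
  by rewrite -[RHS]mulN1r; exact: RintegralZl.
Qed.

Lemma cint_sum (I : Type) (r : seq I) (P : pred I) (f : I -> R -> C) :
  (forall i, P i -> cig (f i)) ->
  cint mu D (fun x => \sum_(i <- r | P i) f i x) =
  \sum_(i <- r | P i) cint mu D (f i).
Proof.
move=> cf; elim: r => [|i r ih].
  by rewrite big_nil -[RHS]cint0; apply: eq_cint => x _; rewrite big_nil.
rewrite big_cons -ih; case: ifPn => Pi; last first.
  by apply: eq_cint => x _; rewrite big_cons (negbTE Pi).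
rewrite -cintD; [|exact: cf|exact: cig_sum].
by apply: eq_cint => x _; rewrite big_cons Pi.
Qed.

(** The factor 2 comes from bounding the real and the imaginary part separately by the integral of
    [A]. *)
Lemma normc_cint_le f (A : R -> R) : cmfun D f -> mu.-integrable D (EFin \o A) ->
  (forall x, D x -> normc (f x) <= A x) ->
  normc (cint mu D f) <= 2 * fine (\int[mu]_(x in D) (A x)%:E).
Proof.
move=> mf iA fA; have [f1 f2] := cig_dom mf iA fA.
rewrite (le_trans (normc_le_abs _))//= mulrDl mul1r lerD//.
- apply: le_trans (le_normr_Rintegral mD f1) _.
  apply: le_Rintegral => //; first exact: integrable_norm.
  by move=> x Dx; rewrite (le_trans (absRe_le _))// fA.
- apply: le_trans (le_normr_Rintegral mD f2) _.
  apply: le_Rintegral => //; first exact: integrable_norm.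
  by move=> x Dx; rewrite (le_trans (absIm_le _))// fA.
Qed.

Lemma cint_dct (fn : nat -> R -> C) f (A : R -> R) :
  (forall n, cmfun D (fn n)) -> cmfun D f -> mu.-integrable D (EFin \o A) ->
  (forall n x, D x -> normc (fn n x) <= A x) ->
  (forall x, D x -> ccvg \oo (fn ^~ x) (f x)) ->
  ccvg \oo (fun n => cint mu D (fn n)) (cint mu D f).
Proof.
move=> mfn mf iA fnA fnf.
have key (p : C -> R) : (forall z, `|p z| <= normc z) ->
   (forall n, measurable_fun D (fun x => p (fn n x))) ->
   measurable_fun D (fun x => p (f x)) ->
   (forall x, D x -> p (fn n x) @[n --> \oo] --> p (f x)) ->
   fine (\int[mu]_(x in D) (p (fn n x))%:E) @[n --> \oo] -->
   fine (\int[mu]_(x in D) (p (f x))%:E).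
  move=> pn m1 m2 cv.
  have [||||i1 _ cv1] := @dominated_convergence _ _ _ mu D mD
    (fun n x => (p (fn n x))%:E) (fun x => (p (f x))%:E) (EFin \o A) _ _ _ iA.
  - by move=> n; exact/measurable_EFinP.
  - exact/measurable_EFinP.
  - by apply: aeW => x Dx; apply/cvg_EFin; [exact: nearW|exact: cv].
  - by apply: aeW => x n Dx; rewrite /= lee_fin (le_trans (pn _))// fnA.
  by apply: fine_cvg; rewrite fineK//; exact: integrable_fin_num.
split.
- apply: key; [exact: absRe_le|by move=> n; case: (mfn n)|by case: mf|].
  by move=> x /fnf [].
- apply: key; [exact: absIm_le|by move=> n; case: (mfn n)|by case: mf|].
  by move=> x /fnf [].
Qed.

End one_measure.

Lemma cigS (mu : {measure set R -> \bar R}) (D D' : set R) f :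
  measurable D -> measurable D' -> D' `<=` D -> cig mu D f -> cig mu D' f.
Proof. by move=> mD mD' sD [f1 f2]; split; exact: integrableS sD _. Qed.

Lemma cint_setU (mu : {measure set R -> \bar R}) (A B : set R) f :
  measurable A -> measurable B -> [disjoint A & B] -> cig mu (A `|` B) f ->
  cint mu (A `|` B) f = cint mu A f + cint mu B f.
Proof.
by move=> mA mB AB [f1 f2]; apply: ceqP; rewrite ?ReD ?ImD /=; exact: Rintegral_setU.
Qed.

Section two_measures.
Variables (m1 m2 : {sigma_finite_measure set R -> \bar R}).

(** Positive and negative parts are treated separately by Tonelli's theorem; the extended difference
    and [fine] are total, so sections of infinite integral do no harm. *)
Lemma measurable_partial_int (D2 : set R) {d} {T : measurableType d} (r : T * R -> R) :
  measurable D2 -> measurable_fun setT r ->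
  measurable_fun setT (fun x => fine (\int[m2]_(y in D2) (r (x, y))%:E)).
Proof.
move=> mD2 mr; apply: measurableT_comp => //.
have mg : measurable_fun setT ((EFin \o r) \_ (setT `*` D2)).
  apply/(measurable_restrictT _ _).1; first exact: measurableX.
  by apply: measurable_funTS; exact/measurable_EFinP.
have -> : (fun x => \int[m2]_(y in D2) (r (x, y))%:E)%E =
    (fun x => \int[m2]_y ((EFin \o r) \_ (setT `*` D2))^\+ (x, y) -
             \int[m2]_y ((EFin \o r) \_ (setT `*` D2))^\- (x, y))%E.
  apply/funext => x; rewrite integral_mkcond.
  have -> : (fun y => (r (x, y))%:E) \_ D2 =
      (fun y => ((EFin \o r) \_ (setT `*` D2)) (x, y)).
    by apply/funext => y; rewrite /patch /= in_setX in_setT.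
  rewrite integralE; under eq_integral do rewrite funepos_comp/=.
  by under [X in (_ - X)%E = _]eq_integral do rewrite funeneg_comp/=.
apply: emeasurable_funB.
- by apply: measurable_fun_fubini_tonelli_F => //; exact: measurable_funepos.
- by apply: measurable_fun_fubini_tonelli_F => //; exact: measurable_funeneg.
Qed.

End two_measures.
End ComplexIntegral.

Section Fubini.
Context {R : realType}.
Local Notation C := R[i].
Variables (m1 m2 : {sigma_finite_measure set R -> \bar R}).
Variables (D1 D2 : set R) (mD1 : measurable D1) (mD2 : measurable D2).
Variables (A B : R -> R).
Hypotheses (iA : m1.-integrable D1 (EFin \o A)) (iB : m2.-integrable D2 (EFin \o B)).

(** The bound by a product makes the extension by zero [g] integrable on the whole plane, where
    Fubini's theorem applies. It also makes every section integrable, so that the inner [fine] loses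
    nothing. *)
Lemma Rintegral_fubini (r : R * R -> R) : measurable_fun setT r ->
  (forall x y, D1 x -> D2 y -> `|r (x, y)| <= A x * B y) ->
  fine (\int[m1]_(x in D1) (fine (\int[m2]_(y in D2) (r (x, y))%:E))%:E) =
  fine (\int[m2]_(y in D2) (fine (\int[m1]_(x in D1) (r (x, y))%:E))%:E).
Proof.
move=> mr rAB.
have mrx x : measurable_fun setT (fun y => r (x, y)).
  exact: (measurableT_comp mr (pair1_measurable x)).
have mry y : measurable_fun setT (fun x => r (x, y)).
  exact: (measurableT_comp mr (pair2_measurable y)).
have i2 x : D1 x -> m2.-integrable D2 (fun y => (r (x, y))%:E).
  move=> Dx.
  have i' : m2.-integrable D2 (EFin \o (fun y => A x * B y)).
    have := integrableZl mD2 (A x) iB.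
    by apply: eq_integrable => // y _ /=; rewrite EFinM.
  apply: (le_integrable mD2 _ _ i').
    by apply/measurable_EFinP; apply: measurable_funTS.
  by move=> y Dy; rewrite /= lee_fin (le_trans (rAB _ _ Dx Dy))// ler_norm.
have i1 y : D2 y -> m1.-integrable D1 (fun x => (r (x, y))%:E).
  move=> Dy.
  have i' : m1.-integrable D1 (EFin \o (fun x => A x * B y)).
    have := integrableZl mD1 (B y) iA.
    by apply: eq_integrable => // x _ /=; rewrite EFinM muleC.
  apply: (le_integrable mD1 _ _ i').
    by apply/measurable_EFinP; apply: measurable_funTS.
  by move=> x Dx; rewrite /= lee_fin (le_trans (rAB _ _ Dx Dy))// ler_norm.
pose g : R * R -> \bar R := (EFin \o r) \_ (D1 `*` D2).
have mg : measurable_fun setT g.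
  apply/(measurable_restrictT _ _).1; first exact: measurableX.
  by apply: measurable_funTS; exact/measurable_EFinP.
have gE x y : g (x, y) = if x \in D1 then ((fun y => (r (x, y))%:E) \_ D2) y else 0%E.
  by rewrite /g /patch in_setX /=; case: (x \in D1).
have gE' x y : g (x, y) = if y \in D2 then ((fun x => (r (x, y))%:E) \_ D1) x else 0%E.
  by rewrite /g /patch in_setX /= andbC; case: (y \in D2).
have ig : (m1 \x m2)%E.-integrable setT g.
  apply/(integrable12ltyP _ _ mg).
  have h1 x : (\int[m2]_y `|g (x, y)| <=
      ((fun x => `|A x|%:E * \int[m2]_(y in D2) `|B y|%:E) \_ D1) x)%E.
    rewrite /patch; case: ifPn => xD1; last first.
      by rewrite integral0_eq// => y _; rewrite gE (negbTE xD1) abse0.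
    have -> : (\int[m2]_y `|g (x, y)| = \int[m2]_(y in D2) `|(r (x, y))|%:E)%E.
      rewrite [RHS]integral_mkcond; apply: eq_integral => y _.
      by rewrite gE xD1 /patch; case: ifP => //; rewrite abse0.
    rewrite -ge0_integralZl//; last first.
      apply/measurable_EFinP; apply: measurableT_comp => //.
      by apply/measurable_EFinP; exact: (measurable_int m2).
    apply: ge0_le_integral => //.
    - apply/measurable_EFinP; apply: measurableT_comp => //.
      exact: measurable_funTS.
    - apply/measurable_EFinP; apply: measurable_funM => //.
      apply: measurableT_comp => //.
      by apply/measurable_EFinP; exact: (measurable_int m2).
    - move=> y Dy; rewrite -EFinM lee_fin -normrM.
      by rewrite (le_trans (rAB _ _ _ _))// ?ler_norm//; exact/set_mem.
  apply: (@le_lt_trans _ _ (\int[m1]_x ((fun x => `|A x|%:E * \int[m2]_(y in D2) `|B y|%:E) \_ D1) x)%E).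
    apply: ge0_le_integral => //.
    - by move=> x _; exact: integral_ge0.
    - apply: (measurable_fun_fubini_tonelli_F (abse \o g)) => //=.
      exact: measurableT_comp.
    - apply/(measurable_restrictT _ _).1 => //.
      apply: emeasurable_funM => //.
      apply/measurable_EFinP; apply: measurableT_comp => //.
      by apply/measurable_EFinP; exact: (measurable_int m1).
  have fB : (\int[m2]_(y in D2) `|B y|%:E < +oo)%E by case/integrableP : iB.
  have fA : (\int[m1]_(x in D1) `|A x|%:E < +oo)%E by case/integrableP : iA.
  rewrite -integral_mkcond ge0_integralZr//.
  - by rewrite lte_mul_pinfty// ?integral_ge0// ge0_fin_numE// integral_ge0.
  - apply/measurable_EFinP; apply: measurableT_comp => //.
    by apply/measurable_EFinP; exact: (measurable_int m1).
  - exact: integral_ge0.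
congr fine.
have -> : (\int[m1]_(x in D1) (fine (\int[m2]_(y in D2) (r (x, y))%:E))%:E =
    \int[m1]_x \int[m2]_y g (x, y))%E.
  rewrite integral_mkcond; apply: eq_integral => x _; rewrite /patch.
  case: ifPn => xD1; last first.
    by rewrite integral0_eq// => y _; rewrite gE (negbTE xD1).
  rewrite fineK; last by apply: integrable_fin_num => //; apply: i2; exact/set_mem.
  rewrite [LHS]integral_mkcond; apply: eq_integral => y _.
  by rewrite gE xD1.
rewrite Fubini//; apply/esym.
rewrite integral_mkcond; apply: eq_integral => y _; rewrite /patch.
case: ifPn => yD2; last first.
  by rewrite integral0_eq// => x _; rewrite gE' (negbTE yD2).
rewrite fineK; last by apply: integrable_fin_num => //; apply: i1; exact/set_mem.
rewrite [LHS]integral_mkcond; apply: eq_integral => x _.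
by rewrite gE' yD2.
Qed.

Lemma cint_fubini (F : R -> R -> C) : cmfun setT (fun p : R * R => F p.1 p.2) ->
  (forall x y, D1 x -> D2 y -> normc (F x y) <= A x * B y) ->
  cint m1 D1 (fun x => cint m2 D2 (fun y => F x y)) =
  cint m2 D2 (fun y => cint m1 D1 (fun x => F x y)).
Proof.
move=> [F1 F2] FAB; apply: ceqP => /=.
- apply: (Rintegral_fubini F1) => x y Dx Dy.
  by rewrite (le_trans (absRe_le _))// FAB.
- apply: (Rintegral_fubini F2) => x y Dx Dy.
  by rewrite (le_trans (absIm_le _))// FAB.
Qed.

Lemma cmfun_partial_int d (T : measurableType d) (F : T -> R -> C) :
  cmfun setT (fun p : T * R => F p.1 p.2) ->
  cmfun setT (fun x => cint m2 D2 (fun y => F x y)).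
Proof.
move=> [F1 F2]; split => /=.
- exact: (@measurable_partial_int _ _ D2 _ _ (fun p => Re (F p.1 p.2))).
- exact: (@measurable_partial_int _ _ D2 _ _ (fun p => Im (F p.1 p.2))).
Qed.

End Fubini.

(** * Square-integrable functions on the graph *)

Section L2.
Context {R : realType}.
Local Notation C := R[i].
Local Notation leb := (@lebR R).

Section square_integrable.
Variables (D : set R) (mD : measurable D).
Implicit Types f g : R -> C.

Definition l2on f : Prop :=
  cmfun D f /\ (\int[leb]_(x in D) (sqmod (f x))%:E < +oo)%E.

Lemma l2on_integrable f : l2on f ->
  leb.-integrable D (EFin \o (fun x => sqmod (f x))).
Proof.
move=> [mf fi]; apply/integrableP; split.
  by apply/measurable_EFinP; exact: measurable_sqmod.
rewrite (le_lt_trans _ fi)// le_eqVlt; apply/orP; left; apply/eqP.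
by apply: eq_integral => x _ /=; rewrite ger0_norm// sqmod_ge0.
Qed.

Lemma l2on_dom f (A : R -> R) : cmfun D f -> leb.-integrable D (EFin \o A) ->
  (forall x, D x -> sqmod (f x) <= A x) -> l2on f.
Proof.
move=> mf iA fA; split => //.
have /integrableP[mA] := iA; apply: le_lt_trans.
apply: ge0_le_integral => //.
- by move=> x _; rewrite lee_fin sqmod_ge0.
- by apply/measurable_EFinP; exact: measurable_sqmod.
- exact: measurableT_comp.
- by move=> x Dx; rewrite /= lee_fin (le_trans (fA x Dx))// ler_norm.
Qed.

Lemma l2on_comb c f g : l2on f -> l2on g -> l2on (fun x => c * f x + g x).
Proof.
move=> lf lg; have i1 := l2on_integrable lf; have i2 := l2on_integrable lg.
have i3 : leb.-integrable D (EFin \o (fun x => 2 * sqmod c * sqmod (f x) + 2 * sqmod (g x))).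
  have := integrableD mD (integrableZl mD (2 * sqmod c) i1) (integrableZl mD 2 i2).
  by apply: eq_integrable => // x _ /=.
apply: (l2on_dom _ i3).
  apply: cmfunD; last exact: lg.1.
  by apply: cmfunM; [exact: cmfun_cst|exact: lf.1].
by move=> x _; rewrite (le_trans (sqmodD _ _))// sqmodM mulrA.
Qed.

Lemma l2on_cig f g : l2on f -> l2on g -> cig leb D (fun x => f x * (g x)^*%R).
Proof.
move=> lf lg; have i1 := l2on_integrable lf; have i2 := l2on_integrable lg.
have i3 : leb.-integrable D (EFin \o (fun x => sqmod (f x) + sqmod (g x))).
  by have := integrableD mD i1 i2; apply: eq_integrable.
apply: (cig_dom mD _ i3).
  by apply: cmfunM; [exact: lf.1|exact: cmfunJ lg.1].
move=> x _; rewrite normcM' normcJ' -!sqr_normc'.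
rewrite -subr_ge0.
have := normc_ge0 (f x); have := normc_ge0 (g x); nra.
Qed.

Lemma l2on_bounded f : (leb D < +oo)%E -> cmfun D f ->
  (exists M, forall x, D x -> normc (f x) <= M) -> l2on f.
Proof.
move=> fD mf [M fM].
have iM : leb.-integrable D (EFin \o (fun=> M ^+ 2)).
  apply: measurable_bounded_integrable => //.
  by exists `|M ^+ 2|; split => // N MN x _ /=; rewrite ltW.
apply: (l2on_dom _ iM) => // x Dx.
rewrite -sqr_normc' ler_sqr ?nnegrE ?normc_ge0 ?fM//.
by rewrite (le_trans (normc_ge0 _) (fM x Dx)).
Qed.

End square_integrable.

Context {G : metric_graph R}.
Implicit Types u v w : gfun G.

Lemma measurable_edge (k : edge G) : measurable (edge_set k).
Proof. by case: k => k; exact: measurable_itv. Qed.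
Local Hint Resolve measurable_edge : core.

Lemma inL2P (P : pred (edge G)) u : inL2 P u <-> forall k, P k -> l2on (edge_set k) (u k).
Proof.
split => hu k /hu[mu fu]; split => //.
- rewrite ge0_integral_lebR//; last by move=> x _; rewrite lee_fin sqmod_ge0.
  by apply/measurable_EFinP; exact: measurable_sqmod.
- rewrite -ge0_integral_lebR//; last by move=> x _; rewrite lee_fin sqmod_ge0.
  by apply/measurable_EFinP; exact: measurable_sqmod.
Qed.

Lemma ginnerE u v : ginner u v =
  \sum_(k : edge G) cint leb (edge_set k) (fun x => u k x * (v k x)^*%R).
Proof. by []. Qed.

Lemma ae_eqfP (P : pred (edge G)) u v : ae_eqf P u v <->
  forall k, P k -> {ae leb, forall x, edge_set k x -> u k x = v k x}.
Proof. by []. Qed.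

Lemma inL2_comb P c u v : inL2 P u -> inL2 P v ->
  inL2 P (fun k x => c * u k x + v k x).
Proof.
move=> /inL2P hu /inL2P hv; apply/inL2P => k Pk.
by apply: l2on_comb => //; [exact: hu|exact: hv].
Qed.

Lemma inL2_0 P : inL2 P ((fun _ _ => 0) : gfun G).
Proof.
move=> k _; split; first exact: cmfun_cst.
by rewrite integral0_eq// => x _; rewrite /sqmod /= expr0n addr0.
Qed.

Lemma inL2Z P c u : inL2 P u -> inL2 P (fun k x => c * u k x).
Proof.
move=> hu; have := inL2_comb c hu (@inL2_0 P).
by under eq_fun do under eq_fun do rewrite addr0.
Qed.

Lemma inL2J P u : inL2 P u -> inL2 P (fun k x => (u k x)^*%R).
Proof.
move=> hu k Pk; have [mu fu] := hu k Pk; split; first exact: cmfunJ.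
by under eq_integral do rewrite sqmodJ.
Qed.

Lemma ginner_combl c u v w : inL2 predT u -> inL2 predT v -> inL2 predT w ->
  ginner (fun k x => c * u k x + v k x) w = c * ginner u w + ginner v w.
Proof.
move=> hu hv hw; rewrite !ginnerE mulr_sumr -big_split/=; apply: eq_bigr => k _.
have iu : cig leb (edge_set k) (fun x => u k x * (w k x)^*%R).
  by apply: l2on_cig => //; [exact: (inL2P _ _).1 hu k isT|exact: (inL2P _ _).1 hw k isT].
have iv : cig leb (edge_set k) (fun x => v k x * (w k x)^*%R).
  by apply: l2on_cig => //; [exact: (inL2P _ _).1 hv k isT|exact: (inL2P _ _).1 hw k isT].
rewrite -cintZ// -cintD//; last exact: cigZ.
by apply: eq_cint => x _; rewrite mulrDl mulrA.
Qed.

Lemma ginnerJ u v : inL2 predT u -> inL2 predT v ->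
  ginner v u = (ginner u v)^*%R.
Proof.
move=> hu hv; rewrite !ginnerE rmorph_sum/=; apply: eq_bigr => k _.
rewrite -cintJ//; last by apply: l2on_cig => //; [exact: (inL2P _ _).1 hu k isT|exact: (inL2P _ _).1 hv k isT].
by apply: eq_cint => x _; rewrite rmorphM /= conjCK mulrC.
Qed.

Lemma ginner_combr c u v w : inL2 predT u -> inL2 predT v -> inL2 predT w ->
  ginner w (fun k x => c * u k x + v k x) = c^*%R * ginner w u + ginner w v.
Proof.
move=> hu hv hw; rewrite ginnerJ//; last exact: inL2_comb.
by rewrite ginner_combl// rmorphD rmorphM/= -!ginnerJ.
Qed.

Lemma ginner0l v : ginner (fun _ _ => 0) v = 0.
Proof.
rewrite ginnerE big1// => k _; rewrite -[RHS](cint0 leb (edge_set k)).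
by apply: eq_cint => x _; rewrite mul0r.
Qed.

Lemma ginnerZl c u v : inL2 predT u -> inL2 predT v ->
  ginner (fun k x => c * u k x) v = c * ginner u v.
Proof.
move=> hu hv; have := ginner_combl c hu (@inL2_0 predT) hv.
by under eq_fun do under eq_fun do rewrite addr0; rewrite ginner0l addr0.
Qed.

Lemma ginnerZr c u v : inL2 predT u -> inL2 predT v ->
  ginner v (fun k x => c * u k x) = c^*%R * ginner v u.
Proof.
by move=> hu hv; rewrite ginnerJ ?ginnerZl// ?rmorphM/= -?ginnerJ//; exact: inL2Z.
Qed.

Lemma ginner_self u : inL2 predT u ->
  ginner u u = (\sum_(k : edge G) fine (\int[leb]_(x in edge_set k) (sqmod (u k x))%:E))%:C.
Proof.
move=> hu; rewrite ginnerE rmorph_sum; apply: eq_bigr => k _ /=.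
rewrite -complexr0; apply: ceqP => /=.
  congr fine; apply: eq_integral => x _; rewrite ReM ReJ ImJ /sqmod.
  by congr EFin; ring.
rewrite integral0_eq//= => x _; rewrite ImM ReJ ImJ; congr EFin; ring.
Qed.

Lemma ginner_self_ge0 u : inL2 predT u -> 0 <= Re (ginner u u).
Proof.
move=> hu; rewrite ginner_self//=; apply: sumr_ge0 => k _.
by rewrite fine_ge0// integral_ge0// => x _; rewrite lee_fin sqmod_ge0.
Qed.

Lemma ginner_self_eq0 u : inL2 predT u -> ginner u u = 0 ->
  ae_eqf predT u (fun _ _ => 0).
Proof.
move=> hu; rewrite ginner_self// => /complexI/eqP.
rewrite psumr_eq0; last first.
  by move=> k _; rewrite fine_ge0// integral_ge0// => x _; rewrite lee_fin sqmod_ge0.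
move=> /allP h k _; have [mu fu] := (inL2P _ _).1 hu k isT.
have {h} /eqP h := h k (mem_index_enum _).
have i0 : (\int[leb]_(x in edge_set k) (sqmod (u k x))%:E = 0)%E.
  rewrite -[LHS]fineK ?h// ge0_fin_numE// integral_ge0// => x _.
  by rewrite lee_fin sqmod_ge0.
have /ae_eq_integral_abs : measurable_fun (edge_set k) (fun x => (sqmod (u k x))%:E).
  by apply/measurable_EFinP; exact: measurable_sqmod.
move=> /(_ leb (measurable_edge k))[+ _].
rewrite (_ : (\int[_]_(_ in _) _)%E = 0%E); last first.
  by rewrite -i0; apply: eq_integral => x _; rewrite abse_EFin ger0_norm// sqmod_ge0.
move=> /(_ erefl); apply: filterS => x h0 Dx.
have [] := h0 Dx => /eqP; apply: contraTeq => u0.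
by rewrite gt_eqF// sqmod_gt0.
Qed.

Lemma eq_ginner u u' v v' : inL2 predT u -> inL2 predT u' -> inL2 predT v ->
  inL2 predT v' -> ae_eqf predT u u' -> ae_eqf predT v v' ->
  ginner u v = ginner u' v'.
Proof.
move=> hu hu' hv hv' uu' vv'; rewrite !ginnerE; apply: eq_bigr => k _.
apply: ae_eq_cint => //.
- by apply: cmfunM; [exact: (hu k isT).1|apply: cmfunJ; exact: (hv k isT).1].
- by apply: cmfunM; [exact: (hu' k isT).1|apply: cmfunJ; exact: (hv' k isT).1].
- by apply: filterS2 ((ae_eqfP _ _ _).1 uu' k isT) ((ae_eqfP _ _ _).1 vv' k isT) => x h1 h2 Dx; rewrite h1// h2.
Qed.

Lemma ae_eqf_refl P u : ae_eqf P u u.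
Proof. by apply/ae_eqfP => k _; exact: aeW. Qed.

Lemma ae_eqf_sym P u v : ae_eqf P u v -> ae_eqf P v u.
Proof.
by move=> /ae_eqfP uv; apply/ae_eqfP => k /uv; apply: filterS => x h Dx; rewrite h.
Qed.

Lemma ae_eqf_trans P u v w : ae_eqf P u v -> ae_eqf P v w -> ae_eqf P u w.
Proof.
move=> /ae_eqfP uv /ae_eqfP vw; apply/ae_eqfP => k Pk.
by apply: filterS2 (uv k Pk) (vw k Pk) => x h1 h2 Dx; rewrite h1// h2.
Qed.

Lemma ae_eqf_comb P c u u' v v' : ae_eqf P u u' -> ae_eqf P v v' ->
  ae_eqf P (fun k x => c * u k x + v k x) (fun k x => c * u' k x + v' k x).
Proof.
move=> /ae_eqfP uv /ae_eqfP vw; apply/ae_eqfP => k Pk.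
by apply: filterS2 (uv k Pk) (vw k Pk) => x h1 h2 Dx; rewrite h1// h2.
Qed.

End L2.

Section SetFunctionIntegral.
Import HBNNSimple.

(** The integral evaluates a set function only on level sets of simple functions, which are
    measurable. This is the passage from the bare [spec_meas] to a genuine measure. *)
Lemma eq_set_function_integral d (T : measurableType d) (R : realType)
    (m1 m2 : set T -> \bar R) (D : set T) (f : T -> \bar R) :
  (forall A, measurable A -> m1 A = m2 A) ->
  (\int[m1]_(x in D) f x = \int[m2]_(x in D) f x)%E.
Proof.
move=> m12.
have sE (h : {nnsfun T >-> R}) : sintegral m1 h = sintegral m2 h.
  apply: eq_fsbigr => x _; rewrite m12//.
rewrite /integral; congr (_ - _)%E; congr ereal_sup; apply/seteqP; split => _ [h h1 <-];
  by exists h.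
Qed.

End SetFunctionIntegral.

(** * Spectral measures and the functional calculus *)

Section SpectralMeasure.
Context {R : realType} {G : metric_graph R}.
Local Notation C := R[i].
Variables (E : set R -> gfun G -> gfun G) (hE : is_pvm E).
Implicit Types u v w : gfun G.

(** E(A) is a self-adjoint idempotent. With v = u this turns (E(A) u, u) into a squared norm, hence
    a nonnegative real number. *)
Lemma pvm_ginner_sqr A u v : measurable A -> inL2 predT u -> inL2 predT v ->
  ginner (E A u) v = ginner (E A u) (E A v).
Proof.
move=> mA hu hv; have hEu := pvm_L2 hE mA hu; have hEv := pvm_L2 hE mA hv.
rewrite -(pvm_selfadj hE mA hEu hv).
apply: eq_ginner => //; first exact: (pvm_L2 hE).
  by have := pvm_mul hE mA mA hu; rewrite setIid; exact: ae_eqf_sym.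
exact: ae_eqf_refl.
Qed.

Lemma ginner_pvm_real A u : measurable A -> inL2 predT u ->
  (Re (ginner (E A u) u))%:C = ginner (E A u) u.
Proof.
move=> mA hu; have hEu := pvm_L2 hE mA hu.
by rewrite pvm_ginner_sqr// ginner_self.
Qed.

Lemma spec_meas_ge0 A u : measurable A -> inL2 predT u -> (0 <= spec_meas E u A)%E.
Proof.
move=> mA hu; rewrite lee_fin pvm_ginner_sqr// ginner_self_ge0//.
exact: (pvm_L2 hE).
Qed.

Lemma eq_spec_meas A u v : measurable A -> inL2 predT u -> inL2 predT v ->
  ae_eqf predT (E A u) (E A v) -> spec_meas E u A = spec_meas E v A.
Proof.
move=> mA hu hv uv; rewrite /spec_meas pvm_ginner_sqr// [in RHS]pvm_ginner_sqr//.
by congr (Re _)%:E; apply: eq_ginner => //; exact: (pvm_L2 hE).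
Qed.

(** A measure must be nonnegative on every set, whereas nothing is known of [E] on nonmeasurable
    ones; hence the value 0 there. The proofs are arguments so that the measure structure can be
    attached to the term. *)
Definition smeas of is_pvm E := fun u (_ : inL2 predT u) (A : set R) =>
  if `[< measurable A >] then spec_meas E u A else 0%E.

Section smeas_def.
Variables (u : gfun G) (hu : inL2 predT u).
Local Notation mu := (smeas hE hu).

Lemma smeasE A : measurable A -> mu A = spec_meas E u A.
Proof. by move=> mA; rewrite /smeas asboolT. Qed.

Let smeas0 : mu set0 = 0%E.
Proof.
rewrite smeasE// /spec_meas.
have h0 := @inL2_0 _ G predT.
rewrite (@eq_ginner _ _ _ (fun _ _ => 0) _ u)//.
- by rewrite ginner0l.
- exact: (pvm_L2 hE).
- exact: (pvm_set0 hE).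
- exact: ae_eqf_refl.
Qed.

Let smeas_ge0 A : (0 <= mu A)%E.
Proof. by rewrite /smeas; case: asboolP => // mA; exact: spec_meas_ge0. Qed.

Let smeas_semi_sigma_additive : semi_sigma_additive mu.
Proof.
move=> F mF tF mU; rewrite smeasE//.
have := pvm_sigma_additive hE hu mF tF mU.
suff -> : (fun n => \sum_(0 <= i < n) mu (F i))%E =
   (fun n => \sum_(0 <= i < n) (Re (ginner (E (F i) u) u))%:E)%E by [].
by apply/funext => n; apply: eq_bigr => i _; rewrite smeasE.
Qed.

HB.instance Definition _ := isMeasure.Build default_measure_display R R mu
  smeas0 smeas_ge0 smeas_semi_sigma_additive.

Let smeas_fin : fin_num_fun mu.
Proof. by move=> A mA; rewrite smeasE. Qed.

HB.instance Definition _ := @Measure_isFinite.Build default_measure_display R R mu smeas_fin.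

Definition sm : {finite_measure set R -> \bar R} := mu.

Lemma smE A : measurable A -> sm A = spec_meas E u A.
Proof. exact: smeasE. Qed.

Lemma cint_spec_meas D f : cint (spec_meas E u) D f = cint sm D f.
Proof.
by rewrite /cint; congr (fine _ +i* fine _); apply: eq_set_function_integral => A mA; rewrite smE.
Qed.

End smeas_def.
End SpectralMeasure.

Section IntegralExtra.
Context {R : realType}.
Local Notation C := R[i].

Lemma cint_indic (mu : {measure set R -> \bar R}) (A : set R) (f : R -> C) :
  cint mu setT (fun x => (\1_A x)%:C * f x) = cint mu A f.
Proof.
apply: ceqP => /=; congr fine; rewrite [RHS]integral_mkcond;
  apply: eq_integral => x _; rewrite ?ReM ?ImM /= indicE /patch;
  case: (x \in A); rewrite /= ?mul1r ?mul0r ?subr0 ?addr0 //.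
Qed.

Lemma cmfun_indic (A : set R) : measurable A -> cmfun setT (fun x => (\1_A x)%:C : C).
Proof. by move=> mA; apply: cmfun_real; exact: measurable_indic. Qed.

Lemma eq_measure_cint (m1 m2 : {measure set R -> \bar R}) (D : set R) (f : R -> C) :
  (forall A, measurable A -> A `<=` D -> m1 A = m2 A) ->
  cint m1 D f = cint m2 D f.
Proof. by move=> m12; rewrite /cint; congr (fine _ +i* fine _); exact: eq_measure_integral. Qed.

Lemma eq_measure_cig (m1 m2 : {measure set R -> \bar R}) (D : set R) (f : R -> C) :
  (forall A, measurable A -> A `<=` D -> m1 A = m2 A) ->
  cig m1 D f -> cig m2 D f.
Proof.
move=> m12 [/integrableP[f1 i1] /integrableP[f2 i2]]; split; apply/integrableP; split => //.
- by rewrite -(eq_measure_integral m2 m12).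
- by rewrite -(eq_measure_integral m2 m12).
Qed.

Lemma cig_bounded (mu : {finite_measure set R -> \bar R}) (D : set R) (f : R -> C) (M : R) :
  measurable D -> cmfun D f -> (forall x, D x -> normc (f x) <= M) -> cig mu D f.
Proof.
move=> mD mf fM; apply: (cig_dom mD mf _ fM).
by apply: finite_measure_integrable_cst.
Qed.

Lemma cig_setU (mu : {measure set R -> \bar R}) (A : set R) (f : R -> C) :
  measurable A -> cig mu A f -> cig mu (~` A) f -> cig mu setT f.
Proof.
move=> mA [/integrableP[f1 i1] /integrableP[f2 i2]] [/integrableP[g1 j1] /integrableP[g2 j2]].
have mAc := measurableC mA.
have key (h : R -> \bar R) : measurable_fun A h -> measurable_fun (~` A) h ->
  (\int[mu]_(x in A) `|h x| < +oo)%E -> (\int[mu]_(x in ~` A) `|h x| < +oo)%E ->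
  mu.-integrable setT h.
  move=> h1 h2 k1 k2.
  have mh : measurable_fun (A `|` ~` A) h by apply/measurable_funU.
  rewrite -(setUv A); apply/integrableP; split => //.
  rewrite ge0_integral_setU//; first exact: lte_add_pinfty.
  - exact: measurableT_comp.
  - by apply/disj_setPS; rewrite setICr.
by split; exact: key.
Qed.

Lemma cint_split (mu : {measure set R -> \bar R}) (A : set R) (f : R -> C) :
  measurable A -> cig mu setT f ->
  cint mu setT f = cint mu A f + cint mu (~` A) f.
Proof.
move=> mA cf; rewrite -cint_setU ?setUv//; first exact: measurableC.
by apply/disj_setPS; rewrite setICr.
Qed.

End IntegralExtra.

(** * Polarization of the spectral measures *)

Section Polarization.
Context {R : realType}.
Local Notation C := R[i].
Local Notation Ci := (Ci : C).

Lemma sum4 (F : nat -> C) : \sum_(n < 4) F n = F 0%N + F 1%N + F 2%N + F 3%N.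
Proof. by rewrite !big_ord_recr big_ord0/= add0r. Qed.

Lemma CiX2 : Ci ^+ 2 = -1. Proof. by rewrite expr2 Ci2. Qed.
Lemma CiX3 : Ci ^+ 3 = - Ci. Proof. by rewrite exprS CiX2 mulrN1. Qed.

(** Meant for replacing one argument of the form by its image under E(A). On subsets of [A] the four
    measures are those of the original arguments; off [A] they all coincide with [my], and 1 + i - 1
    - i = 0 removes it. *)
Lemma polar_split (m mz : nat -> {measure set R -> \bar R})
    (my : {measure set R -> \bar R}) (A : set R) (f : R -> C) :
  measurable A ->
  (forall n B, measurable B -> B `<=` A -> mz n B = m n B) ->
  (forall n B, measurable B -> B `<=` ~` A -> my B = m n B) ->
  (forall n, cig (mz n) A f) -> cig my (~` A) f ->
  4^-1 * (\sum_(n < 4) Ci ^+ n * cint (m n) setT f) =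
  4^-1 * \sum_(n < 4) Ci ^+ n * cint (mz n) setT (fun x => (\1_A x)%:C * f x).
Proof.
move=> mA mz_m my_m cz cy; congr (_ * _).
have cm n : cig (m n) setT f.
  apply: (cig_setU mA).
  - exact: (eq_measure_cig (mz_m n)).
  - exact: (eq_measure_cig (my_m n)).
transitivity (\sum_(n < 4) (Ci ^+ n * cint (mz n) A f + Ci ^+ n * cint my (~` A) f)).
  apply: eq_bigr => n _; rewrite (cint_split mA (cm n)) mulrDr.
  by rewrite (eq_measure_cint _ (mz_m n)) (eq_measure_cint _ (my_m n)).
rewrite big_split/= -mulr_suml (sum4 (fun n => Ci ^+ n)) CiX2 CiX3 expr0 expr1.
rewrite [X in _ + X](_ : _ = 0); last by ring.
by rewrite addr0; apply: eq_bigr => n _; rewrite cint_indic.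
Qed.

End Polarization.

Section SpectralIntegral.
Context {R : realType} {G : metric_graph R}.
Local Notation C := R[i].
Local Notation Ci := (Ci : C).
Variables (E : set R -> gfun G -> gfun G) (hE : is_pvm E).
Implicit Types u v w : gfun G.

Definition pol u v n : gfun G := fun k x => u k x + Ci ^+ n * v k x.

Lemma polE u v n : pol u v n = fun k x => Ci ^+ n * v k x + u k x.
Proof. by apply/funext => k; apply/funext => x; rewrite /pol addrC. Qed.

Lemma inL2_pol u v n : inL2 predT u -> inL2 predT v -> inL2 predT (pol u v n).
Proof. by move=> hu hv; rewrite polE; exact: inL2_comb. Qed.

Lemma spec_intE f u v
    (hu : inL2 predT u) (hv : inL2 predT v) :
  spec_int E f u v =
  4^-1 * \sum_(n < 4) Ci ^+ n * cint (sm hE (inL2_pol n hu hv)) setT f.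
Proof.
rewrite /spec_int; congr (_ * _); apply: eq_bigr => n _.
by rewrite (cint_spec_meas hE (inL2_pol n hu hv)).
Qed.

Definition cbdd (f : R -> C) : Prop :=
  cmfun setT f /\ exists M, forall x, normc (f x) <= M.

Lemma cbdd_cig (mu : {finite_measure set R -> \bar R}) f : cbdd f -> cig mu setT f.
Proof. by move=> [mf [M fM]]; apply: cig_bounded => // x _; exact: fM. Qed.

Lemma cbddM f g : cbdd f -> cbdd g -> cbdd (fun x => f x * g x).
Proof.
move=> [mf [M fM]] [mg [N gN]]; split; first exact: cmfunM.
by exists (M * N) => x; rewrite normcM' ler_pM// normc_ge0.
Qed.

Lemma cbdd_cst c : cbdd (fun=> c).
Proof. by split; [exact: cmfun_cst|exists (normc c)]. Qed.

Lemma cbdd_indic A : measurable A -> cbdd (fun x => (\1_A x)%:C).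
Proof.
move=> mA; split; first exact: cmfun_indic.
by exists 1 => x; rewrite normcR indicE; case: (_ \in _); rewrite ?normr1 ?normr0.
Qed.

Lemma spec_intD u v f g : inL2 predT u -> inL2 predT v -> cbdd f -> cbdd g ->
  spec_int E (fun x => f x + g x) u v = spec_int E f u v + spec_int E g u v.
Proof.
move=> hu hv bf bg; rewrite !(spec_intE _ hu hv) -mulrDr -big_split/=; congr (_ * _).
by apply: eq_bigr => n _; rewrite cintD ?mulrDr//; exact: cbdd_cig.
Qed.

Lemma spec_intZ c u v f : inL2 predT u -> inL2 predT v -> cbdd f ->
  spec_int E (fun x => c * f x) u v = c * spec_int E f u v.
Proof.
move=> hu hv bf; rewrite !(spec_intE _ hu hv) mulrCA; congr (_ * _).
rewrite mulr_sumr; apply: eq_bigr => n _.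
by rewrite cintZ//; [rewrite mulrCA|exact: cbdd_cig].
Qed.

Lemma spec_int_sum (I : Type) (r : seq I) (P : pred I) u v (f : I -> R -> C) :
  inL2 predT u -> inL2 predT v -> (forall i, P i -> cbdd (f i)) ->
  spec_int E (fun x => \sum_(i <- r | P i) f i x) u v =
  \sum_(i <- r | P i) spec_int E (f i) u v.
Proof.
move=> hu hv bf; rewrite (spec_intE _ hu hv).
transitivity (4^-1 * \sum_(n < 4) \sum_(i <- r | P i)
    Ci ^+ n * cint (sm hE (inL2_pol n hu hv)) setT (f i)).
  congr (_ * _); apply: eq_bigr => n _; rewrite -mulr_sumr; congr (_ * _).
  by apply: cint_sum => // i Pi; apply: cbdd_cig; exact: bf.
rewrite exchange_big /= mulr_sumr; apply: eq_bigr => i _.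
by rewrite (spec_intE _ hu hv).
Qed.

Lemma spec_int_dct u v (fn : nat -> R -> C) f (M : R) : inL2 predT u -> inL2 predT v ->
  (forall n, cmfun setT (fn n)) -> cmfun setT f -> (forall n x, normc (fn n x) <= M) ->
  (forall x, ccvg \oo (fn ^~ x) (f x)) ->
  ccvg \oo (fun n => spec_int E (fn n) u v) (spec_int E f u v).
Proof.
move=> hu hv mfn mf fM fnf.
under [X in ccvg _ X]eq_fun do rewrite (spec_intE _ hu hv).
rewrite (spec_intE _ hu hv); apply: ccvgM; first exact: ccvg_cst.
apply: ccvg_sum => i _; apply: ccvgM; first exact: ccvg_cst.
apply: (@cint_dct _ _ _ _ _ _ (fun=> M)) => //.
exact: finite_measure_integrable_cst.
Qed.

(** In the sesquilinear expansion the weights i^n leave the factor 1 on (E(A) u, v), four times, and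
    factors i^n or i^(2n), of sum 0, on the other three terms. *)
Lemma polarization u v A : inL2 predT u -> inL2 predT v -> measurable A ->
  4^-1 * \sum_(n < 4) Ci ^+ n * ginner (E A (pol u v n)) (pol u v n) =
  ginner (E A u) v.
Proof.
move=> hu hv mA.
have hEu := pvm_L2 hE mA hu; have hEv := pvm_L2 hE mA hv.
have ex n : ginner (E A (pol u v n)) (pol u v n) =
    Ci ^+ n * ((Ci ^+ n)^*%R * ginner (E A v) v + ginner (E A v) u) +
    ((Ci ^+ n)^*%R * ginner (E A u) v + ginner (E A u) u).
  rewrite (@eq_ginner _ _ _ (fun k x => Ci ^+ n * E A v k x + E A u k x) _ (pol u v n)).
  - rewrite ginner_combl//; last exact: inL2_pol.
    by rewrite polE !ginner_combr.
  - by apply: (pvm_L2 hE) => //; exact: inL2_pol.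
  - exact: inL2_comb.
  - exact: inL2_pol.
  - exact: inL2_pol.
  - by rewrite polE; exact: (pvm_linear hE).
  - exact: ae_eqf_refl.
rewrite (sum4 (fun n => Ci ^+ n * ginner (E A (pol u v n)) (pol u v n))) !ex.
rewrite !rmorphXn/= CiJ sqrrN !CiX2 expr0 !expr1.
have -> : (- Ci) ^+ 3 = Ci by rewrite exprNn CiX3; ring.
rewrite CiX3; set a := ginner _ _; set b := ginner _ _; set c := ginner _ _; set d := ginner _ _.
have c2 := @Ci2 R.
have -> : Ci * (Ci * (- Ci * a + b) + (- Ci * c + d)) =
  (Ci * Ci) * (- Ci * a + b) - (Ci * Ci) * c + Ci * d by ring.
have -> : - Ci * (- Ci * (Ci * a + b) + (Ci * c + d)) =
  (Ci * Ci) * (Ci * a + b) - (Ci * Ci) * c - Ci * d by ring.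
by rewrite c2; field.
Qed.

Lemma spec_int_indic u v A : inL2 predT u -> inL2 predT v -> measurable A ->
  spec_int E (fun x => (\1_A x)%:C) u v = ginner (E A u) v.
Proof.
move=> hu hv mA; rewrite -polarization// (spec_intE _ hu hv); congr (_ * _).
apply: eq_bigr => n _; congr (_ * _).
rewrite -(ginner_pvm_real hE mA (inL2_pol n hu hv)); apply: ceqP => /=.
  rewrite integral_indic// setIT.
  exact: (congr1 fine (smE hE (inL2_pol n hu hv) mA)).
by rewrite integral0_eq.
Qed.

End SpectralIntegral.

(** * Spectral integrals and spectral projections *)

Section SpectralCalculus.
Context {R : realType} {G : metric_graph R}.
Local Notation C := R[i].
Local Notation Ci := (Ci : C).
Variables (E : set R -> gfun G -> gfun G) (hE : is_pvm E).
Implicit Types u v w : gfun G.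

Lemma pvm_pol B u v n : measurable B -> inL2 predT u -> inL2 predT v ->
  ae_eqf predT (E B (pol u v n)) (fun k x => Ci ^+ n * E B v k x + E B u k x).
Proof. by move=> mB hu hv; rewrite polE; exact: (pvm_linear hE). Qed.

Lemma pvm_sub A B u : measurable A -> measurable B -> inL2 predT u -> B `<=` A ->
  ae_eqf predT (E B (E A u)) (E B u).
Proof.
move=> mA mB hu BA; have := pvm_mul hE mB mA hu.
by rewrite (setIidl BA).
Qed.

Lemma pvm_disj A B u : measurable A -> measurable B -> inL2 predT u -> B `<=` ~` A ->
  ae_eqf predT (E B (E A u)) (fun _ _ => 0).
Proof.
move=> mA mB hu BA; have := pvm_mul hE mB mA hu.
have -> : B `&` A = set0.
  by apply/seteqP; split => // x [/BA].
by move=> h; apply: ae_eqf_trans h _; exact: (pvm_set0 hE).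
Qed.

(** |f| <= 1 + |f|^2, and the spectral measure is finite. *)
Lemma calc_dom_cig f u (hu : inL2 predT u) (D : set R) : measurable D ->
  cmfun setT f -> calc_dom E f u -> cig (sm hE hu) D f.
Proof.
move=> mD mf [_ fi]; apply: (@cigS _ _ setT) => //.
have i1 : (sm hE hu).-integrable setT (EFin \o (fun l => sqmod (f l))).
  apply/integrableP; split.
    by apply/measurable_EFinP; exact: measurable_sqmod.
  rewrite (eq_integral (fun l => (sqmod (f l))%:E)); last first.
    by move=> l _; rewrite /= ger0_norm// sqmod_ge0.
  rewrite (le_lt_trans _ fi)// le_eqVlt; apply/orP; left; apply/eqP.
  by apply: eq_set_function_integral => A mA; exact: smE.
have i2 : (sm hE hu).-integrable setT (EFin \o (fun l => 1 + sqmod (f l))).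
  have := integrableD measurableT (finite_measure_integrable_cst (sm hE hu) 1 measurableT) i1.
  by apply: eq_integrable.
apply: (cig_dom _ _ i2) => // l _; rewrite -sqr_normc'.
have := normc_ge0 (f l); nra.
Qed.

(** The spectral measure of E(A) v is carried by [A], where f is bounded. These are the vectors
    against which [calc] gets tested. *)
Lemma calc_dom_pvm f v A (M : R) : measurable A -> cmfun setT f ->
  (forall x, A x -> normc (f x) <= M) -> inL2 predT v -> calc_dom E f (E A v).
Proof.
move=> mA mf fM hv; have hEv := pvm_L2 hE mA hv; split => //.
rewrite (@eq_set_function_integral _ _ _ _ (sm hE hEv)); last first.
  by move=> B mB; apply: esym; exact: smE.
have ms : measurable_fun setT (fun x => (sqmod (f x))%:E).
  by apply/measurable_EFinP; exact: measurable_sqmod.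
rewrite -(setUv A) ge0_integral_setU//; last 4 first.
- exact: measurableC.
- by rewrite setUv.
- by move=> x _; rewrite lee_fin sqmod_ge0.
- by apply/disj_setPS; rewrite setICr.
apply: lte_add_pinfty.
  have : (sm hE hEv).-integrable A (EFin \o (fun=> M ^+ 2)).
    exact: finite_measure_integrable_cst.
  move=> /integrableP[_]; apply: le_lt_trans.
  apply: ge0_le_integral => //.
  - by move=> x _; rewrite lee_fin sqmod_ge0.
  - exact: measurable_funTS.
  - move=> x Ax; rewrite /= lee_fin ger0_norm ?sqr_ge0// -sqr_normc'.
    by rewrite ler_sqr ?nnegrE ?normc_ge0 ?fM// (le_trans (normc_ge0 _) (fM x Ax)).
have m0 : sm hE hEv (~` A) = 0%E.
  rewrite smE; last exact: measurableC.
  rewrite /spec_meas (@eq_ginner _ _ _ (fun _ _ => 0) _ (E A v))//.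
  - by rewrite ginner0l.
  - by apply: (pvm_L2 hE) => //; exact: measurableC.
  - exact: inL2_0.
  - by apply: pvm_disj => //; exact: measurableC.
  - exact: ae_eqf_refl.
rewrite null_set_integral//; last exact: measurable_funTS.
exact: measurableC.
Qed.

Lemma eq_sm A u v (hu : inL2 predT u) (hv : inL2 predT v) : measurable A ->
  ae_eqf predT (E A u) (E A v) -> sm hE hu A = sm hE hv A.
Proof. by move=> mA uv; rewrite !smE//; exact: eq_spec_meas. Qed.

(** Off [A] the vectors u + i^n E(A) v and u have the same spectral measure, which serves as [my] in
    [polar_split]. There f may be unbounded, and its integrability comes from u being in the
    domain. *)
Lemma spec_int_pvmr f u v A (M : R) : measurable A -> cmfun setT f ->
  (forall x, A x -> normc (f x) <= M) -> calc_dom E f u -> inL2 predT v ->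
  spec_int E f u (E A v) = spec_int E (fun x => (\1_A x)%:C * f x) u v.
Proof.
move=> mA mf fM fu hv; have [hu _] := fu; have hEv := pvm_L2 hE mA hv.
rewrite [LHS](spec_intE hE _ hu hEv).
rewrite [RHS](spec_intE hE _ hu hv).
apply: (polar_split (m := fun n => sm hE (inL2_pol n hu hEv))
  (mz := fun n => sm hE (inL2_pol n hu hv)) (my := sm hE hu)) => //.
- move=> n B mB BA; apply: eq_sm => //.
  apply: ae_eqf_trans (pvm_pol n mB hu hv) _.
  apply: ae_eqf_trans _ (ae_eqf_sym (pvm_pol n mB hu hEv)).
  apply: ae_eqf_comb; last exact: ae_eqf_refl.
  by apply: ae_eqf_sym; exact: pvm_sub.
- move=> n B mB BA; apply: eq_sm => //.
  apply: ae_eqf_trans _ (ae_eqf_sym (pvm_pol n mB hu hEv)).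
  apply: (@ae_eqf_trans _ _ _ _ (fun k x => Ci ^+ n * 0 + E B u k x)).
    under [X in ae_eqf _ _ X]eq_fun do under eq_fun do rewrite mulr0 add0r.
    exact: ae_eqf_refl.
  apply: ae_eqf_comb; last exact: ae_eqf_refl.
  by apply: ae_eqf_sym; exact: pvm_disj.
- by move=> n; apply: cig_bounded fM => //; exact: cmfunTS.
- by apply: calc_dom_cig => //; exact: measurableC.
Qed.

(** For B off [A], E(B) sends E(A) u + i^n v to i^n E(B) v, whose norm does not depend on n: the
    common measure [my] is that of v. *)
Lemma spec_int_pvml f u v A : measurable A -> cbdd f -> inL2 predT u -> inL2 predT v ->
  spec_int E f (E A u) v = spec_int E (fun x => (\1_A x)%:C * f x) u v.
Proof.
move=> mA bf hu hv; have hEu := pvm_L2 hE mA hu; have [mf [M fM]] := bf.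
rewrite [LHS](spec_intE hE _ hEu hv).
rewrite [RHS](spec_intE hE _ hu hv).
apply: (polar_split (m := fun n => sm hE (inL2_pol n hEu hv))
  (mz := fun n => sm hE (inL2_pol n hu hv)) (my := sm hE hv)) => //.
- move=> n B mB BA; apply: eq_sm => //.
  apply: ae_eqf_trans (pvm_pol n mB hu hv) _.
  apply: ae_eqf_trans _ (ae_eqf_sym (pvm_pol n mB hEu hv)).
  apply: ae_eqf_comb; first exact: ae_eqf_refl.
  by apply: ae_eqf_sym; exact: pvm_sub.
- move=> n B mB BA; apply: etrans (smE hE hv mB) _.
  apply: etrans _ (esym (smE hE (inL2_pol n hEu hv) mB)).
  have hEBv := pvm_L2 hE mB hv.
  have hx := inL2_pol n hEu hv.
  rewrite /spec_meas (pvm_ginner_sqr hE mB hv hv) (pvm_ginner_sqr hE mB hx hx).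
  have ae : ae_eqf predT (E B (pol (E A u) v n)) (fun k x => Ci ^+ n * E B v k x).
    apply: ae_eqf_trans (pvm_pol n mB hEu hv) _.
    under [X in ae_eqf _ _ X]eq_fun do under eq_fun do rewrite -[_ * _]addr0.
    by apply: ae_eqf_comb; [exact: ae_eqf_refl|exact: pvm_disj].
  have hz := inL2Z (Ci ^+ n) hEBv.
  rewrite [in RHS](eq_ginner _ hz _ hz ae ae); last 2 first.
  - exact: (pvm_L2 hE).
  - exact: (pvm_L2 hE).
  rewrite ginnerZl// ginnerZr// mulrA mulcJ -sqr_normc' normcX' normcCi.
  by rewrite !expr1n mul1r.
- by move=> n; apply: (@cig_bounded _ _ _ _ M) => //; exact: cmfunTS.
- by apply: (@cig_bounded _ _ _ _ M) => //; [exact: measurableC|exact: cmfunTS].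
Qed.

End SpectralCalculus.

Section FunctionalCalculus.
Context {R : realType} {G : metric_graph R}.
Local Notation C := R[i].
Local Notation Ci := (Ci : C).
Variables (E : set R -> gfun G -> gfun G) (hE : is_pvm E).
Implicit Types u v w : gfun G.

Lemma eq_spec_int f g u v : (forall x, f x = g x) -> spec_int E f u v = spec_int E g u v.
Proof. by move=> /funext ->. Qed.

Lemma spec_int1 u v : inL2 predT u -> inL2 predT v ->
  spec_int E (fun=> 1) u v = ginner u v.
Proof.
move=> hu hv; rewrite (@eq_spec_int _ (fun x => (\1_setT x)%:C)); last first.
  by move=> x; rewrite indicT.
rewrite (spec_int_indic hE)//; apply: eq_ginner => //.
- exact: (pvm_L2 hE).
- exact: (pvm_setT hE).
- exact: ae_eqf_refl.
Qed.

(** Since g need not lie in the domain of h(H), w is tested against E(B n) g with B n = [-n, n].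
    Once B n contains (a, b), as soon as n exceeds |a| + |b|, the spectral integral obtained no
    longer depends on n, while the inner products tend to (w, g). *)
Lemma ginner_calc (h : R -> C) (a b : R) f g w : cmfun setT h ->
  (forall N : R, exists M, forall x, `[- N, N]%classic x -> normc (h x) <= M) ->
  inL2 predT f -> inL2 predT g -> calc E h (E `]a, b[%classic f) w ->
  ginner w g = spec_int E (fun l => (\1_(`]a, b[%classic) l)%:C * h l) f g.
Proof.
move=> mh bh hf hg [dw hw cw].
pose B (n : nat) : set R := `[- n%:R, n%:R]%classic.
have mB n : measurable (B n) by exact: measurable_itv.
have mI : measurable `]a, b[%classic by exact: measurable_itv.
pose N0 := (Num.bound (`|a| + `|b|)).
have abN : `|a| + `|b| < N0%:R by rewrite archi_boundP ?addr_ge0.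
have key n : (N0 <= n)%N ->
    spec_int E (fun l => (\1_(B n) l)%:C) w g = spec_int E (fun l => (\1_(`]a, b[%classic) l)%:C * h l) f g.
  move=> Nn; have [M hM] := bh n%:R.
  rewrite (spec_int_indic hE)// (pvm_selfadj hE)// cw; last exact: (calc_dom_pvm hE (M := M)).
  rewrite (spec_int_pvmr hE (mB n) mh hM dw hg).
  have b1 : cbdd (fun x => (\1_(B n) x)%:C * h x).
    split; first by apply: cmfunM => //; exact: cmfun_indic.
    exists `|M| => x; rewrite normcM' normcR indicE.
    have [xB|_] := boolP (x \in B n); last by rewrite normr0 mul0r.
    rewrite normr1 mul1r (le_trans _ (ler_norm _))//; apply: hM; exact: set_mem.
  rewrite (spec_int_pvml hE mI b1 hf hg).
  apply: eq_spec_int => x; rewrite !indicE.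
  have [/set_mem xI|_] := boolP (x \in `]a, b[%classic); last by rewrite !mul0r.
  have -> : x \in B n.
    move: xI; rewrite /= in_itv/= => /andP[ax xb].
    apply/mem_set; rewrite /B/= in_itv/=.
    have : N0%:R <= n%:R :> R by rewrite ler_nat.
    move: (ler_norm a) (ler_norm b) (ler_norm (- a)) (ler_norm (- b)); rewrite !normrN.
    by move=> *; apply/andP; split; lra.
  by rewrite !mul1r.
have c1 : ccvg \oo (fun n => spec_int E (fun l => (\1_(B n) l)%:C) w g) (ginner w g).
  rewrite -(spec_int1 hw hg); apply: (@spec_int_dct _ _ _ hE _ _ _ _ 1) => //.
  - by move=> n; exact: cmfun_indic.
  - by move=> n x; rewrite normcR indicE; case: (_ \in _); rewrite ?normr1 ?normr0.
  - move=> x; apply: (ccvg_near (f := fun=> 1)); last exact: ccvg_cst.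
    exists (Num.bound `|x|) => // n /= xn; rewrite indicE mem_set//.
    rewrite /B/= in_itv/= -ler_norml.
    have := archi_boundP (normr_ge0 x); move/ltW/le_trans; apply.
    by rewrite ler_nat.
set S := spec_int E _ f g in key *.
apply: (ccvg_unique c1); apply: (ccvg_near (f := fun=> S)); last exact: ccvg_cst.
exists N0; first by [].
by move=> n Nn; rewrite [RHS]key.
Qed.

Lemma ae_spec_int (h : R -> C) (u u' v v' : gfun G) :
  inL2 predT u -> inL2 predT u' -> inL2 predT v -> inL2 predT v' ->
  ae_eqf predT u u' -> ae_eqf predT v v' -> spec_int E h u v = spec_int E h u' v'.
Proof.
move=> hu hu' hv hv' uu vv.
have key n : cint (sm hE (inL2_pol n hu hv)) setT h = cint (sm hE (inL2_pol n hu' hv')) setT h.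
  apply: eq_measure_cint => A mA _; apply: (eq_sm hE) => //.
  apply: (pvm_ae hE) => //; try exact: inL2_pol.
  by rewrite !polE; exact: ae_eqf_comb.
rewrite [LHS](spec_intE hE h hu hv) [RHS](spec_intE hE h hu' hv').
apply: (congr1 ( *%R 4^-1)); apply: eq_bigr => n _.
exact: (congr1 ( *%R (Ci ^+ n)) (key n)).
Qed.

End FunctionalCalculus.

(** * The resolvent *)

Section StepResolvent.
Context {R : realType}.
Local Notation C := R[i].

Definition grid (n j : nat) : R := (j%:R - (n.+1 ^ 2)%:R) / n.+1%:R.

Definition cell (n j : nat) : set R := `[grid n j, grid n j.+1[%classic.

(* The left endpoint values, with mesh [1 / n.+1] on [- n.+1, n.+1[. *)
Definition step_resolvent (z : C) (n : nat) (l : R) : C :=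
  \sum_(j < (2 * n.+1 ^ 2)%N) (z - (grid n j)%:C)^-1 * (\1_(cell n j) l)%:C.

Lemma abs_between (a b l : R) : a <= l -> l <= b -> `|l| <= `|a| + `|b|.
Proof.
move=> al lb; have := ler_norm b; have := ler_norm (- a); rewrite normrN.
by move=> *; have := normr_ge0 a; have := normr_ge0 b; rewrite ler_norml => *;
  apply/andP; split; lra.
Qed.

Lemma measurable_cell n j : @measurable _ R (cell n j). Proof. exact: measurable_itv. Qed.

Lemma le_grid n j k : (j <= k)%N -> grid n j <= grid n k.
Proof. by move=> jk; rewrite ler_pM2r ?invr_gt0 ?ltr0n// lerD2r ler_nat. Qed.

Lemma gridS n j : grid n j.+1 = grid n j + n.+1%:R^-1.
Proof. by rewrite /grid -natr1; field. Qed.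

Lemma cell_inj n j k l : cell n j l -> cell n k l -> j = k.
Proof.
rewrite /cell /= !in_itv/= => /andP[j1 j2] /andP[k1 k2].
have [jk|kj|//] := ltngtP j k.
- by have := lt_le_trans j2 (le_trans (le_grid n jk) k1); rewrite ltxx.
- by have := lt_le_trans k2 (le_trans (le_grid n kj) j1); rewrite ltxx.
Qed.

(** All estimates on the step function follow from this alternative: its value is the resolvent
    function at a point within one mesh, or l is far out. *)
Lemma step_resolventP (z : C) n l :
  (exists x : R, `|l - x| <= n.+1%:R^-1 /\ step_resolvent z n l = (z - x%:C)^-1) \/
  (n.+1%:R <= `|l| /\ step_resolvent z n l = 0).
Proof.
have [[j jl]|no] := pselect (exists j : 'I_(2 * n.+1 ^ 2), cell n j l).
  left; exists (grid n j); split.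
    move: jl; rewrite /cell/= in_itv/= => /andP[j1 j2].
    rewrite ger0_norm ?subr_ge0// lerBlDl (le_trans (ltW j2))//.
    by rewrite gridS.
  rewrite /step_resolvent (bigD1 j)//= indicE (mem_set jl) mulr1 big1 ?addr0// => i ij.
  rewrite indicE memNset ?mulr0// => il; move/eqP: ij; apply.
  by apply: val_inj => /=; exact: cell_inj il jl.
right; split; last first.
  rewrite /step_resolvent big1// => i _; rewrite indicE memNset ?mulr0// => il.
  by apply: no; exists i.
rewrite leNgt; apply/negP; rewrite ltr_norml => /andP[l1 l2]; apply: no.
(* On this scale the cells have length 1 and integer ends, so the cell of l has the integer part of
   [t] as index. *)
pose t := l * n.+1%:R + (n.+1 ^ 2)%:R.
have n0 : 0 < n.+1%:R :> R by rewrite ltr0n.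
have t0 : 0 <= t.
  rewrite /t expnS expn1 natrM; nra.
have tj := truncn_itv t0.
have t2 : t < (2 * n.+1 ^ 2)%:R.
  by rewrite /t !natrM mulr2n mulrDl !mul1r ltrD2r ltr_pM2r.
have jm : (Num.truncn t < 2 * n.+1 ^ 2)%N.
  by rewrite -(ltr_nat R) (le_lt_trans _ t2)//; case/andP: tj.
exists (Ordinal jm); rewrite /cell/= in_itv/= /grid.
have lE : l = (t - (n.+1 ^ 2)%:R) / n.+1%:R by rewrite /t addrK mulfK// gt_eqF.
move/andP: tj => [tj1 tj2].
by rewrite [in X in _ <= X]lE [in X in X < _]lE ler_pM2r ?invr_gt0// ltr_pM2r ?invr_gt0// lerD2r ltrD2r tj1 tj2.
Qed.

Lemma normc_resolvent (z : C) (x : R) : Im z != 0 -> normc (z - x%:C)^-1 <= `|Im z|^-1.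
Proof.
move=> z0; rewrite normcV' lef_pV2 ?posrE ?normr_gt0//.
  by have := absIm_le (z - x%:C); rewrite ImB subr0.
by rewrite normc_gt0; apply: contra_neq z0 => /(congr1 (@complex.Im R)); rewrite ImB subr0.
Qed.

Lemma subC_neq0 (z : C) (x : R) : Im z != 0 -> z - x%:C != 0.
Proof. by apply: contra_neq => /(congr1 (@complex.Im R)); rewrite ImB subr0. Qed.

Lemma step_resolvent_bound (z : C) n l : Im z != 0 ->
  normc (step_resolvent z n l) <= `|Im z|^-1.
Proof.
move=> z0; have [[x [_ ->]]|[_ ->]] := step_resolventP z n l.
  exact: normc_resolvent.
by rewrite normc0' invr_ge0.
Qed.

(** Writing f as (z - H) u brings in the unbounded factor z - l. The product with the step function
    stays bounded because it is 1 + (x - l) / (z - x) with |x - l| at most the mesh, hence at most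
    1. *)
Lemma step_resolvent_bound1 (z : C) n l : Im z != 0 ->
  normc (step_resolvent z n l * (z - l%:C)) <= 1 + `|Im z|^-1.
Proof.
move=> z0; have [[x [lx ->]]|[_ ->]] := step_resolventP z n l; last first.
  by rewrite mul0r normc0' addr_ge0// invr_ge0.
have -> : (z - x%:C)^-1 * (z - l%:C) = 1 + (z - x%:C)^-1 * (x - l)%:C.
  by rewrite rmorphB/=; field; exact: subC_neq0.
rewrite (le_trans (normcD' _ _))// normc1' lerD2l normcM' normcR distrC.
rewrite -[leRHS]mulr1 ler_pM ?normc_ge0 ?normc_resolvent//.
by rewrite (le_trans lx)// invf_le1 ?ltr0n// ler1n.
Qed.

Lemma step_resolvent_cvg (z : C) l : Im z != 0 ->
  ccvg \oo (fun n => step_resolvent z n l) (z - l%:C)^-1.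
Proof.
move=> z0.
apply: (@ccvg_squeeze _ _ _ _ _ _ (fun n => n.+1%:R^-1 * (`|Im z|^-1 * `|Im z|^-1))); last first.
  rewrite -[X in _ --> X](mul0r (`|Im z|^-1 * `|Im z|^-1)).
  by apply: cvgM; [exact: cvg_harmonic|exact: cvg_cst].
exists (Num.bound `|l|) => // n /= ln.
have [[x [lx ->]]|[nl _]] := step_resolventP z n l; last first.
  have := archi_boundP (normr_ge0 l).
  have : (Num.bound `|l|)%:R <= n.+1%:R :> R by rewrite ler_nat ltnW.
  lra.
have -> : (z - x%:C)^-1 - (z - l%:C)^-1 = (x - l)%:C * ((z - x%:C)^-1 * (z - l%:C)^-1).
  by rewrite rmorphB/=; field; rewrite !subC_neq0.
rewrite normcM' normcR distrC ler_pM// ?normc_ge0// normcM'.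
by rewrite ler_pM ?normc_ge0// normc_resolvent.
Qed.

Lemma cmfun_sub (z : C) : cmfun setT (fun l : R => z - l%:C).
Proof. by apply: cmfunB; [exact: cmfun_cst|apply: cmfun_real; exact: measurable_id]. Qed.

End StepResolvent.

Section Resolvent.
Context {R : realType} {G : metric_graph R}.
Local Notation C := R[i].
Local Notation Ci := (Ci : C).
Variables (E : set R -> gfun G -> gfun G) (hR : resolution_of_identity E).
Let hE : is_pvm E := hR.1.
Implicit Types u v w : gfun G.

Lemma gfun_addr0 u : (fun k x => u k x + 0) = u.
Proof. by apply/funext => k; apply/funext => x; rewrite addr0. Qed.

Lemma pvm0 A : measurable A -> ae_eqf predT (E A (fun _ _ => 0)) (fun _ _ => 0).
Proof.
move=> mA; have h0 := @inL2_0 _ G predT.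
have := pvm_linear hE (-1) mA h0 h0.
rewrite (gfun_addr0 (fun k x => (-1) * 0)) mulr0 => /ae_eqf_trans; apply.
by move=> k _; apply: aeW => x _; rewrite mulN1r addNr.
Qed.

Lemma pvmZ A c u : measurable A -> inL2 predT u ->
  ae_eqf predT (E A (fun k x => c * u k x)) (fun k x => c * E A u k x).
Proof.
move=> mA hu; have h0 := @inL2_0 _ G predT.
have := pvm_linear hE c mA hu h0.
rewrite (gfun_addr0 (fun k x => c * u k x)) => /ae_eqf_trans; apply.
rewrite -[X in ae_eqf _ _ X](gfun_addr0 (fun k x => c * E A u k x)).
by apply: ae_eqf_comb; [exact: ae_eqf_refl|exact: pvm0].
Qed.

(** By self-adjointness the projection moves onto v, which puts the test vector in the domain of
    H. *)
Lemma opH_pvm u w v (A : set R) (M : R) : opH u w -> measurable A ->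
  (forall x, A x -> `|x| <= M) -> inL2 predT v ->
  ginner (E A w) v = spec_int E (fun l => (\1_A l)%:C * l%:C) u v.
Proof.
move=> /(hR.2 u w)[du hw cw] mA AM hv.
have mid : cmfun setT (fun l : R => l%:C : C) by apply: cmfun_real; exact: measurable_id.
have AM' x : A x -> normc (x%:C : C) <= M by move=> Ax; rewrite normcR; exact: AM.
rewrite (pvm_selfadj hE mA hw hv) cw; last exact: (calc_dom_pvm hE mA mid AM').
exact: (spec_int_pvmr hE mA mid AM').
Qed.

(* [H u] is controlled only after a spectral projection on a bounded set
   ([opH_pvm]), whence the approximation by step functions on bounded cells. *)
Lemma resolvent_spec_int u f v (z : C) : Im z != 0 ->
  opH u (fun k x => z * u k x - f k x) -> inL2 predT f -> inL2 predT v ->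
  ginner u v = spec_int E (fun l => (z - l%:C)^-1) f v.
Proof.
move=> z0 Hu hf hv.
have [[hu _] hw _] := (hR.2 _ _).1 Hu.
pose K n j := fun l : R => (\1_(cell n j) l)%:C * (z - l%:C) : C.
have mK n j : cbdd (K n j).
  split; first by apply: cmfunM; [by apply: cmfun_indic; exact: measurable_cell|exact: cmfun_sub].
  exists (normc z + (`|grid n j| + `|grid n j.+1| : R)) => l.
  rewrite /K indicE normcM' normcR.
  have [/set_mem|_] := boolP (l \in cell n j); last first.
    by rewrite normr0 mul0r addr_ge0 ?normc_ge0// addr_ge0.
  rewrite /cell/= in_itv/= => /andP[l1 l2].
  rewrite normr1 mul1r (le_trans (normcB' _ _))// lerD2l normcR.
  exact: (abs_between l1 (ltW l2)).
(* On a single cell: f = z u - H u, projected on the cell, gives the integral of z - l over it. *)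
have key n j : spec_int E (fun l => (\1_(cell n j) l)%:C) f v = spec_int E (K n j) u v.
  have mA := @measurable_cell R n j.
  rewrite (spec_int_indic hE hf hv mA).
  have bA (x : R) : cell n j x -> `|x| <= `|grid n j| + `|grid n j.+1|.
    rewrite /cell/= in_itv/= => /andP[l1 l2].
    exact: (abs_between l1 (ltW l2)).
  have e1 := opH_pvm Hu mA bA hv.
  have e2 : z * ginner (E (cell n j) u) v =
      ginner (E (cell n j) (fun k x => z * u k x - f k x)) v + ginner (E (cell n j) f) v.
    have hEf := pvm_L2 hE mA hf; have hEu := pvm_L2 hE mA hu.
    have hEw := pvm_L2 hE mA hw; have hzu := inL2Z z hu.
    rewrite -ginnerZl// -[X in _ = X + _]mul1r -ginner_combl//.
    rewrite -(@eq_ginner _ _ (E (cell n j) (fun k x => z * u k x)) _ v v)//.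
    - apply: eq_ginner => //; last exact: ae_eqf_refl.
      + exact: (pvm_L2 hE).
      + exact: inL2_comb.
      + apply: ae_eqf_trans _ (pvm_linear hE 1 mA hw hf).
        rewrite (_ : (fun k x => 1 * (z * u k x - f k x) + f k x) = (fun k x => z * u k x)).
          exact: ae_eqf_refl.
        by apply/funext => k; apply/funext => x; ring.
    - exact: (pvm_L2 hE).
    - exact: inL2Z.
    - exact: pvmZ.
    - exact: ae_eqf_refl.
  have bid : cbdd (fun l : R => (\1_(cell n j) l)%:C * l%:C : C).
    split.
      apply: cmfunM; first exact: cmfun_indic.
      by apply: cmfun_real; exact: measurable_id.
    exists (`|grid n j| + `|grid n j.+1|) => l; rewrite indicE normcM' !normcR.
    have [/set_mem lA|_] := boolP (l \in cell n j).
      by rewrite normr1 mul1r; exact: bA.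
    by rewrite normr0 mul0r addr_ge0.
  have e3 : spec_int E (K n j) u v =
    spec_int E (fun l => z * (\1_(cell n j) l)%:C + (-1) * ((\1_(cell n j) l)%:C * l%:C)) u v.
    by apply: eq_spec_int => l; rewrite /K; ring.
  rewrite e3 (spec_intD hE)//; last 2 first.
  - by apply: cbddM; [exact: cbdd_cst|exact: cbdd_indic].
  - by apply: cbddM; [exact: cbdd_cst|].
  rewrite (spec_intZ hE)//; last exact: cbdd_indic.
  rewrite (spec_intZ hE)// -e1 (spec_int_indic hE)// e2; ring.
have cE n : spec_int E (step_resolvent z n) f v =
    spec_int E (fun l => step_resolvent z n l * (z - l%:C)) u v.
  have cc (c : C) (g : R -> C) : cbdd g -> cbdd (fun l => c * g l).
    by move=> bg; apply: cbddM => //; exact: cbdd_cst.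
  have bi j : cbdd (fun l : R => (\1_(cell n j) l)%:C : C).
    by apply: cbdd_indic; exact: measurable_cell.
  rewrite /step_resolvent (spec_int_sum hE)//; last by move=> j _; exact: cc.
  rewrite [RHS](@eq_spec_int _ _ _ _
    (fun l => \sum_(j < (2 * n.+1 ^ 2)%N) (z - (grid n j)%:C)^-1 * K n j l)); last first.
    by move=> l; rewrite mulr_suml; apply: eq_bigr => j _; rewrite /K mulrA.
  rewrite [RHS](@spec_int_sum _ _ _ hE _ _ _ _ _ _ hu hv) => [|j _]; last exact: cc.
  apply: eq_bigr => j _.
  by rewrite [LHS](spec_intZ hE _ hf hv (bi j)) [RHS](spec_intZ hE _ hu hv (mK n j)) key.
have mS n : cmfun setT (step_resolvent z n).
  apply: cmfun_sum => j _; apply: cmfunM; first exact: cmfun_cst.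
  by apply: cmfun_indic; exact: measurable_cell.
(* One sequence, two limits: expressed by f it tends to the integral of (z - l)^-1, expressed by u
   it tends to the integral of 1, which is (u, v). *)
have c1 : ccvg \oo (fun n => spec_int E (step_resolvent z n) f v)
    (spec_int E (fun l => (z - l%:C)^-1) f v).
  apply: (@spec_int_dct _ _ _ hE _ _ _ _ `|Im z|^-1) => //.
  - by apply: cmfunV; exact: cmfun_sub.
  - by move=> n x; exact: step_resolvent_bound.
  - by move=> x; exact: step_resolvent_cvg.
have c2 : ccvg \oo (fun n => spec_int E (step_resolvent z n) f v) (ginner u v).
  rewrite -(spec_int1 hE hu hv).
  under [X in ccvg _ X]eq_fun do rewrite cE.
  apply: (@spec_int_dct _ _ _ hE _ _ _ _ (1 + `|Im z|^-1)) => //.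
  - by move=> n; apply: cmfunM => //; exact: cmfun_sub.
  - by move=> n x; exact: step_resolvent_bound1.
  - move=> x; have -> : (1 : C) = (z - x%:C)^-1 * (z - x%:C).
      by rewrite mulVf// subC_neq0.
    by apply: ccvgM; [exact: step_resolvent_cvg|exact: ccvg_cst].
exact: ccvg_unique c2 c1.
Qed.

(** The resolvent identity with f = 0 and v = u gives (u, u). To see that it is 0, the zero vector
    is written as [E set0 u], and [spec_int_pvml] turns the integrand into 0. *)
Lemma opH_nonreal_eigen (u : gfun G) (z : C) : Im z != 0 -> inL2 predT u ->
  opH u (fun k x => z * u k x) -> ae_eqf predT u (fun _ _ => 0).
Proof.
move=> z0 hu Hu; apply: ginner_self_eq0 => //.
have h0 := @inL2_0 _ G predT.
rewrite (resolvent_spec_int z0 _ h0 hu); last first.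
  by under eq_fun do under eq_fun do rewrite subr0.
have b1 : cbdd (fun l : R => (z - l%:C)^-1).
  split; first by apply: cmfunV; exact: cmfun_sub.
  by exists `|Im z|^-1 => x; exact: normc_resolvent.
have m0 : measurable (set0 : set R) by [].
have e0 := ae_spec_int hE (fun l : R => (z - l%:C)^-1) h0 (pvm_L2 hE m0 hu) hu hu
  (ae_eqf_sym (pvm_set0 hE hu)) (ae_eqf_refl u).
rewrite [LHS]e0 [LHS](spec_int_pvml hE m0 b1 hu hu).
rewrite (@eq_spec_int _ _ _ _ (fun l => 0 * 1)).
  by rewrite (spec_intZ hE 0 hu hu (cbdd_cst 1)) mul0r.
by move=> l; rewrite indicE in_set0 !mul0r.
Qed.

End Resolvent.

(** * Stone's formula *)

Section RealIntegrals.
Context {R : realType}.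
Local Notation C := R[i].

Lemma lebR_itvoo_fin (a b : R) : (lebR (`]a, b[%classic : set R) < +oo)%E.
Proof. by rewrite /lebR lebesgue_measure_itv /=; case: ifP => // _; rewrite -EFinD ltry. Qed.

Lemma bounded_itv_integrable (a b : R) (f : R -> R) (M : R) : measurable_fun setT f ->
  (forall x, a < x < b -> `|f x| <= M) ->
  lebR.-integrable (`]a, b[%classic : set R) (EFin \o f).
Proof.
move=> mf fM; apply: measurable_bounded_integrable => //.
- exact: lebR_itvoo_fin.
- exact: measurable_funTS.
- exists M; split; first exact: num_real.
  move=> N MN x /=; rewrite in_itv/= => xab.
  by rewrite (le_trans (fM x xab))// ltW.
Qed.

Lemma integral_derivative (F f : R -> R) (a b : R) : a <= b ->
  (forall x : R, is_derive (x : R^o) 1 (F : R^o -> R^o) (f x)) -> continuous f ->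
  fine (\int[lebR]_(x in `]a, b[) (f x)%:E) = F b - F a.
Proof.
move=> ab dF cf.
have [->|anb] := eqVneq a b.
  by rewrite set_itv_ge ?bnd_simp// integral_set0 subrr.
have altb : a < b by rewrite lt_neqAle anb ab.
have mf : measurable_fun setT f by exact: continuous_measurable_fun.
have cF (x : R) : {for x, continuous F}.
  by apply: differentiable_continuous; apply/derivable1_diffP; case: (dF x).
rewrite integral_lebR//; last by apply/measurable_EFinP; exact: measurable_funTS.
have := @continuous_FTC2 R f F a b altb _ _ _.
rewrite integral_itv_bndoo; last by apply/measurable_EFinP; exact: measurable_funTS.
move=> ->//.
- exact: continuous_subspaceT.
- split; first by move=> x _; case: (dF x).
  + by apply: cvg_at_right_filter; exact: cF.
  + by apply: cvg_at_left_filter; exact: cF.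
- by move=> x _; rewrite derive1E; case: (dF x).
Qed.

(* pi times the Poisson kernel of the upper half-plane. *)
Definition poisson (e l x : R) : R := e / ((l - x) ^+ 2 + e ^+ 2).

Lemma poisson_gt0 e l x : 0 < e -> 0 < poisson e l x.
Proof. by move=> e0; rewrite divr_gt0// ltr_wpDl ?sqr_ge0// exprn_gt0. Qed.

Lemma poisson_le e l x : 0 < e -> poisson e l x <= e^-1.
Proof.
move=> e0; rewrite /poisson ler_pdivrMr; last by rewrite ltr_wpDl ?sqr_ge0// exprn_gt0.
rewrite mulrDr expr2 [in leRHS]expr2 (mulKf (lt0r_neq0 e0)) lerDr.
by rewrite mulr_ge0 ?invr_ge0 ?(ltW e0)// -expr2 sqr_ge0.
Qed.

Lemma poisson_far e l x (d : R) : 0 < e -> 0 < d -> d <= `|l - x| ->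
  poisson e l x <= e / d ^+ 2.
Proof.
move=> e0 d0 dl; rewrite /poisson ler_pM2l// lef_pV2 ?posrE.
- rewrite -[leLHS]addr0 lerD ?sqr_ge0// -(real_normK (num_real (l - x))).
  by rewrite ler_sqr ?nnegrE// ltW.
- by rewrite ltr_wpDl ?sqr_ge0// exprn_gt0.
- by rewrite exprn_gt0.
Qed.

Lemma poissonE e l x : poisson e l x = - Im ((l +i* e) - x%:C)^-1.
Proof.
by rewrite ImV ImB /= subr0 /sqmod ReB ImB/= subr0 mulNr opprK.
Qed.

Lemma measurable_poisson d (T : measurableType d) (e : R) (p q : T -> R) :
  measurable_fun setT p -> measurable_fun setT q ->
  measurable_fun setT (fun t => poisson e (p t) (q t)).
Proof.
move=> mp mq; under eq_fun do rewrite poissonE.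
suff : cmfun setT (fun t => ((p t +i* e) - (q t)%:C)^-1).
  by move=> [_ m2]; apply: measurable_funN.
apply: cmfunV; apply: cmfunB; last exact: cmfun_real.
by split => //=.
Qed.

Lemma integral_poisson (e x a b : R) : 0 < e -> a <= b ->
  fine (\int[lebR]_(l in `]a, b[) (poisson e l x)%:E) =
  atan ((b - x) / e) - atan ((a - x) / e).
Proof.
move=> e0 ab.
apply: (@integral_derivative (fun l => atan ((l - x) / e)) (fun l => poisson e l x)) => //.
- move=> l; rewrite (_ : poisson e l x = e^-1 * (1 + ((l - x) / e) ^+ 2)^-1); last first.
    have en : e != 0 by rewrite gt_eqF.
    have D : (l - x) ^+ 2 + e ^+ 2 = e ^+ 2 * (1 + ((l - x) / e) ^+ 2) by field.
    have : 1 + ((l - x) / e) ^+ 2 != 0 by rewrite gt_eqF// ltr_wpDr ?sqr_ge0.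
    rewrite /poisson D; set Q := 1 + _ => Q0.
    by rewrite invfM mulrA expr2 invfM mulVKf.
  have h : is_derive l 1 (fun l : R => (l - x) / e) e^-1.
    rewrite (_ : (fun l : R => _) = (e^-1 *: (id - cst x) : R -> R)); last first.
      by apply/funext => l'; rewrite /= mulrC.
    by apply: is_derive_eq; rewrite subr0 -[_ *: _]/(_ * _) mulr1.
  by rewrite mulrC; exact: (is_derive1_comp (f := @atan R)).
- move=> l; apply: cvgM; first exact: cvg_cst.
  apply: cvgV; first by rewrite gt_eqF// ltr_wpDl ?sqr_ge0 ?exprn_gt0.
  apply: cvgD; last exact: cvg_cst.
  by apply: cvgM; (apply: cvgB; [exact: cvg_id|exact: cvg_cst]).
Qed.

Lemma abs_integral_poisson (e x a b : R) : 0 < e -> a <= b ->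
  0 <= fine (\int[lebR]_(l in `]a, b[) (poisson e l x)%:E) <= pi.
Proof.
move=> e0 ab; apply/andP; split.
  by apply: fine_ge0; apply: integral_ge0 => l _; rewrite lee_fin ltW ?poisson_gt0.
rewrite integral_poisson//.
have := atan_gtNpi2 ((a - x) / e); have := atan_ltpi2 ((b - x) / e); lra.
Qed.

Lemma cvg_harmonic_mul (M : R) : n.+1%:R^-1 * M @[n --> \oo] --> (0 : R).
Proof.
by rewrite -[X in _ --> X](mul0r M); apply: cvgM; [exact: cvg_harmonic|exact: cvg_cst].
Qed.

Lemma cvg_integral_poisson (x a b : R) : a < x < b ->
  fine (\int[lebR]_(l in `]a, b[) (poisson n.+1%:R^-1 l x)%:E) @[n --> \oo] --> (pi : R).
Proof.
move=> /andP[ax xb].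
have ab := ltW (lt_trans ax xb).
rewrite (_ : (fun n => _) = fun n : nat => atan ((b - x) * n.+1%:R) + atan ((x - a) * n.+1%:R)); last first.
  apply/funext => n; rewrite integral_poisson ?invr_gt0// !invrK.
  by rewrite -atanN -mulNr opprB.
have cv (c : R) : 0 < c -> atan (c * n.+1%:R) @[n --> \oo] --> (pi / 2 : R).
  move=> c0; apply: (cvg_comp (fun n : nat => c * n.+1%:R : R) atan _ (@cvgy_atan R)).
  apply/cvgryPge => A; exists (Num.bound `|A / c|) => // n /= hn.
  rewrite mulrC -ler_pdivrMr// (le_trans (ler_norm _))// ltW//.
  by rewrite (lt_le_trans (archi_boundP (normr_ge0 _)))// ler_nat ltnW.
rewrite [X in _ --> X](_ : _ = pi / 2 + pi / 2); last by field.
by apply: cvgD; apply: cv; rewrite subr_gt0.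
Qed.

End RealIntegrals.

(** * Poisson averages of a continuous function *)

Section Stone.
Context {R : realType}.
Local Notation C := R[i].

Lemma cint_real (mu : {measure set R -> \bar R}) D (r : R -> R) :
  cint mu D (fun x => (r x)%:C) = (fine (\int[mu]_(x in D) (r x)%:E))%:C.
Proof. by apply: ceqP => //=; rewrite integral0_eq. Qed.

Variables (phi : R -> C) (a b M : R).
Hypotheses (ab : a <= b) (cphi : ccont phi)
  (phi0 : forall l, ~ (a < l < b) -> phi l = 0) (phiM : forall l, normc (phi l) <= M).

Let I : set R := `]a, b[%classic.
Let mI : measurable I. Proof. exact: measurable_itv. Qed.
Let eps (n : nat) : R := n.+1%:R^-1.
Let eps0 n : 0 < eps n. Proof. by rewrite invr_gt0. Qed.

Lemma cmfun_ccont (f : R -> C) : ccont f -> cmfun setT f.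
Proof.
move=> cf; split; apply: continuous_measurable_fun; [exact: ccont_Re|exact: ccont_Im].
Qed.

Let mphi : cmfun setT phi. Proof. exact: cmfun_ccont. Qed.

Let mpoisson (e x : R) : measurable_fun setT (fun l => poisson e l x).
Proof. by apply: measurable_poisson => //; exact: measurable_cst. Qed.

Let ipoisson n (x : R) : lebR.-integrable I (EFin \o (fun l => poisson (eps n) l x)).
Proof.
apply: (@bounded_itv_integrable _ a b _ (eps n)^-1) => // l _.
by rewrite ger0_norm ?poisson_le// ltW// poisson_gt0.
Qed.

Let iZ (k : R) (h : R -> R) : lebR.-integrable I (EFin \o h) ->
  lebR.-integrable I (EFin \o (fun x => k * h x)).
Proof.
by move=> ih; have := integrableZl mI k ih; apply: eq_integrable => // x _ /=; rewrite EFinM.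
Qed.

Definition poisson_avg (n : nat) (x : R) : C :=
  cint lebR I (fun l => phi l * (poisson (eps n) l x)%:C).

Let M0 : 0 <= M. Proof. exact: le_trans (normc_ge0 _) (phiM 0). Qed.

Lemma cmfun_poisson (e x : R) : cmfun setT (fun l : R => (poisson e l x)%:C : C).
Proof. exact: cmfun_real. Qed.

Lemma poisson_avg_bound n x : normc (poisson_avg n x) <= 2 * (M * pi).
Proof.
apply: le_trans (normc_cint_le (mu := lebR) (A := fun l => M * poisson (eps n) l x) mI _ _ _) _.
- by apply: cmfunM; apply: cmfunTS => //; exact: cmfun_poisson.
- exact: iZ.
- by move=> l _; rewrite normcM' normcR ger0_norm ?ler_wpM2r// ltW// poisson_gt0.
- rewrite ler_wpM2l// [leLHS](RintegralZl (mu := lebR))// ler_wpM2l//.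
  by have /andP[] := abs_integral_poisson x (eps0 n) ab.
Qed.

(** Approximate identity. Inside (a, b) the mass of the kernel on the interval tends to pi; outside,
    where it tends to pi / 2 at an endpoint and to 0 farther away, [phi x] = 0 makes it
    irrelevant. *)
Lemma poisson_avg_cvg x : ccvg \oo (poisson_avg ^~ x) (pi%:C * phi x).
Proof.
pose T n := fine (\int[lebR]_(l in I) (poisson (eps n) l x)%:E).
have c1 : ccvg \oo (fun n => phi x * (T n)%:C) (pi%:C * phi x).
  have [xab|nx] := boolP (a < x < b).
    rewrite mulrC; apply: ccvgM; first exact: ccvg_cst.
    by apply: ccvg_real; exact: cvg_integral_poisson.
  rewrite phi0; last exact/negP.
  rewrite mulr0; apply: ccvg_ext (ccvg_cst 0) => n; by rewrite mul0r.
have mD : cmfun setT (fun l => phi l - phi x).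
  by apply: cmfunB => //; exact: cmfun_cst.
have avgE n : poisson_avg n x = cint lebR I (fun l => (phi l - phi x) * (poisson (eps n) l x)%:C) + phi x * (T n)%:C.
  have ip : cig lebR I (fun l => (poisson (eps n) l x)%:C : C).
    apply: (cig_dom mI _ (ipoisson n x)); first exact: cmfunTS (cmfun_poisson _ _).
    by move=> l _; rewrite normcR ger0_norm// ltW// poisson_gt0.
  rewrite -cint_real -cintZ// -cintD//; last first.
  - exact: cigZ.
  - apply: (cig_dom mI _ (iZ (2 * M) (ipoisson n x))).
      by apply: cmfunTS; apply: cmfunM => //; exact: cmfun_poisson.
    move=> l _; rewrite normcM' normcR ger0_norm; last by rewrite ltW// poisson_gt0.
    rewrite ler_wpM2r//; first by rewrite ltW// poisson_gt0.
    by rewrite (le_trans (normcB' _ _))// mulrDl mul1r lerD.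
  - by apply: eq_cint => l _; rewrite -mulrDl subrK.
apply: (ccvg_ext (fun n => esym (avgE n))).
rewrite -[X in ccvg _ _ X]add0r; apply: ccvgD => //.
apply/ccvg_normcP => e e0.
(* Near x the oscillation of [phi] is at most e' and the mass at most pi: with the factor 2 of
   [normc_cint_le] this part contributes e / 2. *)
pose e' := e / (4 * pi).
have pi0 := pi_gt0 R.
have e'0 : 0 < e' by rewrite divr_gt0// mulr_gt0.
have /ccvg_normcP/(_ e' e'0) [d /= d0 hd] := cphi x.
(* At distance at least d from x, the oscillation is at most 2 M and the kernel at most eps /
   d^2. *)
pose K := 2 * M / d ^+ 2.
have K0 : 0 <= K by rewrite divr_ge0 ?sqr_ge0// mulr_ge0.
pose L := fine (lebR I).
have L0 : 0 <= L by rewrite fine_ge0.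
have key n : eps n * (4 * (K * L)) <= e ->
    normc (cint lebR I (fun l => (phi l - phi x) * (poisson (eps n) l x)%:C)) <= e.
  move=> hn.
have iC : lebR.-integrable I (EFin \o (fun=> K * eps n)).
  by apply: (@bounded_itv_integrable _ a b _ `|K * eps n|).
have iA : lebR.-integrable I (EFin \o (fun l => e' * poisson (eps n) l x + K * eps n)).
  have := integrableD mI (iZ e' (ipoisson n x)) iC; by apply: eq_integrable.
have mF : cmfun I (fun l => (phi l - phi x) * (poisson (eps n) l x)%:C).
  by apply: cmfunTS; apply: cmfunM => //; exact: cmfun_poisson.
apply: le_trans (normc_cint_le (mu := lebR) mI mF iA _) _.
- move=> l _; rewrite normcM' normcR ger0_norm; last by rewrite ltW// poisson_gt0.
  have p0 : 0 <= poisson (eps n) l x by rewrite ltW// poisson_gt0.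
  have [ld|dl] := ltP `|l - x| d.
    apply: (@le_trans _ _ (e' * poisson (eps n) l x)).
      by apply: ler_wpM2r => //; apply: hd; rewrite /= distrC.
    by rewrite lerDl; apply: mulr_ge0 => //; exact: ltW.
  apply: (@le_trans _ _ (K * eps n)); last first.
    by rewrite lerDr; apply: mulr_ge0 => //; exact: ltW.
  have -> : K * eps n = 2 * M * (eps n / d ^+ 2) by rewrite /K; ring.
  apply: ler_pM => //; [exact: normc_ge0| |exact: poisson_far].
  by rewrite (le_trans (normcB' _ _))// mulrDl mul1r lerD.
- have -> : fine (\int[lebR]_(l in I) (e' * poisson (eps n) l x + K * eps n)%:E) =
      e' * T n + K * eps n * L.
    apply: etrans (RintegralD mI (iZ e' (ipoisson n x)) iC) _.
    by congr (_ + _); [exact: RintegralZl|exact: Rintegral_cst].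
  have /andP[_ Tpi] := abs_integral_poisson x (eps0 n) ab.
  rewrite mulrDr.
  have h1 : 2 * (e' * T n) <= e / 2.
    have pin : (pi : R) != 0 by rewrite gt_eqF.
    have -> : e / 2 = 2 * (e' * pi).
      have -> : e' * pi = e / 4 by rewrite /e' invfM (mulrA e) mulfVK.
      by field.
    by apply: ler_wpM2l => //; apply: ler_wpM2l; [exact: ltW|exact: Tpi].
  have h2 : 2 * (K * eps n * L) <= e / 2.
    move: hn; have -> : eps n * (4 * (K * L)) = 2 * (2 * (K * eps n * L)) by ring.
    lra.
  by rewrite [leRHS]splitr lerD.
have c2 : eps n * (4 * (K * L)) @[n --> \oo] --> (0 : R) by exact: cvg_harmonic_mul.
have /cvgrPdist_le/(_ e e0) := c2.
apply: filterS => n; rewrite sub0r normrN ger0_norm => [hn|]; last first.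
  by apply: mulr_ge0; [exact: ltW|apply: mulr_ge0 => //; exact: mulr_ge0].
by rewrite !subr0; exact: key.
Qed.

End Stone.

(** * Continuous approximation of the indicator of (a, b) *)

Section Cutoff.
Context {R : realType}.
Variables a b : R.

(** The positive part of (x - a) (b - x). *)
Definition bump (x : R) : R := ((x - a) * (b - x) + `|(x - a) * (b - x)|) / 2.

(** As n grows, t / (t + 1 / (n + 1)) tends to 1 for t > 0 and stays 0 for t = 0, which singles out
    the open interval. *)
Definition cutoff (n : nat) (x : R) : R := bump x / (bump x + n.+1%:R^-1).

Lemma bump_ge0 x : 0 <= bump x.
Proof.
rewrite divr_ge0//; set t := _ * _; have := ler_norm (- t); rewrite normrN; lra.
Qed.

Lemma bump_gt0 x : a < x < b -> 0 < bump x.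
Proof.
move=> /andP[ax xb]; have t0 : 0 < (x - a) * (b - x) by rewrite mulr_gt0// subr_gt0.
by rewrite divr_gt0// addr_gt0// normr_gt0 gt_eqF.
Qed.

Lemma bump_eq0 x : a < b -> ~ (a < x < b) -> bump x = 0.
Proof.
move=> ab nx; have : (x - a) * (b - x) <= 0.
  have [ax|xa] := ltP a x; last first.
    by rewrite mulr_le0_ge0 ?subr_le0// subr_ge0 (le_trans xa)// ltW.
  have [xb|bx] := ltP x b; first by case: nx; rewrite ax xb.
  by rewrite mulr_ge0_le0 ?subr_le0// subr_ge0 ltW.
by move=> t0; rewrite /bump ler0_norm// addrN mul0r.
Qed.

Lemma continuous_bump : continuous bump.
Proof.
move=> x; apply: cvgM; last exact: cvg_cst.
have c : (y - a) * (b - y) @[y --> x] --> (x - a) * (b - x).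
  by apply: cvgM; apply: cvgB; (exact: cvg_id || exact: cvg_cst).
by apply: cvgD => //; exact: cvg_norm.
Qed.

Lemma bump_den n x : 0 < bump x + n.+1%:R^-1.
Proof. by rewrite ltr_wpDl ?bump_ge0. Qed.

Lemma continuous_cutoff n : continuous (cutoff n).
Proof.
move=> x; apply: cvgM; first exact: continuous_bump.
apply: cvgV; first by rewrite gt_eqF ?bump_den.
by apply: cvgD; [exact: continuous_bump|exact: cvg_cst].
Qed.

Lemma cutoff_eq0 n x : a < b -> ~ (a < x < b) -> cutoff n x = 0.
Proof. by move=> ab nx; rewrite /cutoff bump_eq0// mul0r. Qed.

Lemma cutoff_norm n x : `|cutoff n x| <= 1.
Proof.
have d0 := bump_den n x; rewrite ger0_norm; last first.
  by apply: divr_ge0; [exact: bump_ge0|exact: ltW].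
by rewrite ler_pdivrMr// mul1r lerDl invr_ge0.
Qed.

Lemma cutoff_cvg x : a < b -> cutoff n x @[n --> \oo] --> (\1_(`]a, b[%classic) x : R).
Proof.
move=> ab; rewrite indicE; have [xab|nx] := boolP (a < x < b).
  rewrite mem_set /= ?in_itv//= -(mulfV (lt0r_neq0 (bump_gt0 xab))).
  apply: cvgM; first exact: cvg_cst.
  apply: cvgV; first by rewrite gt_eqF ?bump_gt0.
  rewrite -[X in _ --> X]addr0; apply: cvgD; first exact: cvg_cst.
  exact: cvg_harmonic.
rewrite memNset /= ?in_itv/=; last exact/negP.
under eq_cvg do rewrite (cutoff_eq0 _ ab (elimN idP nx)).
exact: cvg_cst.
Qed.

End Cutoff.

(** * Stone's formula for a density with boundary values *)

Section StoneFormula.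
Context {R : realType} {G : metric_graph R}.
Local Notation C := R[i].
Local Notation Ci := (Ci : C).
Variables (E : set R -> gfun G -> gfun G) (hE : is_pvm E).
Variables (u v : gfun G) (hu : inL2 predT u) (hv : inL2 predT v).
Variables (a b : R) (ab : a < b).
Let I : set R := `]a, b[%classic.
Let mI : measurable I. Proof. exact: measurable_itv. Qed.
Let eps (n : nat) : R := n.+1%:R^-1.
Let eps0 n : 0 < eps n. Proof. by rewrite invr_gt0. Qed.

Lemma cig_itv (f : R -> C) (M : R) : cmfun setT f ->
  (forall l, a < l < b -> normc (f l) <= M) -> cig lebR I f.
Proof.
move=> mf fM; apply: (@cig_dom _ _ _ mI _ (fun=> M)).
- exact: cmfunTS.
- by apply: (@bounded_itv_integrable _ a b _ `|M|).
- by move=> l; rewrite /I/= in_itv/=; exact: fM.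
Qed.

(* Fubini moves the average onto [phi], whose Poisson averages converge to
   [pi * phi] boundedly; [phi] vanishes off (a, b), so no endpoint terms occur. *)
Lemma stone_spec_int (phi : R -> C) (M : R) : ccont phi ->
  (forall l, ~ (a < l < b) -> phi l = 0) -> (forall l, normc (phi l) <= M) ->
  ccvg \oo (fun n => cint lebR I (fun l => phi l * spec_int E (fun x => (poisson (eps n) l x)%:C) u v))
    (pi%:C * spec_int E phi u v).
Proof.
move=> cphi phi0 phiM; have mphi := cmfun_ccont cphi.
have M0 : 0 <= M := le_trans (normc_ge0 _) (phiM 0).
have mF n : cmfun setT (fun p : R * R => phi p.1 * (poisson (eps n) p.1 p.2)%:C).
  apply: cmfunM; first exact: cmfun_comp.
  by apply: cmfun_real; exact: measurable_poisson.
have bF n l x : normc (phi l * (poisson (eps n) l x)%:C) <= M * (eps n)^-1.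
  rewrite normcM' normcR ger0_norm; last by rewrite ltW// poisson_gt0.
  apply: ler_pM => //; [exact: normc_ge0|by rewrite ltW// poisson_gt0|exact: poisson_le].
have mpo n l : cmfun setT (fun x : R => (poisson (eps n) l x)%:C : C).
  by apply: cmfun_real; apply: measurable_poisson => //; exact: measurable_cst.
have ipo n l k : cig (sm hE (inL2_pol k hu hv)) setT (fun x => (poisson (eps n) l x)%:C : C).
  apply: (@cig_bounded _ _ _ _ (eps n)^-1) => // x _.
  by rewrite normcR ger0_norm ?poisson_le// ltW// poisson_gt0.
have key n : spec_int E (poisson_avg phi a b n) u v =
    cint lebR I (fun l => phi l * spec_int E (fun x => (poisson (eps n) l x)%:C) u v).
  pose c k l := cint (sm hE (inL2_pol k hu hv)) setT (fun x => phi l * (poisson (eps n) l x)%:C).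
  have ic k : cig lebR I (c k).
    pose B := 2 * fine (\int[sm hE (inL2_pol k hu hv)]_(x in setT) (M * (eps n)^-1)%:E).
    apply: (@cig_itv _ B).
      exact: (@cmfun_partial_int _ (sm hE (inL2_pol k hu hv)) setT measurableT _ R
        (fun l x => phi l * (poisson (eps n) l x)%:C) (mF n)).
    move=> l _; apply: (@normc_cint_le _ _ _ _ _ (fun=> M * (eps n)^-1)) => //.
    - apply: cmfunM; last exact: mpo.
      exact: cmfun_cst.
    - exact: finite_measure_integrable_cst.
  transitivity (cint lebR I (fun l => 4^-1 * \sum_(k < 4) Ci ^+ k * c k l)); last first.
    apply: eq_cint => l _; rewrite (spec_intE hE _ hu hv) mulrCA; congr (_ * _).
    rewrite mulr_sumr; apply: eq_bigr => k _; rewrite /c cintZ//.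
    by rewrite mulrCA.
  rewrite (spec_intE hE _ hu hv) cintZ//; last first.
    by apply: cig_sum => // k _; exact: cigZ.
  congr (_ * _); rewrite cint_sum//; last by move=> k _; exact: cigZ.
  apply: eq_bigr => k _; rewrite cintZ//; congr (_ * _).
  rewrite /poisson_avg /c.
  apply/esym; apply: (cint_fubini mI measurableT (A := fun=> M * (eps n)^-1) (B := fun=> 1)) => //.
  - by apply: (@bounded_itv_integrable _ a b _ `|M * (eps n)^-1|).
  - exact: finite_measure_integrable_cst.
  - by move=> l x _ _; rewrite mulr1.
under [X in ccvg _ X]eq_fun do rewrite -key.
rewrite -(spec_intZ hE); last first.
- by split => //; exists M.
- by [].
- by [].
apply: (@spec_int_dct _ _ _ hE _ _ _ _ (2 * (M * pi))) => //.
- move=> n; have := @cmfun_partial_int _ lebR I mI _ R (fun x l => phi l * (poisson (eps n) l x)%:C).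
  apply; apply: cmfunM; first exact: cmfun_comp.
  by apply: cmfun_real; exact: measurable_poisson.
- by apply: cmfunM => //; exact: cmfun_cst.
- by move=> n x; apply: poisson_avg_bound => //; exact: ltW.
- by move=> x; apply: (@poisson_avg_cvg _ _ _ _ M) => //; exact: ltW.
Qed.

(** Two successive limits: the width of the Poisson kernel tends to 0 at a fixed cutoff, and only
    then the cutoff tends to the indicator. Each side passes through both by dominated convergence,
    so that atoms of E at a or b never enter. *)
Lemma stone_density (h : R -> C) (Gn : nat -> R -> C) (G0 : R -> C) (M : R) :
  ccont h ->
  (forall n l, a < l < b -> spec_int E (fun x => (poisson (eps n) l x)%:C) u v = - Gn n l) ->
  (forall n, cmfun setT (Gn n)) -> cmfun setT G0 ->
  (forall n l, a < l < b -> normc (Gn n l) <= M) ->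
  (forall l, a < l < b -> ccvg \oo (Gn ^~ l) (G0 l)) ->
  spec_int E (fun l => (\1_I l)%:C * h l) u v = - (pi^-1)%:C * cint lebR I (fun l => h l * G0 l).
Proof.
move=> ch GE mG mG0 GM GG0.
have mh := cmfun_ccont ch.
have [Mh hMh] : exists Mh, forall l, a < l < b -> normc (h l) <= Mh.
  have cn : {within `[a, b], continuous (fun l => normc (h l) : R)}.
    by apply: continuous_subspaceT => x; exact: (cvg_normc (ch x)).
  have [c _ hc] := EVT_max (ltW ab) cn.
  exists (normc (h c)) => l /andP[al lb]; apply: hc.
  by rewrite in_itv/= !ltW.
have Mh0 : 0 <= Mh.
  have h0 : a < (a + b) / 2 < b by rewrite !midf_lt.
  exact: le_trans (normc_ge0 _) (hMh _ h0).
pose phi N l := (cutoff a b N l)%:C * h l.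
have cphi N : ccont (phi N).
  move=> l; apply: ccvgM; last exact: ch.
  by apply: ccvg_real; exact: continuous_cutoff.
have phi0 N l : ~ (a < l < b) -> phi N l = 0.
  by move=> nl; rewrite /phi cutoff_eq0// mul0r.
have phiM N l : normc (phi N l) <= Mh.
  have [lab|/negP nl] := boolP (a < l < b); last by rewrite phi0// normc0'.
  rewrite normcM' normcR -[leRHS]mul1r.
  by apply: ler_pM => //; [exact: normc_ge0|exact: cutoff_norm|exact: hMh].
have G0M l : a < l < b -> normc (G0 l) <= M.
  move=> lab.
  by apply: (normc_lim_le (GG0 l lab)) => n; exact: GM.
have iM (K : R) : lebR.-integrable I (EFin \o (fun=> K)).
  by apply: (@bounded_itv_integrable _ a b _ `|K|).
have key N : pi%:C * spec_int E (phi N) u v = - cint lebR I (fun l => phi N l * G0 l).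
  have c1 := stone_spec_int (cphi N) (phi0 N) (phiM N).
  have ig : cig lebR I (fun l => phi N l * G0 l).
    apply: (@cig_itv _ (Mh * M)); first by apply: cmfunM => //; exact: cmfun_ccont.
    by move=> l lab; rewrite normcM'; apply: ler_pM; rewrite ?normc_ge0 ?G0M.
  have c2 : ccvg \oo (fun n => cint lebR I (fun l => phi N l * spec_int E (fun x => (poisson (eps n) l x)%:C) u v))
     (- cint lebR I (fun l => phi N l * G0 l)).
    rewrite -cintN//.
    have -> : (fun n => cint lebR I (fun l => phi N l * spec_int E (fun x => (poisson (eps n) l x)%:C) u v)) =
      (fun n => cint lebR I (fun l => - (phi N l * Gn n l))).
      apply/funext => n; apply: eq_cint => l; rewrite /I/= in_itv/= => lab.
      by rewrite GE// mulrN.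
    apply: (@cint_dct _ _ _ mI _ _ (fun=> Mh * M)) => //.
    - by move=> n; apply: cmfunTS; apply: cmfunN; apply: cmfunM => //; exact: cmfun_ccont.
    - by apply: cmfunTS; apply: cmfunN; apply: cmfunM => //; exact: cmfun_ccont.
    - move=> n l; rewrite /I/= in_itv/= => lab; rewrite normcN' normcM'.
      by apply: ler_pM; rewrite ?normc_ge0 ?GM.
    - move=> l; rewrite /I/= in_itv/= => lab; apply: ccvgN; apply: ccvgM; first exact: ccvg_cst.
      exact: GG0.
  exact: ccvg_unique c1 c2.
have c1 : ccvg \oo (fun N => pi%:C * spec_int E (phi N) u v)
   (pi%:C * spec_int E (fun l => (\1_I l)%:C * h l) u v).
  apply: ccvgM; first exact: ccvg_cst.
  apply: (@spec_int_dct _ _ _ hE _ _ _ _ Mh) => //.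
  - by move=> n; exact: cmfun_ccont.
  - by apply: cmfunM => //; exact: cmfun_indic.
  - move=> l; apply: ccvgM; last exact: ccvg_cst.
    by apply: ccvg_real; exact: cutoff_cvg.
have c2 : ccvg \oo (fun N => pi%:C * spec_int E (phi N) u v)
   (- cint lebR I (fun l => h l * G0 l)).
  under [X in ccvg _ X]eq_fun do rewrite key.
  apply: ccvgN; apply: (@cint_dct _ _ _ mI _ _ (fun=> Mh * M)) => //.
  - by move=> n; apply: cmfunTS; apply: cmfunM => //; exact: cmfun_ccont.
  - by apply: cmfunTS; apply: cmfunM.
  - move=> n l; rewrite /I/= in_itv/= => lab; rewrite normcM'.
    by apply: ler_pM; rewrite ?normc_ge0 ?G0M.
  - move=> l; rewrite /I/= in_itv/= => lab; apply: ccvgM; last exact: ccvg_cst.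
    rewrite -[X in ccvg _ _ X]mul1r; apply: ccvgM; last exact: ccvg_cst.
    have := @cutoff_cvg _ a b l ab; rewrite indicE mem_set ?in_itv// => cc.
    exact: (ccvg_real (a := 1)).
have pin : (pi%:C : C) != 0 by rewrite -normc_eq0' normcR normr_eq0 gt_eqF ?pi_gt0.
apply: (mulfI pin); rewrite (ccvg_unique c1 c2) fmorphV mulNr mulrN mulrA mulfV//.
by rewrite mul1r.
Qed.

End StoneFormula.

(** * The differential equation on an edge *)

Section ExponentialODE.
Context {R : realType}.
Local Notation C := R[i].

(** On the half-line the density of the exponential law of parameter c is c times this function. *)
Lemma integrable_exp_decay (c : R) : 0 < c ->
  lebR.-integrable (`]0, +oo[%classic : set R) (EFin \o (fun x => expR (- c * x))).
Proof.
move=> c0.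
have i1 : lebR.-integrable setT (EFin \o exponential_pdf c).
  by apply/integrable_lebR => //; exact: integrable_exponential_pdf.
have mD : measurable (`]0, +oo[%classic : set R) by exact: measurable_itv.
have i2 := integrableS measurableT mD (@subsetT _ _) i1.
have := integrableZl mD c^-1 i2.
apply: eq_integrable => // x /set_mem /=; rewrite in_itv/= andbT => x0.
rewrite exponential_pdfE ?ltW// -EFinM; congr EFin.
by apply: mulKf; rewrite gt_eqF.
Qed.

Lemma continuous_affine_comp (m k : R) (g : R -> R) :
  continuous g -> continuous (fun x : R => g (m * x + k)).
Proof.
move=> cg x; apply: (cvg_comp (fun y : R => m * y + k) g _ (cg _)).
by apply: cvgD; [apply: cvgM; [exact: cvg_cst|exact: cvg_id]|exact: cvg_cst].
Qed.

Lemma is_derive_affine (m k x : R) : is_derive (x : R^o) 1 (fun y : R => m * y + k : R) m.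
Proof.
rewrite (_ : (fun y : R => _) = (m *: id + cst k : R -> R)); last by apply/funext.
by apply: is_derive_eq; rewrite addr0 -[_ *: _]/(_ * _) mulr1.
Qed.

(** A generic [g] serves both [cos] and [sin], that is, the real and the imaginary part of
    [Cexp]. *)
Lemma is_derive_expcos (al be de ga : R) (g dg : R -> R) (x : R) :
  (forall y : R, is_derive (y : R^o) 1 (g : R^o -> R^o) (dg y)) ->
  is_derive (x : R^o) 1 (fun y : R => expR (al * y + ga) * g (be * y + de) : R)
    (al * expR (al * x + ga) * g (be * x + de) + expR (al * x + ga) * (be * dg (be * x + de))).
Proof.
move=> hg.
have h1 : is_derive (x : R^o) 1 (expR \o (fun y : R => al * y + ga) : R -> R) (expR (al * x + ga) * al).
  by apply: is_derive1_comp; exact: is_derive_affine.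
have h2 : is_derive (x : R^o) 1 (g \o (fun y : R => be * y + de) : R -> R) (dg (be * x + de) * be).
  by apply: is_derive1_comp; exact: is_derive_affine.
have h := is_deriveM h1 h2.
apply: (is_derive_eq h); rewrite -[X in X + _]/(_ * _) -[X in _ + X]/(_ * _) /=; ring.
Qed.

Lemma cint_Cexp (c d : C) (s t : R) : s <= t ->
  cint lebR `]s, t[ (fun x : R => c * Cexp (c * x%:C + d)) =
  Cexp (c * t%:C + d) - Cexp (c * s%:C + d).
Proof.
move=> st; have Re_e (x : R) : Re (c * Cexp (c * x%:C + d)) =
    Re c * expR (Re c * x + Re d) * cos (Im c * x + Im d) +
    expR (Re c * x + Re d) * (Im c * - sin (Im c * x + Im d)).
  by rewrite ReM /= ReD ImD ReM ImM /= !mulr0 subr0 add0r; ring.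
have Im_e (x : R) : Im (c * Cexp (c * x%:C + d)) =
    Re c * expR (Re c * x + Re d) * sin (Im c * x + Im d) +
    expR (Re c * x + Re d) * (Im c * cos (Im c * x + Im d)).
  by rewrite ImM /= ReD ImD ReM ImM /= !mulr0 subr0 add0r; ring.
have cE := @continuous_affine_comp (Re c) (Re d) _ (@continuous_expR R).
have cg (g : R -> R) (dg : R -> R) : continuous g -> continuous dg -> continuous (fun x : R =>
    Re c * expR (Re c * x + Re d) * g (Im c * x + Im d) +
    expR (Re c * x + Re d) * (Im c * dg (Im c * x + Im d))).
  move=> c1 c2 x; apply: cvgD; apply: cvgM.
  - by apply: cvgM; [exact: cvg_cst|exact: cE].
  - exact: (continuous_affine_comp c1).
  - exact: cE.
  - by apply: cvgM; [exact: cvg_cst|exact: (continuous_affine_comp c2)].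
have cN : continuous (fun x : R => - sin x : R) by move=> x; apply: cvgN; exact: continuous_sin.
apply: ceqP; rewrite ?ReB ?ImB /=.
- under eq_integral do rewrite Re_e.
  rewrite -/(Rintegral lebR _ _).
  apply: etrans (integral_derivative st (fun x => is_derive_expcos (Re c) (Im c) (Im d) (Re d) x (@is_derive_cos R)) _) _.
  + exact: (cg _ _ (@continuous_cos R) cN).
  + by rewrite /= !ReD !ReM !ImD !ImM /= !mulr0 !subr0 !add0r.
- under eq_integral do rewrite Im_e.
  rewrite -/(Rintegral lebR _ _).
  apply: etrans (integral_derivative st (fun x => is_derive_expcos (Re c) (Im c) (Im d) (Re d) x (@is_derive_sin R)) _) _.
  + exact: (cg _ _ (@continuous_sin R) (@continuous_cos R)).
  + by rewrite /= !ReD !ReM !ImD !ImM /= !mulr0 !subr0 !add0r.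
Qed.

End ExponentialODE.

Section EdgeODE.
Context {R : realType} {G : metric_graph R}.
Local Notation C := R[i].
Local Notation Ci := (Ci : C).
Local Notation leb := (@lebR R).

Lemma cl_edge_ge0 (k : edge G) x : cl_edge_set k x -> 0 <= x.
Proof. by case: k => k; rewrite /cl_edge_set/= in_itv/= => /andP[]. Qed.

Lemma cl_edge_sub (k : edge G) x : cl_edge_set k x -> `]0, x[%classic `<=` edge_set k.
Proof.
case: k => k; rewrite /cl_edge_set/= in_itv/= => /andP[x0 xl] y /=; rewrite !in_itv/=.
  by move=> /andP[-> yx]; rewrite (lt_le_trans yx).
by move=> /andP[-> _].
Qed.

Lemma edge_gt0 (k : edge G) x : edge_set k x -> 0 < x.
Proof. by case: k => k; rewrite /edge_set/= in_itv/= => /andP[]. Qed.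

Lemma l2on_itv_cig (D : set R) (f : R -> C) (x : R) : measurable D ->
  `]0, x[%classic `<=` D -> l2on D f -> cig leb `]0, x[ f.
Proof.
move=> mD sD lf; have i1 := l2on_integrable lf.
have mx : measurable (`]0, x[%classic : set R) by exact: measurable_itv.
have i2 := integrableS mD mx sD i1.
have i3 : leb.-integrable (`]0, x[%classic : set R) (EFin \o (fun y => 1 + sqmod (f y))).
  have i4 : leb.-integrable (`]0, x[%classic : set R) (EFin \o (fun=> 1)).
    by apply: (@bounded_itv_integrable _ 0 x _ 1) => // y _; rewrite normr1.
  by have := integrableD mx i4 i2; apply: eq_integrable.
have [m1 m2] := lf.1.
apply: (cig_dom mx _ i3).
  by split; [exact: measurable_funS m1|exact: measurable_funS m2].
move=> y _; rewrite -sqr_normc'; have := normc_ge0 (f y); nra.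
Qed.

(* u is of class H^2 on the edge, u' = p and - u'' = w *)
Definition eode (k : edge G) (u p w : R -> C) : Prop :=
  [/\ l2on (edge_set k) u, l2on (edge_set k) p, l2on (edge_set k) w
    & forall x, cl_edge_set k x ->
      u x = u 0 + cint leb `]0, x[ p /\ p x = p 0 - cint leb `]0, x[ w].

Lemma eode_comb k c u p w u' p' w' : eode k u p w -> eode k u' p' w' ->
  eode k (fun x => c * u x + u' x) (fun x => c * p x + p' x)
    (fun x => c * w x + w' x).
Proof.
have mD := measurable_edge k.
move=> [u1 p1 w1 h1] [u2 p2 w2 h2]; split; do ?exact: l2on_comb.
move=> x kx; have [h1u h1p] := h1 x kx; have [h2u h2p] := h2 x kx.
have sx := cl_edge_sub kx.
have cp1 := l2on_itv_cig mD sx p1; have cp2 := l2on_itv_cig mD sx p2.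
have cw1 := l2on_itv_cig mD sx w1; have cw2 := l2on_itv_cig mD sx w2.
have mx : measurable (`]0, x[%classic : set R) by exact: measurable_itv.
rewrite !cintD//; do ?exact: cigZ.
by rewrite !cintZ// h1u h1p h2u h2p; split; ring.
Qed.

Lemma eode0 k : eode k (fun=> 0) (fun=> 0) (fun=> 0).
Proof.
have l0 : l2on (edge_set k) (fun=> 0 : C).
  by have := (inL2P predT (fun _ _ => 0)).1 (@inL2_0 _ G predT) k isT.
by split => // x _; rewrite cint0 addr0 subr0.
Qed.

Lemma eodeZ k c u p w : eode k u p w ->
  eode k (fun x => c * u x) (fun x => c * p x) (fun x => c * w x).
Proof.
move=> h; have := eode_comb c h (eode0 k).
by under eq_fun do rewrite addr0; under [X in eode _ _ X]eq_fun do rewrite addr0;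
  under [X in eode _ _ _ X]eq_fun do rewrite addr0.
Qed.

Lemma eode_sum k (I : Type) (r : seq I) (P : pred I) (u p w : I -> R -> C) :
  (forall i, P i -> eode k (u i) (p i) (w i)) ->
  eode k (fun x => \sum_(i <- r | P i) u i x) (fun x => \sum_(i <- r | P i) p i x)
    (fun x => \sum_(i <- r | P i) w i x).
Proof.
move=> h; elim: r => [|i r ih].
  have e0 (v : I -> R -> C) : (fun x => \sum_(i <- [::] | P i) v i x) = fun=> 0.
    by apply/funext => x; rewrite big_nil.
  by rewrite !e0; exact: eode0.
have eC (v : I -> R -> C) : (fun x => \sum_(j <- i :: r | P j) v j x) =
    (fun x => (P i)%:R * v i x + \sum_(j <- r | P j) v j x).
  by apply/funext => x; rewrite big_cons; case: (P i); rewrite ?mul1r ?mul0r ?add0r.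
rewrite !eC; case Pi: (P i); first by apply: eode_comb => //; exact: h.
by under eq_fun do rewrite mul0r add0r; under [X in eode _ _ X]eq_fun do rewrite mul0r add0r;
  under [X in eode _ _ _ X]eq_fun do rewrite mul0r add0r.
Qed.

Lemma l2on_decay (k : edge G) (f : R -> C) (M c : R) : 0 < c -> cmfun (edge_set k) f ->
  (forall x, edge_set k x -> normc (f x) <= M * expR (- c * x)) -> l2on (edge_set k) f.
Proof.
move=> c0 mf fM; have mD := measurable_edge k.
have m0 : measurable (`]0, +oo[%classic : set R) by exact: measurable_itv.
have sD : edge_set k `<=` (`]0, +oo[%classic : set R).
  by move=> x /edge_gt0; rewrite /= in_itv/= andbT.
have i1 := integrableS m0 mD sD (integrable_exp_decay (c := c + c) (addr_gt0 c0 c0)).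
have i2 : leb.-integrable (edge_set k) (EFin \o (fun x => M ^+ 2 * expR (- (c + c) * x))).
  by have := integrableZl mD (M ^+ 2) i1; apply: eq_integrable.
apply: (l2on_dom mD mf i2) => x kx.
rewrite -sqr_normc' (_ : M ^+ 2 * _ = (M * expR (- c * x)) ^+ 2); last first.
  by rewrite exprMn; congr (_ * _); rewrite expr2 -expRD; congr expR; ring.
by rewrite ler_sqr ?nnegrE ?normc_ge0 ?fM// (le_trans (normc_ge0 _) (fM x kx)).
Qed.

Lemma cmfun_Cexp_affine (c d : C) : cmfun setT (fun x : R => Cexp (c * x%:C + d)).
Proof.
apply: cmfun_Cexp; apply: cmfunD; last exact: cmfun_cst.
by apply: cmfunM; [exact: cmfun_cst|apply: cmfun_real; exact: measurable_id].
Qed.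

Lemma eode_Cexp k (c : C) : (bounded_edges k \/ Re c < 0) ->
  eode k (fun x => Cexp (c * x%:C)) (fun x => c * Cexp (c * x%:C))
    (fun x => - (c ^+ 2) * Cexp (c * x%:C)).
Proof.
move=> kc.
have me : cmfun setT (fun x : R => Cexp (c * x%:C)).
  by have := cmfun_Cexp_affine c 0; under eq_fun do rewrite addr0.
have ne (x : R) : normc (Cexp (c * x%:C)) = expR (Re c * x).
  by rewrite normc_Cexp ReM /= mulr0 subr0.
have l1 : l2on (edge_set k) (fun x => Cexp (c * x%:C)).
  case: kc => [|cn]; last first.
    apply: (@l2on_decay _ _ 1 (- Re c)); first by rewrite oppr_gt0.
      exact: cmfunTS.
    by move=> x _; rewrite ne opprK mul1r.
  case: k => // k _; apply: l2on_bounded; first exact: measurable_edge.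
  - exact: lebR_itvoo_fin.
  - exact: cmfunTS.
  - exists (expR (`|Re c| * len k)) => x kx.
    have /andP[x0 xk] : 0 < x < len k by move: kx; rewrite /edge_set/= in_itv.
    rewrite ne ler_expR (le_trans (ler_norm _))// normrM.
    by rewrite ler_wpM2l// gtr0_norm// ltW.
have lZ a : l2on (edge_set k) (fun x => a * Cexp (c * x%:C)).
  have l0 : l2on (edge_set k) (fun=> 0 : C) by case: (eode0 k).
  have := l2on_comb (measurable_edge k) a l1 l0.
  by under eq_fun do rewrite addr0.
split => // x kx; have x0 := cl_edge_ge0 kx.
have e1 : cint leb `]0, x[ (fun y => c * Cexp (c * y%:C)) = Cexp (c * x%:C) - Cexp (c * (0 : R)%:C).
  have := cint_Cexp c 0 x0; rewrite !addr0 => <-.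
  by apply: eq_cint => y _; rewrite addr0.
split; first by rewrite e1 addrC subrK.
have cc : cig leb `]0, x[ (fun y => c * Cexp (c * y%:C)).
  exact: l2on_itv_cig (measurable_edge k) (cl_edge_sub kx) (lZ c).
rewrite (@eq_cint _ _ _ _ (fun y => - c * (c * Cexp (c * y%:C)))).
  by rewrite cintZ// e1; ring.
by move=> y _; ring.
Qed.

End EdgeODE.

(** * The particular solution on an infinite edge *)

Section ParticularSolution.
Context {R : realType} {G : metric_graph R}.
Local Notation C := R[i].
Local Notation Ci := (Ci : C).
Local Notation leb := (@lebR R).

Lemma cint_itv_split (g : R -> C) (x y : R) : 0 < y -> y < x ->
  cig leb `]0, x[ g -> cint leb `]0, x[ g = cint leb `]0, y[ g + cint leb `]y, x[ g.
Proof.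
move=> y0 yx cg.
have m1 : measurable (`]0, y[%classic : set R) by exact: measurable_itv.
have m2 : measurable (`]y, x[%classic : set R) by exact: measurable_itv.
have m3 : measurable ([set y] : set R) by exact: measurable_set1.
have E : `]0, x[%classic = `]0, y[%classic `|` ([set y] `|` `]y, x[%classic) :> set R.
  apply/seteqP; split => t /=; rewrite !in_itv/=.
    by move=> /andP[t0 tx]; have [ty|ty|ty] := ltgtP t y; [left; rewrite t0|right; right; rewrite tx|right; left].
  move=> [/andP[-> ty]|[->|/andP[yt ->]]]; first by rewrite (lt_trans ty yx).
    by rewrite y0.
  by rewrite (lt_trans y0 yt).
have c2 : cig leb ([set y] `|` `]y, x[%classic) g.
  have mU : measurable ([set y] `|` `]y, x[%classic : set R) by exact: measurableU.
  apply: (@cigS _ _ (`]0, x[%classic : set R) _ _ (measurable_itv _) mU _ cg).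
  by rewrite E => t ht; right.
rewrite {1}E cint_setU//; last 3 first.
- exact: measurableU.
- apply/disj_setPS => t [] /=; rewrite !in_itv/= => /andP[_ ty] [ty'|/andP[yt _]].
    by rewrite ty' ltxx in ty.
  by have := lt_trans ty yt; rewrite ltxx.
- by rewrite -E.
rewrite cint_setU//; last first.
  by apply/disj_setPS => t [] /= ->; rewrite in_itv/= ltxx.
have -> : cint leb [set y] g = 0; last by rewrite add0r.
have s0 : leb [set y] = 0%E by rewrite /lebR lebesgue_measure_set1.
have sy : [set y] `<=` (`]0, x[%classic : set R) by move=> t ->; rewrite /= in_itv/= y0.
have [g1 g2] := cig_cmfun (cigS (measurable_itv _) m3 sy cg).
by apply: ceqP => /=; rewrite null_set_integral//; exact/measurable_EFinP.
Qed.

(** The derivative of |x - y| in x off the diagonal; the value -1 at x = y fits the branch x <= y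
    used below. *)
Definition sg (x y : R) : R := if y < x then 1 else -1.

Variables (z : C) (z0 : 0 < Im z).

(** Times (2 i z)^-1, the fundamental solution of u'' + z^2 u on the line. *)
Definition green (x y : R) : C := Cexp (Ci * z * `|x - y|%:C).

Lemma normc_wave (t : R) : normc (Cexp (Ci * z * t%:C)) = expR (- Im z * t).
Proof.
rewrite normc_Cexp; congr expR; rewrite !ReM !ImM /=; ring.
Qed.

Lemma normc_green x y : normc (green x y) <= 1.
Proof.
rewrite normc_wave -[leRHS]expR0 ler_expR mulNr oppr_le0.
by rewrite mulr_ge0// ltW.
Qed.

Lemma normc_sg x y : normc ((sg x y)%:C : C) = 1.
Proof. by rewrite normcR /sg; case: ifP; rewrite ?normr1// normrN1. Qed.

Lemma cmfun_green : cmfun setT (fun p : R * R => green p.1 p.2).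
Proof.
apply: cmfun_Cexp; apply: cmfunM; first exact: cmfun_cst.
apply: cmfun_real; apply: measurableT_comp => //.
exact: measurable_funB.
Qed.

Lemma cmfun_sg : cmfun setT (fun p : R * R => (sg p.1 p.2)%:C : C).
Proof.
apply: cmfun_real; apply: measurable_fun_ifT => //.
exact: measurable_fun_ltr.
Qed.

Lemma green_left x y : x <= y -> green x y = Cexp (- (Ci * z) * x%:C + Ci * z * y%:C).
Proof.
by move=> xy; rewrite /green ler0_norm ?subr_le0//; congr Cexp; rewrite rmorphN rmorphB/=; ring.
Qed.

Lemma green_right x y : y <= x -> green x y = Cexp (Ci * z * x%:C + - (Ci * z) * y%:C).
Proof.
by move=> xy; rewrite /green ger0_norm ?subr_ge0//; congr Cexp; rewrite rmorphB/=; ring.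
Qed.

Lemma greenxx y : green y y = 1.
Proof. by rewrite /green subrr normr0 mulr0 Cexp0. Qed.

Lemma cig_sec (F : R * R -> C) (M x y : R) : cmfun setT F ->
  (forall p, normc (F p) <= M) -> cig leb `]0, x[ (fun t => F (t, y)).
Proof.
move=> mF FM; apply: (@cig_itv _ 0 x _ M); last by move=> l _; exact: FM.
by apply: (@cmfun_comp _ _ _ _ _ F) => //; exact: pair2_measurable.
Qed.

Let izg (p : R * R) : C := Ci * z * green p.1 p.2.
Let izsg (p : R * R) : C := Ci * z * (sg p.1 p.2)%:C * green p.1 p.2.

Let m_izg : cmfun setT izg.
Proof. by apply: cmfunM; [exact: cmfun_cst|exact: cmfun_green]. Qed.
Let m_izsg : cmfun setT izsg.
Proof.
apply: cmfunM; last exact: cmfun_green.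
by apply: cmfunM; [exact: cmfun_cst|exact: cmfun_sg].
Qed.
Let b_izg p : normc (izg p) <= normc (Ci * z).
Proof.
have -> : normc (izg p) = normc (Ci * z) * normc (green p.1 p.2) by exact: normcM'.
by rewrite -[leRHS]mulr1 ler_wpM2l ?normc_ge0 ?normc_green.
Qed.
Let b_izsg p : normc (izsg p) <= normc (Ci * z).
Proof.
have -> : normc (izsg p) = normc (Ci * z) * normc (green p.1 p.2).
  by rewrite /izsg normcM' (normcM' (Ci * z)) normc_sg mulr1.
by rewrite -[leRHS]mulr1 ler_wpM2l ?normc_ge0 ?normc_green.
Qed.

Lemma cint_green' x y : 0 <= x -> 0 < y ->
  cint leb `]0, x[ (fun t => Ci * z * (sg t y)%:C * green t y) = green x y - green 0 y.
Proof.
move=> x0 y0.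
have left_part s : 0 <= s -> s <= y ->
    cint leb `]0, s[ (fun t => Ci * z * (sg t y)%:C * green t y) = green s y - green 0 y.
  move=> s0 sy; rewrite (green_left sy) (green_left (ltW y0)) -cint_Cexp//.
  apply: eq_cint => t /=; rewrite in_itv/= => /andP[_ ts].
  have ty : t < y by exact: lt_le_trans ts sy.
  by rewrite /sg ltNge (ltW ty)/= (green_left (ltW ty)) rmorphN1 mulrN1.
have [xy|yx] := leP x y; first exact: left_part.
rewrite (cint_itv_split y0 yx); last exact: (@cig_sec izsg _ x y m_izsg b_izsg).
rewrite (left_part y (ltW y0) (lexx y)).
have -> : cint leb `]y, x[ (fun t => Ci * z * (sg t y)%:C * green t y) = green x y - green y y.
  rewrite (green_right (ltW yx)) (green_right (lexx y)) -cint_Cexp ?ltW//.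
  apply: eq_cint => t /=; rewrite in_itv/= => /andP[yt _].
  by rewrite /sg yt (green_right (ltW yt)) mulr1.
by ring.
Qed.

(** Off t = y the integrand is the derivative of [sg] times [green], which jumps by 2 at t = y. This
    jump is the source of the equation: integrated against f, it restores f. *)
Lemma cint_green x y : 0 <= x -> 0 < y ->
  cint leb `]0, x[ (fun t => Ci * z * green t y) =
  (sg x y)%:C * green x y + green 0 y - (if y < x then 2 else 0).
Proof.
move=> x0 y0.
have left_part s : 0 <= s -> s <= y ->
    cint leb `]0, s[ (fun t => Ci * z * green t y) = green 0 y - green s y.
  move=> s0 sy; rewrite (green_left sy) (green_left (ltW y0)) -opprB -cint_Cexp//.
  rewrite -cintN//; last first.
    apply: (@cig_itv _ 0 s _ (normc (- (Ci * z)) * expR (- Im z * 0))).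
      by apply: cmfunM; [exact: cmfun_cst|exact: cmfun_Cexp_affine].
    move=> t /andP[t0 ts]; rewrite normcM' ler_wpM2l ?normc_ge0//.
    have -> : - (Ci * z) * t%:C + Ci * z * y%:C = Ci * z * (y - t)%:C.
      by rewrite rmorphB/=; ring.
    rewrite normc_wave ler_expR !mulNr lerN2 ler_wpM2l ?ltW//.
    by rewrite subr_gt0 (lt_le_trans ts sy).
  apply: eq_cint => t /=; rewrite in_itv/= => /andP[_ ts].
  have ty : t < y by exact: lt_le_trans ts sy.
  by rewrite (green_left (ltW ty)); ring.
have [xy|yx] := leP x y.
  by rewrite /sg ltNge xy/= left_part// rmorphN1; ring.
rewrite (cint_itv_split y0 yx); last exact: (@cig_sec izg _ x y m_izg b_izg).
rewrite (left_part y (ltW y0) (lexx y)) greenxx.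
have -> : cint leb `]y, x[ (fun t => Ci * z * green t y) = green x y - green y y.
  rewrite (green_right (ltW yx)) (green_right (lexx y)) -cint_Cexp ?ltW//.
  by apply: eq_cint => t /=; rewrite in_itv/= => /andP[yt _]; rewrite (green_right (ltW yt)).
by rewrite /sg yx greenxx rmorph1; ring.
Qed.

End ParticularSolution.

Section ParticularSolutionODE.
Context {R : realType} {G : metric_graph R}.
Local Notation C := R[i].
Local Notation Ci := (Ci : C).
Local Notation leb := (@lebR R).
Local Notation D := (`]0, +oo[%classic : set R).
Variables (z : C) (z0 : 0 < Im z) (f : R -> C) (r : R).
Hypotheses (mf : cmfun setT f) (intf : leb.-integrable D (EFin \o (fun y => normc (f y))))
  (f2 : l2on D f) (fr : forall y, r < y -> f y = 0).

Let mD : measurable D. Proof. exact: measurable_itv. Qed.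

Definition psol (x : R) : C := cint leb D (fun y => green z x y * f y).
Definition psol' (x : R) : C := cint leb D (fun y => Ci * z * (sg x y)%:C * green z x y * f y).
(** Minus the second derivative of [psol], following the sign convention of [eode]. The factor 2 i z
    on f is there because [psol] leaves out (2 i z)^-1. *)
Definition psol'' (x : R) : C := z ^+ 2 * psol x - 2 * Ci * z * f x.

Let Mf := fine (\int[leb]_(y in D) (normc (f y))%:E).

(** As f vanishes beyond r, only y <= r matter, and for them exp(- Im z |x - y|) <= exp(- Im z (x -
    r)). This decay in x puts [psol] in L^2 of the half-line. *)
Lemma green_decay x y : normc (green z x y * f y) <= expR (- Im z * x) * (expR (Im z * r) * normc (f y)).
Proof.
have [yr|ry] := leP y r; last by rewrite fr// mulr0 normc0' mulr0 mulr0.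
rewrite normcM' mulrA ler_wpM2r ?normc_ge0// normc_wave// -expRD ler_expR.
have e1 : Im z * (x - y) <= Im z * `|x - y| by rewrite ler_wpM2l ?ler_norm// ltW.
have e2 : Im z * y <= Im z * r by rewrite ler_wpM2l// ltW.
by move: e1; rewrite !mulNr mulrBr => e1; lra.
Qed.

Let iA c : leb.-integrable D (EFin \o (fun y => c * normc (f y))).
Proof.
by have := integrableZl mD c intf; apply: eq_integrable.
Qed.

Let IZ c : fine (\int[leb]_(y in D) (c * normc (f y))%:E) = c * Mf.
Proof. exact: (RintegralZl c mD intf). Qed.

Let m2f : cmfun setT (fun p : R * R => f p.2).
Proof. exact: cmfun_comp. Qed.

Let m_green : cmfun setT (fun p : R * R => green z p.1 p.2 * f p.2).
Proof. by apply: cmfunM => //; exact: cmfun_green. Qed.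

Let m_green' : cmfun setT (fun p : R * R => Ci * z * (sg p.1 p.2)%:C * green z p.1 p.2 * f p.2).
Proof.
apply: cmfunM => //; apply: cmfunM; last exact: cmfun_green.
by apply: cmfunM; [exact: cmfun_cst|exact: cmfun_sg].
Qed.

Let sec (F : R * R -> C) x : cmfun setT F -> cmfun D (fun y => F (x, y)).
Proof.
move=> mF; apply: cmfunTS; apply: (@cmfun_comp _ _ _ _ _ F) => //.
Qed.

Lemma normc_green' x y : normc (Ci * z * (sg x y)%:C * green z x y * f y) =
  normc (Ci * z) * normc (green z x y * f y).
Proof. by rewrite normcM' (normcM' (_ * (sg x y)%:C)) (normcM' (Ci * z)) normc_sg mulr1 (normcM' (green _ _ _)) mulrA. Qed.

Lemma normc_psol x : normc (psol x) <= 2 * (expR (Im z * r) * Mf) * expR (- Im z * x).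
Proof.
have h := @normc_cint_le _ leb D mD (fun y => green z x y * f y)
  (fun y => expR (- Im z * x) * expR (Im z * r) * normc (f y)) (sec x m_green) (iA _) _.
apply: le_trans (h _) _; first by move=> y _; rewrite -mulrA; exact: green_decay.
by rewrite IZ le_eqVlt; apply/orP; left; apply/eqP; ring.
Qed.

Lemma normc_psol' x : normc (psol' x) <= normc (Ci * z) * (2 * (expR (Im z * r) * Mf)) * expR (- Im z * x).
Proof.
have h := @normc_cint_le _ leb D mD (fun y => Ci * z * (sg x y)%:C * green z x y * f y)
  (fun y => normc (Ci * z) * expR (- Im z * x) * expR (Im z * r) * normc (f y)) (sec x m_green') (iA _) _.
apply: le_trans (h _) _.
  move=> y _; rewrite normc_green' -!mulrA ler_wpM2l ?normc_ge0//.
  exact: green_decay.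
by rewrite IZ le_eqVlt; apply/orP; left; apply/eqP; ring.
Qed.

Lemma cmfun_psol : cmfun setT psol.
Proof. exact: (@cmfun_partial_int _ leb D mD _ R (fun x y => green z x y * f y)). Qed.

Lemma cmfun_psol' : cmfun setT psol'.
Proof.
exact: (@cmfun_partial_int _ leb D mD _ R (fun x y => Ci * z * (sg x y)%:C * green z x y * f y)).
Qed.

Lemma cig_green x : cig leb D (fun y => green z x y * f y).
Proof.
apply: (cig_dom mD (sec x m_green) intf) => y _.
by rewrite normcM' -[leRHS]mul1r ler_wpM2r ?normc_ge0 ?normc_green.
Qed.

Lemma cig_sg x : cig leb D (fun y => (sg x y)%:C * green z x y * f y).
Proof.
apply: (cig_dom mD _ intf) => [|y _].
  apply: cmfunM; last exact: cmfunTS.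
  have mF : cmfun setT (fun p : R * R => (sg p.1 p.2)%:C * green z p.1 p.2).
    by apply: cmfunM; [exact: cmfun_sg|exact: cmfun_green].
  exact: (sec x mF).
rewrite normcM' (normcM' (sg x y)%:C) normc_sg mul1r.
by rewrite -[leRHS]mul1r ler_wpM2r ?normc_ge0 ?normc_green.
Qed.

Let cigf : cig leb D f.
Proof. by apply: (cig_dom mD _ intf) => //; exact: cmfunTS. Qed.

(** No differentiation under the integral sign: [eode] asks for integral identities, which follow by
    Fubini's theorem from [cint_green'] for u and from [cint_green] for u'. *)
Lemma eode_psol (k : eU G) : eode (inr k : edge G) psol psol' psol''.
Proof.
have l1 : l2on D psol.
  apply: (@l2on_decay _ G (inr k) _ _ _ z0 _ (fun x _ => normc_psol x)).
  exact: cmfunTS cmfun_psol.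
have l2 : l2on D psol'.
  apply: (@l2on_decay _ G (inr k) _ _ _ z0 _ (fun x _ => normc_psol' x)).
  exact: cmfunTS cmfun_psol'.
have l3 : l2on D psol''.
  have l0 : l2on D (fun=> 0 : C) by case: (eode0 (inr k : edge G)).
  have h := l2on_comb mD (z ^+ 2) l1 (l2on_comb mD (- (2 * Ci * z)) f2 l0).
  suff -> : psol'' = (fun x => z ^+ 2 * psol x + (- (2 * Ci * z) * f x + 0)) by [].
  by apply/funext => x; rewrite /psol'' addr0 mulNr.
split; [exact: l1|exact: l2|exact: l3|move=> x kx]; have x0 : 0 <= x := cl_edge_ge0 kx.
have mx : measurable (`]0, x[%classic : set R) by exact: measurable_itv.
have ix (K : R) : leb.-integrable (`]0, x[%classic : set R) (EFin \o (fun=> K)).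
  by apply: (@bounded_itv_integrable _ 0 x _ `|K|).
have cx := l2on_itv_cig mD (cl_edge_sub kx).
have gsec y : cig leb `]0, x[ (fun t => green z t y).
  apply: (@cig_itv _ 0 x _ 1); last by move=> t _; exact: normc_green.
  exact: (@cmfun_comp _ _ _ _ _ (fun p : R * R => green z p.1 p.2) (fun t => (t, y)) (cmfun_green z) (pair2_measurable y)).
have g'sec y : cig leb `]0, x[ (fun t => Ci * z * (sg t y)%:C * green z t y).
  apply: (@cig_itv _ 0 x _ (normc (Ci * z))).
    have mF : cmfun setT (fun p : R * R => Ci * z * (sg p.1 p.2)%:C * green z p.1 p.2).
      apply: cmfunM; last exact: cmfun_green.
      by apply: cmfunM; [exact: cmfun_cst|exact: cmfun_sg].
    exact: (@cmfun_comp _ _ _ _ _ _ (fun t => (t, y)) mF (pair2_measurable y)).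
  move=> t _; rewrite normcM' (normcM' (Ci * z)) normc_sg mulr1.
  by rewrite -[leRHS]mulr1 ler_wpM2l ?normc_ge0 ?normc_green.
split.
- rewrite /psol' (@cint_fubini _ leb leb _ _ mx mD (fun=> normc (Ci * z)) (fun y => normc (f y)) (ix _) intf
    (fun t y => Ci * z * (sg t y)%:C * green z t y * f y) m_green'); last first.
    move=> t y _ _; rewrite normc_green' (normcM' (green z t y)) ler_wpM2l ?normc_ge0//.
    by rewrite -[leRHS]mul1r ler_wpM2r ?normc_ge0 ?normc_green.
  have -> : cint leb D (fun y => cint leb `]0, x[ (fun t => Ci * z * (sg t y)%:C * green z t y * f y)) =
      cint leb D (fun y => green z x y * f y - green z 0 y * f y).
    apply: eq_cint => y; rewrite /= in_itv/= andbT => y0.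
    rewrite -mulrBl -cint_green'// [RHS]mulrC -cintZ//.
    by apply: eq_cint => t _; rewrite mulrC.
  by rewrite cintB ?/psol//; [ring|exact: cig_green|exact: cig_green].
- have w1 : cint leb `]0, x[ psol'' = z ^+ 2 * cint leb `]0, x[ psol - 2 * Ci * z * cint leb `]0, x[ f.
    rewrite [LHS]cintB//; last 2 first.
    - by apply: cigZ => //; exact: (cx _ l1).
    - by apply: cigZ => //; exact: (cx _ f2).
    by rewrite (cintZ mx _ (cx _ l1)) (cintZ mx _ (cx _ f2)).
  (* This is [cint_green] integrated against f; its jump becomes twice the integral of f over ]0,
     x[. *)
  have w2 : Ci * z * cint leb `]0, x[ psol =
      cint leb D (fun y => (sg x y)%:C * green z x y * f y) + psol 0 - 2 * cint leb `]0, x[ f.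
    rewrite -(cintZ mx _ (cx _ l1)).
    have -> : cint leb `]0, x[ (fun t => Ci * z * psol t) =
        cint leb `]0, x[ (fun t => cint leb D (fun y => Ci * z * green z t y * f y)).
      apply: eq_cint => t _; rewrite /psol -cintZ//; last exact: cig_green.
      by apply: eq_cint => y _; rewrite mulrA.
    rewrite (@cint_fubini _ leb leb _ _ mx mD (fun=> normc (Ci * z)) (fun y => normc (f y)) (ix _) intf
      (fun t y => Ci * z * green z t y * f y)); last 2 first.
    - apply: cmfunM => //; apply: cmfunM; last exact: cmfun_green.
      exact: cmfun_cst.
    - move=> t y _ _; rewrite normcM' (normcM' (Ci * z)) ler_wpM2r ?normc_ge0//.
      by rewrite -[leRHS]mulr1 ler_wpM2l ?normc_ge0 ?normc_green.
    have cI : cig leb D (fun y => (\1_(`]0, x[%classic) y)%:C * f y).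
      apply: (cig_dom mD _ intf).
        by apply: cmfunTS; apply: cmfunM => //; exact: cmfun_indic.
      move=> y _; rewrite normcM' normcR indicE -[leRHS]mul1r ler_wpM2r ?normc_ge0//.
      by case: (_ \in _); rewrite ?normr1 ?normr0.
    have -> : cint leb `]0, x[ f = cint leb D (fun y => (\1_(`]0, x[%classic) y)%:C * f y).
      rewrite -cint_indic -[RHS]cint_indic; apply: eq_cint => y _.
      rewrite mulrA !indicE; have [/set_mem yx|_] := boolP (y \in `]0, x[%classic); last by rewrite mulr0.
      rewrite mem_set ?mul1r//; move: yx; rewrite /= !in_itv/= andbT.
      by move=> /andP[].
    rewrite -(cintZ mD 2 cI) /psol -(cintD mD (cig_sg x) (cig_green 0)) -cintB//.
    - apply: eq_cint => y yD; have y0 : 0 < y by move: yD; rewrite /= in_itv/= andbT.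
      transitivity (cint leb `]0, x[ (fun t => Ci * z * green z t y) * f y).
        rewrite [RHS]mulrC -cintZ//; last exact: cigZ.
        by apply: eq_cint => t _; rewrite mulrC.
      rewrite cint_green// indicE.
      have -> : (y \in `]0, x[%classic) = (y < x).
        apply/idP/idP => [/set_mem|yx]; first by rewrite /= in_itv/= y0.
        by apply/mem_set; rewrite /= in_itv/= y0.
      by case: (y < x) => /=; ring.
    - exact: (cigD mD (cig_sg x) (cig_green 0)).
    - exact: (cigZ mD 2 cI).
  have q0 : psol' 0 = - (Ci * z) * psol 0.
    rewrite /psol' /psol -cintZ//; last exact: cig_green.
    apply: eq_cint => y; rewrite /= in_itv/= andbT => y0.
    by rewrite /sg ltNge (ltW y0)/= rmorphN1; ring.
  have qx : psol' x = Ci * z * cint leb D (fun y => (sg x y)%:C * green z x y * f y).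
    rewrite /psol' -cintZ//; last exact: cig_sg.
    by apply: eq_cint => y _; ring.
  have iz2 : z ^+ 2 = - (Ci * z) * (Ci * z).
    by rewrite mulNr mulrACA Ci2; ring.
  rewrite qx q0 w1 iz2 -(mulrA (- (Ci * z))) w2; ring.
Qed.

End ParticularSolutionODE.

(** * The vertex conditions and the resolvent kernel *)

Section Waves.
Context {R : realType} {G : metric_graph R}.
Local Notation C := R[i].
Local Notation Ci := (Ci : C).
Local Notation leb := (@lebR R).
Implicit Types (e : eend G) (j : edge G).

Lemma laplace_eode (P : pred (edge G)) (u p w : gfun G) :
  (forall j, P j -> eode j (u j) (p j) (w j)) ->
  vertex_conditions P (trace_val u) (trace_nder p) -> laplace P u p w.
Proof.
move=> h hv; split => //.
- by apply/inL2P => j /h[].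
- by apply/inL2P => j /h[].
- by apply/inL2P => j /h[].
- by move=> j x /h[_ _ _]; exact.
Qed.

Lemma laplace_opH (u p w : gfun G) : laplace predT u p w -> opH u w.
Proof.
move=> h; exists u, p; split => //; first by case: h.
exact: ae_eqf_refl.
Qed.

Lemma vertex_conditionsZ (P : pred (edge G)) (a b : eend G -> C) t :
  vertex_conditions P a b -> vertex_conditions P a (fun e => t * b e).
Proof.
move=> [h1 h2 h3]; split => // v hv.
by rewrite -mulr_sumr h3// mulr0.
Qed.

Lemma vcond_form_sum (I : Type) (r : seq I) (c : vcond G) (t : I -> C) (a b : I -> eend G -> C) :
  vcond_form c (fun e => \sum_(i <- r) t i * a i e) (fun e => \sum_(i <- r) t i * b i e) =
  \sum_(i <- r) t i * vcond_form c (a i) (b i).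
Proof.
case: c => [e|e e'|v] //=.
- by rewrite -sumrB; apply: eq_bigr => i _; rewrite mulrBr.
- by rewrite exchange_big/=; apply: eq_bigr => i _; rewrite mulr_sumr.
Qed.

Lemma vcond_formD (c : vcond G) (a b a' b' : eend G -> C) :
  vcond_form c (fun e => a e + a' e) (fun e => b e + b' e) =
  vcond_form c a b + vcond_form c a' b'.
Proof.
case: c => [e|e e'|v] //=; first by ring.
by rewrite big_split.
Qed.

Lemma vcond_formZ (c : vcond G) (a b : eend G -> C) t :
  vcond_form c (fun e => a e * t) (fun e => b e * t) = vcond_form c a b * t.
Proof.
case: c => [e|e e'|v] //=; first by rewrite mulrBl.
by rewrite mulr_suml.
Qed.

Lemma eq_vcond_form (c : vcond G) (a b a' b' : eend G -> C) :
  (forall e, a e = a' e) -> (forall e, b e = b' e) -> vcond_form c a b = vcond_form c a' b'.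
Proof. by move=> /funext -> /funext ->. Qed.

Definition waves (z : C) (t : eend G -> C) : gfun G :=
  fun j x => \sum_(e | edge_of e == j) t e * basis_fun z e x.

Definition waves' (z : C) (t : eend G -> C) : gfun G :=
  fun j x => \sum_(e | edge_of e == j) t e * (expsign e * Ci * z * basis_fun z e x).

Lemma expsign2 e : expsign e * expsign e = 1.
Proof. by case: e => [[k []]|k] /=; rewrite ?mulrNN mulr1. Qed.

Lemma eode_waves (z : C) (t : eend G -> C) j : 0 < Im z ->
  eode j (waves z t j) (waves' z t j) (fun x => z ^+ 2 * waves z t j x).
Proof.
move=> z0.
have -> : (fun x => z ^+ 2 * waves z t j x) =
    (fun x => \sum_(e | edge_of e == j) t e * (- ((expsign e * Ci * z) ^+ 2) * basis_fun z e x)).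
  apply/funext => x; rewrite mulr_sumr; apply: eq_bigr => e _.
  have -> : - ((expsign e * Ci * z) ^+ 2) = - ((expsign e * expsign e) * (Ci * Ci) * z ^+ 2) by ring.
  by rewrite expsign2 Ci2; ring.
apply: eode_sum => e ej; apply: eodeZ; apply: eode_Cexp.
case: e ej => [[k b]|k] /eqP <-; first by left.
by right; rewrite !ReM !ImM /=; move: z0; lra.
Qed.

Lemma trace_waves z t e :
  trace_val (waves z t) e = \sum_e' t e' * basis_val z e' e.
Proof.
rewrite /trace_val /waves big_mkcond/=; apply: eq_bigr => e' _.
by rewrite /basis_val eq_sym; case: ifP => // _; rewrite mulr0.
Qed.

Lemma trace_waves' z t e :
  trace_nder (waves' z t) e = Ci * z * \sum_e' t e' * basis_nder z e' e.
Proof.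
rewrite /trace_nder /waves' big_mkcond/= !mulr_sumr; apply: eq_bigr => e' _.
by rewrite /basis_nder eq_sym; case: ifP => // _; [ring|rewrite !mulr0].
Qed.

Lemma sum_enum_val (F : eend G -> C) : \sum_(i < dimN G) F (enum_val i) = \sum_e F e.
Proof.
rewrite [RHS](reindex (@enum_val (eend G) (eend G)))//.
exact: onW_bij (@enum_val_bij (eend G)).
Qed.

Lemma Dmx_mul s z (c : 'cV[C]_(dimN G)) n :
  (Dmx s z *m c) n 0 = vcond_form (s n)
    (fun e => \sum_e' c (enum_rank e') 0 * basis_val z e' e)
    (fun e => \sum_e' c (enum_rank e') 0 * basis_nder z e' e).
Proof.
rewrite vcond_form_sum -sum_enum_val mxE; apply: eq_bigr => i _.
by rewrite mxE enum_valK mulrC.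
Qed.

(** A nondegenerate interval is not null; used to pick actual points where an almost everywhere
    identity holds. *)
Lemma ae_lebR_exists (a b : R) (P : R -> Prop) : a < b ->
  {ae leb, forall x, `]a, b[%classic x -> P x} -> exists2 x, a < x < b & P x.
Proof.
move=> ab [N [mN N0 sN]]; apply: contrapT => no.
have sI : `]a, b[%classic `<=` N.
  move=> x xab; apply: sN => /= h; apply: no; exists x; last exact: h.
  by move: xab; rewrite /= in_itv.
have : (leb `]a, b[%classic <= leb N)%E by apply: le_measure => //; rewrite inE//; exact: measurable_itv.
rewrite N0 /lebR lebesgue_measure_itv/= lte_fin ab -EFinD lee_fin subr_le0.
by rewrite leNgt ab.
Qed.

Lemma waves_inr z t (k : eU G) x : waves z t (inr k) x = t (inr k) * basis_fun z (inr k) x.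
Proof.
rewrite /waves (big_pred1 (inr k)) // => e.
by case: e => [[k' b]|k'] //=.
Qed.

Lemma waves_inl z t (k : eB G) x : waves z t (inl k) x =
  t (inl (k, true)) * basis_fun z (inl (k, true)) x +
  t (inl (k, false)) * basis_fun z (inl (k, false)) x.
Proof.
have kk : (inl k : edge G) == inl k by [].
rewrite /waves (bigD1 (inl (k, true)) kk) (bigD1 (inl (k, false))); last by rewrite kk /=; apply/eqP => -[].
rewrite big1; first by rewrite /= addr0.
move=> e /andP[/andP[]]; case: e => [[k' [|]]|k'] //= /eqP[->]; rewrite ?eqxx//.
Qed.

(** On an infinite edge there is one exponential, and it has no zero. On a bounded edge, multiplying
    by exp(izx) gives c + d exp(2izx) = 0 almost everywhere. A point in each half of the edge gives
    two such equations; exp(2izx) has different moduli at these points since Im z > 0, so d = 0 and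
    then c = 0. *)
Lemma waves_eq0 (z : C) (t : eend G -> C) : 0 < Im z ->
  ae_eqf predT (waves z t) (fun _ _ => 0) -> forall e, t e = 0.
Proof.
move=> z0 h.
have Ce (x : C) : Cexp x != 0 by rewrite -normc_eq0' normc_Cexp gt_eqF ?expR_gt0.
have /ae_eqfP h' := h.
case=> [[k b]|k]; last first.
  have [|x _] := @ae_lebR_exists 0 1 (fun x => waves z t (inr k) x = 0) ltr01.
    apply: filterS (h' (inr k) isT) => x hx /=; rewrite in_itv/= => /andP[x0 _].
    by apply: hx; rewrite /edge_set/= in_itv/= x0.
  rewrite waves_inr => /eqP; rewrite mulf_eq0 (negbTE (Ce _)) orbF.
  by move/eqP.
have l0 := len_gt0 k.
have ex (c d : R) : 0 <= c -> d <= len k -> c < d ->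
    exists2 x, c < x < d & t (inl (k, true)) + t (inl (k, false)) * Cexp (2 * Ci * z * x%:C) = 0.
  move=> c0 dk cd.
  have [|x xcd hx] := @ae_lebR_exists c d (fun x => waves z t (inl k) x = 0) cd.
    apply: filterS (h' (inl k) isT) => x hx /=; rewrite in_itv/= => /andP[cx xd].
    by apply: hx; rewrite /edge_set/= in_itv/= (le_lt_trans c0 cx) (lt_le_trans xd dk).
  exists x => //; have := congr1 (fun y => Cexp (Ci * z * x%:C) * y) hx.
  rewrite waves_inl mulr0 mulrDr ![Cexp _ * (_ * _)]mulrCA /basis_fun /= -!CexpD.
  have -> : Ci * z * x%:C + -1 * Ci * z * x%:C = 0 by ring.
  have -> : Ci * z * x%:C + 1 * Ci * z * x%:C = 2 * Ci * z * x%:C by ring.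
  by rewrite Cexp0 mulr1.
have h2 : 0 < len k / 2 by rewrite divr_gt0.
have h3 : len k / 2 < len k by rewrite ltr_pdivrMr// ltr_pMr// ltr1n.
have [x /andP[x0 xm] hx] := ex _ _ (lexx 0) (ltW h3) h2.
have [y /andP[my yl] hy] := ex _ _ (ltW h2) (lexx _) h3.
have xy : x < y := lt_trans xm my.
have tf : t (inl (k, false)) = 0.
  have : t (inl (k, false)) * (Cexp (2 * Ci * z * y%:C) - Cexp (2 * Ci * z * x%:C)) = 0.
    rewrite mulrBr -(addrK (t (inl (k, true))) (_ * Cexp (2 * Ci * z * y%:C))).
    by rewrite [X in X - _ - _]addrC hy sub0r -opprD hx oppr0.
  move/eqP; rewrite mulf_eq0 => /orP[/eqP//|].
  rewrite subr_eq0 => /eqP /(congr1 (@ComplexField.Normc.normc R)).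
  have nE (w : R) : ComplexField.Normc.normc (Cexp (2 * Ci * z * w%:C)) = expR (- 2 * Im z * w).
    rewrite normc_Cexp; congr expR; rewrite -mulrA (_ : 2 * Ci * _ = (Ci * z * w%:C) + (Ci * z * w%:C)).
      by rewrite ReD !ReM !ImM /=; ring.
    by ring.
  rewrite !nE => /expR_inj; rewrite !mulNr => /oppr_inj /mulfI e.
  have : y = x by apply: e; rewrite mulf_neq0// gt_eqF.
  by move=> yx; move: xy; rewrite yx ltxx.
have tt : t (inl (k, true)) = 0 by move: hx; rewrite tf mul0r addr0.
by case: b.
Qed.

End Waves.

(** * The kernel solves the boundary value problem *)

Section ResolventKernel.
Context {R : realType} {G : metric_graph R}.
Local Notation C := R[i].
Local Notation Ci := (Ci : C).
Local Notation leb := (@lebR R).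
Local Notation D := (`]0, +oo[%classic : set R).
Variables (s : 'I_(dimN G) -> vcond G) (dd dc : C -> C)
  (Mc Mp : C -> 'M[C]_(dimN G)) (X : eU G -> C -> 'cV[C]_(dimN G))
  (E : set R -> gfun G -> gfun G) (k : eU G).
Hypotheses (hs : vertex_system s) (hA1 : A1 s dd dc Mc Mp) (hA2 : A2 s dc Mp X)
  (hR : resolution_of_identity E).

(* A vector in the kernel gives waves in D(H) that are eigenfunctions of H for the
   nonreal number [z ^+ 2]. *)
Lemma det_Dmx_neq0 (z : C) : 0 < Im z -> Im (z ^+ 2) != 0 -> \det (Dmx s z) != 0.
Proof.
move=> z0 z2; apply/negP; rewrite -det_tr => /det0P[v v0 vD].
have Dv : Dmx s z *m v^T = 0 by apply: (can_inj trmxK); rewrite trmx_mul trmxK trmx0.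
pose t (e : eend G) := v^T (enum_rank e) 0.
have hw : ae_eqf predT (waves z t) (fun _ _ => 0).
  have L : laplace predT (waves z t) (waves' z t) (fun j x => z ^+ 2 * waves z t j x).
    apply: laplace_eode => [j _|]; first exact: eode_waves.
    have -> : trace_nder (waves' z t) = fun e => Ci * z * \sum_e' t e' * basis_nder z e' e.
      by apply/funext => e; exact: trace_waves'.
    apply: vertex_conditionsZ.
    have -> : trace_val (waves z t) = fun e => \sum_e' t e' * basis_val z e' e.
      by apply/funext => e; exact: trace_waves.
    by apply: hs.2 => n; rewrite -Dmx_mul Dv mxE.
  apply: (opH_nonreal_eigen hR z2); first by case: L.
  exact: laplace_opH L.
have t0 := waves_eq0 z0 hw.
move/eqP: v0; apply; apply/rowP => i; rewrite mxE.
by have := t0 (enum_val i); rewrite /t enum_valK mxE.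
Qed.

Definition on_edge (fk : R -> C) : gfun G := fun j x => if j == inr k then fk x else 0.

Variables (fk : R -> C) (r : R).
Hypotheses (mf : cmfun setT fk) (intf : leb.-integrable D (EFin \o (fun y => normc (fk y))))
  (f2 : l2on D fk) (fr : forall y, r < y -> fk y = 0).

Lemma inL2_on_edge : inL2 predT (on_edge fk).
Proof.
apply/inL2P => j _; rewrite /on_edge; case: eqP => [->|_]; first exact: f2.
by case: (eode0 j).
Qed.

Lemma inY_on_edge : inY k (on_edge fk).
Proof.
split; first exact: inL2_on_edge.
by move=> j jk; apply: aeW => x _; rewrite /on_edge (negbTE jk).
Qed.

Definition fourier (z : C) : C := cint leb D (fun y => Cexp (Ci * z * y%:C) * fk y).

Lemma cig_fourier (z : C) : 0 < Im z -> cig leb D (fun y => Cexp (Ci * z * y%:C) * fk y).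
Proof.
move=> z0; apply: (cig_dom (measurable_itv _) _ intf).
  apply: cmfunTS; apply: cmfunM => //.
  by have := cmfun_Cexp_affine (Ci * z) 0; under eq_fun do rewrite addr0.
move=> y; rewrite /= in_itv/= andbT => y0; rewrite normcM' -[leRHS]mul1r ler_wpM2r ?normc_ge0//.
by rewrite normc_wave// -expR0 ler_expR mulNr oppr_le0 mulr_ge0// ltW.
Qed.

Lemma green0 (z : C) y : 0 < y -> green z 0 y = Cexp (Ci * z * y%:C).
Proof. by move=> y0; rewrite /green sub0r normrN gtr0_norm. Qed.

Lemma psol0 z : psol z fk 0 = fourier z.
Proof. by apply: eq_cint => y; rewrite /= in_itv/= andbT => y0; rewrite green0. Qed.

Lemma psol'0 z : 0 < Im z -> psol' z fk 0 = - (Ci * z) * fourier z.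
Proof.
move=> z0; rewrite /psol' /fourier -cintZ//; [|exact: cig_fourier].
apply: eq_cint => y; rewrite /= in_itv/= andbT => y0.
by rewrite green0// /sg ltNge (ltW y0)/= rmorphN1; ring.
Qed.

Lemma Fvec_on_edge z :
  Fvec z (on_edge fk) = ((2 * Ci * z)^-1 * fourier z) *: delta_mx (enum_rank (inr k : eend G)) 0.
Proof.
apply/colP => n; rewrite !mxE eqxx andbT; set e := enum_val n.
have -> : (n == enum_rank (inr k : eend G)) = (e == inr k).
  by rewrite -(inj_eq enum_val_inj) enum_rankK.
have ee : (edge_of e == inr k) = (e == inr k) by case: e => [[k' b]|k'].
have [ek|ne] := eqVneq e (inr k).
  have h : cint leb (edge_set (edge_of (inr k : eend G)))
    (fun y => Cexp (Ci * z * `|epos (inr k : eend G) - y|%:C) * on_edge fk (edge_of (inr k : eend G)) y) = fourier z.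
    apply: eq_cint => y; rewrite /= in_itv/= andbT => y0.
    by rewrite sub0r normrN gtr0_norm// /on_edge eqxx.
  by rewrite mulr1 ek [X in _ * X = _]h.
have h : cint leb (edge_set (edge_of e))
    (fun y => Cexp (Ci * z * `|epos e - y|%:C) * on_edge fk (edge_of e) y) = 0.
  rewrite -[RHS](cint0 leb (edge_set (edge_of e))); apply: eq_cint => y _.
  by rewrite /on_edge ee (negbTE ne) mulr0.
by rewrite mulr0 [X in _ * X = _]h mulr0.
Qed.

Definition resolvent_fun (z : C) : gfun G :=
  fun j x => cint leb D (fun y => Kkernel_z s dc Mc X k j x y z * fk y).

Definition wave_coef (z : C) (e : eend G) : C :=
  (2 * Ci * z)^-1 * (kcoef s Mc X k z (enum_rank e) 0 / dc z) * fourier z.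

(** exp(iz(+-x + y)) factors into a wave in x and the Fourier weight in y, so this part of the
    kernel yields a combination of waves; the remaining part is the particular solution, present on
    the edge k only. *)
Lemma resolvent_funE (z : C) j x : 0 < Im z ->
  resolvent_fun z j x =
  (j == inr k)%:R * ((2 * Ci * z)^-1 * psol z fk x) + waves z (wave_coef z) j x.
Proof.
move=> z0; have mD : measurable D by exact: measurable_itv.
have cg := cig_green z0 mf intf x.
have cF := cig_fourier z0.
transitivity (cint leb D (fun y => (j == inr k)%:R * (2 * Ci * z)^-1 * (green z x y * fk y) +
   \sum_(e : eend G | edge_of e == j) ((2 * Ci * z)^-1 *
      (kcoef s Mc X k z (enum_rank e) 0 / dc z) * basis_fun z e x) * (Cexp (Ci * z * y%:C) * fk y))).
  apply: eq_cint => y _; rewrite /Kkernel_z mulrDr mulrDl; congr (_ + _).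
    by case: (j == inr k); rewrite ?mul1r ?mul0r ?mulr0 ?mul0r// /green mulrA.
  rewrite mulr_sumr mulr_suml; apply: eq_bigr => e _.
  rewrite (_ : Ci * z * (expsign e * x%:C + y%:C) = expsign e * Ci * z * x%:C + Ci * z * y%:C); last by ring.
  by rewrite CexpD /basis_fun; ring.
rewrite cintD//; [|exact: cigZ|by apply: cig_sum => // e _; exact: cigZ].
rewrite cintZ// cint_sum//; last by move=> e _; exact: cigZ.
congr (_ + _); first by rewrite mulrA.
apply: eq_bigr => e _; rewrite cintZ// /wave_coef /fourier; ring.
Qed.

(** Cramer's rule with the splitting of the adjugate: D^-1 = (M_p + d_d M_c) / (d_d d_c). The term
    in M_c loses d_d at once and gives the first summand of [kcoef]; the term in M_p is what (A2)
    evaluates, and gives [X]. *)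
Lemma Dmx_wave_coef (z : C) : 0 < Im z -> Im (z ^+ 2) != 0 ->
  Dmx s z *m (\col_n wave_coef z (enum_val n)) = Rmx s *m Fvec z (on_edge fk).
Proof.
move=> z0 z2; have d0 := det_Dmx_neq0 z0 z2.
have zP : (Cplus `|` Creal : set C) z by left.
have zP' : (Cplus `|` Creal_star : set C) z by left.
have zP'' : (Cplus `|` Creal_pos : set C) z by left.
have dE := A1_det hA1 zP.
have [dd0 dc0] : dd z != 0 /\ dc z != 0.
  by move: d0; rewrite dE mulf_eq0 negb_or => /andP[].
have F : (fourier z) = cint (@lebesgue_measure R) `]0, +oo[ (fun y => Cexp (Ci * z * y%:C) * on_edge fk (inr k) y).
  by rewrite /on_edge eqxx.
have a2 : (\det (Dmx s z))^-1 *: (Mp z *m Rmx s *m Fvec z (on_edge fk)) =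
   ((2 * Ci * z * dc z)^-1 * fourier z) *: X k z.
  rewrite F; apply: (hA2 k).2 => //; first exact: inY_on_edge.
  have [c1 c2] := cig_fourier z0.
  by split; rewrite /on_edge eqxx; apply/integrable_lebR => //; exact: measurable_itv.
have cE : \col_n wave_coef z (enum_val n) =
   (\det (Dmx s z))^-1 *: (\adj (Dmx s z) *m (Rmx s *m Fvec z (on_edge fk))).
  rewrite (A1_adj hA1 zP') mulmxDl scalerDr mulmxA a2 -scalemxAl dE scalerA invfM.
  have -> : (dd z * dc z)^-1 * dd z = (dc z)^-1 by rewrite invfM mulrAC mulVf// mul1r.
  rewrite Fvec_on_edge -!scalemxAr scalerA.
  apply/colP => n; rewrite !mxE /wave_coef enum_valK /kcoef -mulmxA !mxE !invfM; ring.
by rewrite cE -scalemxAr mulmxA mul_mx_adj mul_scalar_mx scalerA mulVf// scale1r.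
Qed.

(** The particular solution has value F and outward normal derivative iz F at the end of the edge k,
    and [Rmx] is minus the vertex conditions on such data. After division of the derivatives by iz
    the conditions for the sum read D(z) t - R F = 0. *)
Lemma opH_resolvent_fun (z : C) : 0 < Im z -> Im (z ^+ 2) != 0 ->
  opH (resolvent_fun z) (fun j x => z ^+ 2 * resolvent_fun z j x - on_edge fk j x).
Proof.
move=> z0 z2; have zn : z != 0.
  by apply: contraTneq z0 => ->; rewrite ltxx.
have iz0 : 2 * Ci * z != 0 by rewrite !mulf_neq0// ?Ci_neq0// pnatr_eq0.
pose ps (j : edge G) x := (j == inr k)%:R * ((2 * Ci * z)^-1 * psol z fk x).
pose ps' (j : edge G) x := (j == inr k)%:R * ((2 * Ci * z)^-1 * psol' z fk x).
have uE : resolvent_fun z = fun j x => ps j x + waves z (wave_coef z) j x.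
  by apply/funext => j; apply/funext => x; exact: resolvent_funE.
apply: (@laplace_opH _ _ _ (fun j x => ps' j x + waves' z (wave_coef z) j x)).
rewrite uE; apply: laplace_eode => [j _|].
  have -> : (fun x => z ^+ 2 * (ps j x + waves z (wave_coef z) j x) - on_edge fk j x) =
    (fun x => (j == inr k)%:R * ((2 * Ci * z)^-1 * psol'' z fk x) + z ^+ 2 * waves z (wave_coef z) j x).
    apply/funext => x; rewrite /ps /psol'' /on_edge; case: (j == inr k) => /=.
      by field; rewrite zn Ci_neq0.
    by ring.
  have hp : eode j (ps j) (ps' j) (fun x => (j == inr k)%:R * ((2 * Ci * z)^-1 * psol'' z fk x)).
    have [jk|jk] := boolP (j == inr k); last first.
      have := eode0 j; congr eode; apply/funext => x; rewrite /ps /ps' ?(negbTE jk); exact/esym/mul0r.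
    have := eodeZ (2 * Ci * z)^-1 (eode_psol z0 mf intf f2 fr k).
    rewrite (eqP jk); congr eode; apply/funext => x; rewrite /ps /ps' ?eqxx; exact/esym/mul1r.
  have := eode_comb 1 hp (eode_waves (wave_coef z) j z0).
  by congr eode; apply/funext => x; rewrite mul1r.
pose t := wave_coef z.
pose Fe (e : eend G) := (e == inr k)%:R * ((2 * Ci * z)^-1 * fourier z).
have ee (e : eend G) : (edge_of e == inr k) = (e == inr k) by case: e => [[k' b]|k'].
have tv : trace_val (fun j x => ps j x + waves z t j x) =
    fun e => \sum_e' t e' * basis_val z e' e + Fe e.
  apply/funext => e; rewrite -trace_waves /trace_val addrC; congr (_ + _).
  rewrite /ps /Fe ee; have [->|_] := eqVneq e (inr k); last by rewrite !mul0r.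
  by rewrite psol0.
have tn : trace_nder (fun j x => ps' j x + waves' z t j x) =
    fun e => Ci * z * (\sum_e' t e' * basis_nder z e' e + Fe e).
  apply/funext => e; rewrite [RHS]mulrDr -trace_waves' /trace_nder mulrDr addrC; congr (_ + _).
  rewrite /ps' /Fe ee; have [->|_] := eqVneq e (inr k); last by rewrite !mul0r !mulr0.
  by rewrite psol'0//=; ring.
rewrite tv tn; apply: vertex_conditionsZ; apply: hs.2 => n.
rewrite vcond_formD.
have tE e' : (\col_n wave_coef z (enum_val n)) (enum_rank e') 0 = t e'.
  by rewrite mxE enum_rankK.
have -> : vcond_form (s n) (fun e => \sum_e' t e' * basis_val z e' e)
    (fun e => \sum_e' t e' * basis_nder z e' e) = (Dmx s z *m (\col_n wave_coef z (enum_val n))) n 0.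
  by rewrite Dmx_mul; apply: eq_vcond_form => e; apply: eq_bigr => e' _; rewrite tE.
rewrite (Dmx_wave_coef z0 z2) Fvec_on_edge -scalemxAr mxE mxE (bigD1 (enum_rank (inr k : eend G)))//=.
rewrite big1 => [|j /negbTE jk]; last by rewrite [X in _ * X]mxE jk mulr0.
rewrite addr0 mxE [X in _ * (_ * X)]mxE !eqxx mulr1 enum_rankK vcond_formZ; ring.
Qed.

End ResolventKernel.

(** * Boundary values of the kernel on the real axis *)

Section SquareRootPath.
Context {R : realType}.
Local Notation C := R[i].
Local Notation Ci := (Ci : C).

(** For e >= 0, the square root of l + i e with nonnegative real and imaginary parts. The closed
    form is continuous on the whole plane, which gives the boundary values on the real axis
    directly. *)
Definition zpath (p : R * R) : C :=
  let N := Num.sqrt (p.1 ^+ 2 + p.2 ^+ 2) in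
  Num.sqrt ((N + p.1) / 2) +i* Num.sqrt ((N - p.1) / 2).

Lemma norm_le_hypot (l e : R) : `|l| <= Num.sqrt (l ^+ 2 + e ^+ 2).
Proof. by rewrite -sqrtr_sqr ler_wsqrtr// lerDl sqr_ge0. Qed.

Lemma zpath_sqr (l e : R) : 0 <= e -> zpath (l, e) ^+ 2 = l +i* e.
Proof.
move=> e0; rewrite /zpath /=; set N := Num.sqrt (l ^+ 2 + e ^+ 2).
have Nl : `|l| <= N := norm_le_hypot l e.
have NN : N ^+ 2 = l ^+ 2 + e ^+ 2 by rewrite sqr_sqrtr// addr_ge0 ?sqr_ge0.
have h1 : 0 <= (N + l) / 2.
  by rewrite divr_ge0// -lerBlDr sub0r (le_trans _ Nl)// -normrN ler_norm.
have h2 : 0 <= (N - l) / 2 by rewrite divr_ge0// subr_ge0 (le_trans _ Nl)// ler_norm.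
have pE : Num.sqrt ((N + l) / 2) * Num.sqrt ((N - l) / 2) = e / 2.
  have ee : (N + l) / 2 * ((N - l) / 2) = (e / 2) ^+ 2.
    have -> : (N + l) / 2 * ((N - l) / 2) = (N ^+ 2 - l ^+ 2) / 4 by field.
    by rewrite NN; field.
  rewrite -sqrtrM// ee.
  by rewrite sqrtr_sqr ger0_norm// divr_ge0.
apply: ceqP; rewrite expr2 ?ReM ?ImM /=.
  by rewrite -!expr2 !sqr_sqrtr//; field.
by rewrite [X in _ + X]mulrC pE; field.
Qed.

Lemma zpath_Im_ge0 (l e : R) : 0 <= Im (zpath (l, e)).
Proof. exact: sqrtr_ge0. Qed.

Lemma zpath_Im_gt0 (l e : R) : 0 < e -> 0 < Im (zpath (l, e)).
Proof.
move=> e0; rewrite lt_neqAle zpath_Im_ge0 andbT eq_sym; apply/eqP => z0.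
have := zpath_sqr l (ltW e0) => /(congr1 (@complex.Im R)).
by rewrite expr2 ImM z0 mulr0 mul0r addr0 /= => ee; rewrite -ee ltxx in e0.
Qed.

Lemma zpath0 (l : R) : 0 <= l -> zpath (l, 0) = (Num.sqrt l)%:C.
Proof.
move=> l0; rewrite /zpath /= expr0n addr0 sqrtr_sqr ger0_norm// subrr mul0r sqrtr0.
by rewrite (_ : (l + l) / 2 = l)//; field.
Qed.

Lemma zpath_neq0 (l e : R) : 0 < l -> 0 <= e -> zpath (l, e) != 0.
Proof.
move=> l0 e0; apply/eqP => z0; have := zpath_sqr l e0.
by rewrite z0 expr0n => /(congr1 (@complex.Re R)) /= l1; rewrite -l1 ltxx in l0.
Qed.

Lemma ccont_zpath : ccont zpath.
Proof.
move=> p.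
have c1 : fst q @[q --> p] --> p.1 by exact: cvg_fst.
have c2 : snd q @[q --> p] --> p.2 by exact: cvg_snd.
have cN : Num.sqrt (q.1 ^+ 2 + q.2 ^+ 2) @[q --> p] --> Num.sqrt (p.1 ^+ 2 + p.2 ^+ 2).
  apply: continuous_cvg; first exact: sqrt_continuous.
  by apply: cvgD; rewrite !expr2; apply: cvgM.
split; apply: continuous_cvg; try exact: sqrt_continuous; apply: cvgM; try exact: cvg_cst.
  exact: cvgD.
exact: cvgB.
Qed.

Lemma ccvg_compact_bounded (T : topologicalType) (A : set T) (f : T -> C) :
  compact A -> (forall p, A p -> ccvg (nbhs p) f (f p)) ->
  exists M, forall p, A p -> normc (f p) <= M.
Proof.
move=> cA cf.
have cn : {within A, continuous (fun p => normc (f p) : R)}.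
  apply: continuous_in_subspaceT => p /set_mem Ap; exact: cvg_normc (cf p Ap).
have /compact_bounded[M [_ hM]] := continuous_compact cn cA.
exists (M + 1) => p Ap; have /hM hM1 : M < M + 1 by rewrite ltrDl.
by apply: le_trans (ler_norm _) _; apply: hM1; exists p.
Qed.

(* [F] restricted to [Z] is continuous along the square root of [l + i e],
   jointly in [l] and [e]. *)
Definition pathfun (Z : set C) (F : C -> C) :=
  exists Phi : R * R -> C, ccont Phi /\ forall p, Z (zpath p) -> F (zpath p) = Phi p.

Lemma pathfun_poly (J : finType) (c : J -> R) (Z : set C) F :
  poly_in_exp c Z F -> pathfun Z F.
Proof.
move=> [P hP]; exists (fun p => mpoly.meval (fun n => Cexp (Ci * zpath p * (c (enum_val n))%:C)) P).
split=> [p|p Zp]; last exact: hP.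
under eq_fun do rewrite mpoly.mevalE.
rewrite mpoly.mevalE; apply: ccvg_sum => m _; apply: ccvgM; first exact: ccvg_cst.
apply: ccvg_prod => i _; apply: ccvgX; apply: ccvg_Cexp.
by apply: ccvgM; [apply: ccvgM; [exact: ccvg_cst|exact: ccont_zpath]|exact: ccvg_cst].
Qed.

Lemma pathfunS (Z Z' : set C) F : Z' `<=` Z -> pathfun Z F -> pathfun Z' F.
Proof. by move=> ZZ [P [cP hP]]; exists P; split=> // p /ZZ; exact: hP. Qed.

Lemma pathfun_cst (Z : set C) c : pathfun Z (fun=> c).
Proof. by exists (fun=> c); split=> // p; exact: ccvg_cst. Qed.

Lemma pathfunD (Z : set C) F F' : pathfun Z F -> pathfun Z F' -> pathfun Z (fun z => F z + F' z).
Proof.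
move=> [P [cP hP]] [Q [cQ hQ]]; exists (fun p => P p + Q p).
by split=> [p|p Zp]; [exact: ccvgD|rewrite hP// hQ].
Qed.

Lemma pathfunM (Z : set C) F F' : pathfun Z F -> pathfun Z F' -> pathfun Z (fun z => F z * F' z).
Proof.
move=> [P [cP hP]] [Q [cQ hQ]]; exists (fun p => P p * Q p).
by split=> [p|p Zp]; [exact: ccvgM|rewrite hP// hQ].
Qed.

Lemma pathfun_sum (Z : set C) (I : Type) (r : seq I) (F : I -> C -> C) :
  (forall i, pathfun Z (F i)) -> pathfun Z (fun z => \sum_(i <- r) F i z).
Proof.
move=> hF; elim: r => [|i r ih].
  by under eq_fun do rewrite big_nil; exact: pathfun_cst.
by under eq_fun do rewrite big_cons; exact: pathfunD.
Qed.

End SquareRootPath.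

(** * Continuity and bounds of the kernel up to the real axis *)

Section KernelPath.
Context {R : realType} {G : metric_graph R}.
Local Notation C := R[i].
Local Notation Ci := (Ci : C).
Variables (s : 'I_(dimN G) -> vcond G) (dd dc : C -> C)
  (Mc Mp : C -> 'M[C]_(dimN G)) (X : eU G -> C -> 'cV[C]_(dimN G))
  (E : set R -> gfun G -> gfun G) (k : eU G).
Hypotheses (hs : vertex_system s) (hA1 : A1 s dd dc Mc Mp) (hA2 : A2 s dc Mp X)
  (hR : resolution_of_identity E).

Lemma ccvg_app {T U : topologicalType} (F : T -> C) (g : U -> T) (H : set_system U) (p : T) :
  ccvg (nbhs p) F (F p) -> g u @[u --> H] --> p -> ccvg H (fun u => F (g u)) (F p).
Proof.
by move=> [c1 c2] cg; split; [exact: (cvg_comp _ _ cg c1)|exact: (cvg_comp _ _ cg c2)].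
Qed.

Lemma cvg_pairR {T} {F : set_system T} {FF : Filter F} (f g : T -> R) (l e : R) :
  f t @[t --> F] --> l -> g t @[t --> F] --> e ->
  (f t, g t) @[t --> F] --> ((l, e) : R * R).
Proof. by move=> fl ge; exact: (@cvg_pair _ _ _ F (nbhs l) (nbhs e) _ _ _ f g). Qed.

Lemma zpath_domain (l e : R) : 0 < l -> 0 <= e -> (Cplus `|` Creal_pos : set C) (zpath (l, e)).
Proof.
move=> l0; rewrite le_eqVlt => /orP[/eqP <-|e0]; last by left; exact: zpath_Im_gt0.
by right; rewrite zpath0 ?(ltW l0)//; split => //=; rewrite sqrtr_gt0.
Qed.

(** On the real axis this is part of (A1). Above it, d_c is a factor of the determinant of D(z),
    which does not vanish there. *)
Lemma dc_zpath_neq0 (l e : R) : 0 < l -> 0 <= e -> dc (zpath (l, e)) != 0.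
Proof.
move=> l0 e0; have := e0; rewrite le_eqVlt => /orP[/eqP <-|e1].
  by apply: (A1_dc_neq0 hA1); rewrite zpath0 ?(ltW l0).
have z0 := zpath_Im_gt0 l e1.
have : \det (Dmx s (zpath (l, e))) != 0.
  apply: (det_Dmx_neq0 hs hR z0).
  by rewrite zpath_sqr//= gt_eqF.
by rewrite (A1_det hA1) ?mulf_eq0; [rewrite negb_or => /andP[]|left].
Qed.

Lemma pathfun_dc : pathfun setT dc.
Proof. by have [r _ h] := A1_dc_poly hA1; exact: pathfun_poly h. Qed.

Lemma pathfun_kcoef n :
  pathfun (Cplus `|` Creal_pos) (fun z => kcoef s Mc X k z n 0).
Proof.
have -> : (fun z => kcoef s Mc X k z n 0) = fun z =>
   \sum_j (\sum_i Mc z n i * Rmx s i j) * (delta_mx (enum_rank (inr k : eend G)) 0 : 'cV[C]_(dimN G)) j 0 + X k z n 0.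
  by apply/funext => z; rewrite !mxE; congr (_ + _); apply: eq_bigr => j _; rewrite mxE.
apply: pathfunD; last by have [r _ h] := (hA2 k).1 n; exact: pathfun_poly h.
apply: pathfun_sum => j; apply: pathfunM; last exact: pathfun_cst.
apply: pathfun_sum => i; apply: pathfunM; last exact: pathfun_cst.
have [r _ h] := A1_Mc_poly hA1 n i.
apply: pathfunS (pathfun_poly h) => z [?|[z1 z2]]; first by left.
by right; split => //; apply: contraTneq z2 => ->; rewrite ltxx.
Qed.

(** (A1) and (A2) give exponential polynomials on the domain of z only, so measurability is stated
    for a function [K] of all real arguments which agrees with the kernel for l > 0 and e >= 0. The
    bound comes from compactness of [a, b] x [0, 1] with a > 0, the limit from continuity at e = 0;
    both rest on z and d_c having no zero there. *)
Lemma kernel_path : exists K : R -> R -> edge G -> R -> R -> C,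
  [/\ forall l e j x y, 0 < l -> 0 <= e ->
        Kkernel_z s dc Mc X k j x y (zpath (l, e)) = K l e j x y,
      forall e j, cmfun setT (fun q : (R * R) * R => K q.1.1 e j q.1.2 q.2),
      forall (a b r : R), 0 < a -> exists M, forall l e j x y, a < l < b -> 0 <= e <= 1 ->
        0 < x <= r -> 0 < y <= r -> normc (K l e j x y) <= M
    & forall l j x y, 0 < l ->
        ccvg \oo (fun n => K l n.+1%:R^-1 j x y) (K l 0 j x y)].
Proof.
have [Pd [cPd hPd]] := pathfun_dc.
have /choice[Pk hPk] := pathfun_kcoef.
pose I0 (p : R * R) : C := (2 * Ci * zpath p)^-1.
pose Psi (e : eend G) (p : R * R) : C := I0 p * (Pk (enum_rank e) p / Pd p).
have cI0 (l e : R) : 0 < l -> 0 <= e -> ccvg (nbhs (l, e)) I0 (I0 (l, e)).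
  move=> l0 e0; apply: ccvgV; first by rewrite !mulf_neq0 ?pnatr_eq0 ?Ci_neq0 ?zpath_neq0.
  by apply: ccvgM; [exact: ccvg_cst|exact: ccont_zpath].
have cPsi e' (l e : R) : 0 < l -> 0 <= e -> ccvg (nbhs (l, e)) (Psi e') (Psi e' (l, e)).
  move=> l0 e0; apply: ccvgM; first exact: cI0.
  apply: ccvgM; first exact: (hPk _).1.
  by apply: ccvgV; [rewrite -hPd// dc_zpath_neq0|exact: cPd].
pose W (t : R) (p : R * R) : C := Cexp (Ci * zpath p * t%:C).
have cW (t : R) (p : R * R) : ccvg (nbhs p) (W t) (W t p).
  by apply: ccvg_Cexp; apply: ccvgM; [apply: ccvgM; [exact: ccvg_cst|exact: ccont_zpath]|exact: ccvg_cst].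
pose sx (e : eend G) (x : R) : R := if e is inl (_, true) then - x else x.
have sxE e (x : R) : expsign e * x%:C = (sx e x)%:C.
  by rewrite /sx /expsign; case: e => [[? []]|?]; rewrite ?mul1r// mulN1r rmorphN.
pose K (l e : R) j (x y : R) : C := (j == inr k)%:R * (I0 (l, e) * W `|x - y| (l, e)) +
  \sum_(e' : eend G | edge_of e' == j) Psi e' (l, e) * W (sx e' x + y) (l, e).
exists K; split.
- move=> l e j x y l0 e0; have zd := zpath_domain l0 e0.
  rewrite /Kkernel_z mulrDr; congr (_ + _).
    by case: (j == inr k); rewrite ?mul1r// mul0r mulr0.
  rewrite mulr_sumr; apply: eq_bigr => e' _.
  rewrite /Psi /W (hPk _).2// hPd// sxE -rmorphD/= /I0; ring.
- move=> e j.
  have mP (F : R * R -> C) : ccont F -> cmfun setT (fun q : (R * R) * R => F (q.1.1, e)).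
    move=> cF; apply: (@cmfun_comp _ _ _ _ _ (fun l => F (l, e)) (fun q : (R * R) * R => q.1.1)).
      apply: cmfun_ccont => l; apply: (ccvg_app (cF _)).
      by apply: cvg_pairR; [exact: cvg_id|exact: cvg_cst].
    by apply: measurableT_comp; [exact: measurable_fst|exact: measurable_fst].
  have mz := mP _ (@ccont_zpath R).
  have mx : measurable_fun setT (fun q : (R * R) * R => q.1.2).
    by apply: measurableT_comp; [exact: measurable_snd|exact: measurable_fst].
  have my : measurable_fun setT (fun q : (R * R) * R => q.2) by exact: measurable_snd.
  have mI : cmfun setT (fun q : (R * R) * R => I0 (q.1.1, e)).
    by apply: cmfunV; apply: cmfunM => //; exact: cmfun_cst.
  have mW (t : R -> R -> R) : measurable_fun setT (fun q : (R * R) * R => t q.1.2 q.2) ->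
      cmfun setT (fun q : (R * R) * R => W (t q.1.2 q.2) (q.1.1, e)).
    move=> mt; apply: cmfun_Cexp; apply: cmfunM; last exact: cmfun_real.
    by apply: cmfunM => //; exact: cmfun_cst.
  apply: cmfunD.
    apply: cmfunM; first exact: cmfun_cst.
    apply: cmfunM => //; apply: (mW (fun x y => `|x - y|)).
    by apply: measurableT_comp => //; exact: measurable_funB.
  apply: cmfun_sum => e' _; apply: cmfunM.
    apply: cmfunM => //; apply: cmfunM; first exact: (mP _ (hPk _).1).
    by apply: cmfunV; exact: (mP _ cPd).
  apply: (mW (fun x y => sx e' x + y)); apply: measurable_funD => //.
  by case: e' => [[? []]|?] //=; exact: measurableT_comp.
- move=> a b r a0.
  pose A : set (R * R) := `[a, b]%classic `*` `[0, 1]%classic.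
  have cA : compact A by apply: compact_setX; exact: segment_compact.
  have AP (p : R * R) : A p -> 0 < p.1 /\ 0 <= p.2.
    move=> [] /=; rewrite !in_itv/= => /andP[h1 _] /andP[h2 _].
    by rewrite h2 (lt_le_trans a0).
  have [M0 hM0] : exists M, forall p, A p -> normc (zpath p) <= M.
    by apply: ccvg_compact_bounded => // p _; exact: ccont_zpath.
  have [M1 hM1] : exists M, forall p, A p -> normc (I0 p) <= M.
    by apply: ccvg_compact_bounded => // -[l e] /AP[? ?]; exact: cI0.
  have /choice[M2 hM2] : forall e', exists M, forall p, A p -> normc (Psi e' p) <= M.
    by move=> e'; apply: ccvg_compact_bounded => // -[l e] /AP[? ?]; exact: cPsi.
  (* The lengths |x - y| and +-x + y in the exponentials are at most 2 r in modulus, and Im z is at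
     most [M0]. *)
  pose B : R := expR (M0 * (2 * r)).
  exists (`|M1| * B + \sum_e' `|M2 e'| * B) => l e j x y /andP[al lb] e01 /andP[x0 xr] /andP[y0 yr].
  have Ale : A (l, e) by split; rewrite /= in_itv/= ?(ltW al) ?(ltW lb)//.
  have hW t : `|t| <= 2 * r -> normc (W t (l, e)) <= B.
    move=> tr; rewrite normc_wave ler_expR mulNr -mulrN.
    apply: le_trans (ler_norm _) _; rewrite normrM normrN ler_pM//.
    exact: le_trans (absIm_le _) (hM0 _ Ale).
  have B0 : 0 <= B by exact: expR_ge0.
  apply: le_trans (normcD' _ _) _; apply: lerD.
    case: (j == inr k); last by rewrite mul0r normc0' mulr_ge0.
    rewrite mul1r normcM'; apply: ler_pM; rewrite ?normc_ge0//.
      exact: le_trans (hM1 _ Ale) (ler_norm _).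
    by apply: hW; rewrite normr_id ler_norml; apply/andP; split; lra.
  apply: le_trans (normc_sum _ _ _) _; rewrite big_mkcond; apply: ler_sum => e' _.
  case: ifP => _; last by rewrite mulr_ge0.
  rewrite normcM'; apply: ler_pM; rewrite ?normc_ge0//.
    exact: le_trans (hM2 _ _ Ale) (ler_norm _).
  by apply: hW; rewrite ler_norml /sx; case: e' => [[? []]|?]; apply/andP; split; lra.
- move=> l j x y l0.
  have cl : ((l, n.+1%:R^-1) : R * R) @[n --> \oo] --> ((l, 0) : R * R).
    by apply: cvg_pairR; [exact: cvg_cst|exact: cvg_harmonic].
  apply: ccvgD.
    apply: ccvgM; first exact: ccvg_cst.
    apply: ccvgM; [apply: (ccvg_app _ cl); exact: cI0|apply: (ccvg_app _ cl); exact: cW].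
  apply: ccvg_sum => e' _.
  by apply: ccvgM; [apply: (ccvg_app _ cl); exact: cPsi|apply: (ccvg_app _ cl); exact: cW].
Qed.

End KernelPath.

(** * Complex conjugation and H *)

Section Conjugation.
Context {R : realType} {G : metric_graph R}.
Local Notation C := R[i].

Lemma vertex_conditionsJ (P : pred (edge G)) (a b : eend G -> C) :
  vertex_conditions P a b ->
  vertex_conditions P (fun e => (a e)^*%R) (fun e => (b e)^*%R).
Proof.
move=> [h1 h2 h3]; split => [e e' Pe Pe' ee'|e Pe ve|v vv].
- by rewrite (h1 e e').
- by rewrite h2// rmorph0.
- by rewrite -rmorph_sum h3// rmorph0.
Qed.

(** The equation and the vertex conditions have real coefficients. This gives the resolvent in the
    lower half-plane from the one in the upper half-plane. *)
Lemma opHJ (u w : gfun G) : opH u w ->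
  opH (fun j x => (u j x)^*%R) (fun j x => (w j x)^*%R).
Proof.
move=> [u' [p [hu uu' [hu' hp hw hi hv]]]].
exists (fun j x => (u' j x)^*%R), (fun j x => (p j x)^*%R); split.
- exact: inL2J.
- apply/ae_eqfP => j _; have /ae_eqfP/(_ j isT) := uu'.
  by apply: filterS => x h /h ->.
split; [exact: inL2J|exact: inL2J|exact: inL2J| |].
  move=> j x _ jx; have [h1 h2] := hi j x isT jx.
  have cp := l2on_itv_cig (measurable_edge j) (cl_edge_sub jx) ((inL2P _ _).1 hp j isT).
  have cw := l2on_itv_cig (measurable_edge j) (cl_edge_sub jx) ((inL2P _ _).1 hw j isT).
  have mx : measurable (`]0, x[%classic : set R) by exact: measurable_itv.
  split.
    by rewrite h1 rmorphD; congr (_ + _); exact/esym/(cintJ mx cp).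
  by rewrite h2 rmorphB; congr (_ - _); exact/esym/(cintJ mx cw).
have := vertex_conditionsJ hv; congr vertex_conditions; apply/funext => e.
by rewrite /trace_nder rmorphM; congr (_ * _); rewrite /outsign; case: e => [[? []]|?]; rewrite ?rmorphN ?rmorph1.
Qed.

End Conjugation.

(** * The spectral density *)

Section SpectralDensity.
Context {R : realType} {G : metric_graph R}.
Local Notation C := R[i].
Local Notation Ci := (Ci : C).
Local Notation leb := (@lebR R).
Local Notation D := (`]0, +oo[%classic : set R).
Variables (K : R -> R -> edge G -> R -> R -> C).
Hypotheses
  (mK : forall e j, cmfun setT (fun q : (R * R) * R => K q.1.1 e j q.1.2 q.2))
  (bK : forall a b r : R, 0 < a -> exists M, forall l e j x y, a < l < b -> 0 <= e <= 1 ->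
        0 < x <= r -> 0 < y <= r -> normc (K l e j x y) <= M)
  (cK : forall l j x y, 0 < l ->
        ccvg \oo (fun n => K l n.+1%:R^-1 j x y) (K l 0 j x y)).
Variables (fk : R -> C) (r : R).
Hypotheses (mf : cmfun setT fk) (intf : leb.-integrable D (EFin \o (fun y => normc (fk y))))
  (fr : forall y, r < y -> fk y = 0).

Definition density (e l : R) : gfun G :=
  fun j x => cint leb D (fun y => (Im (K l e j x y))%:C * fk y).

Let mD : measurable D. Proof. exact: measurable_itv. Qed.

Lemma measurable_ImK e j :
  cmfun setT (fun q : (R * R) * R => (Im (K q.1.1 e j q.1.2 q.2))%:C * fk q.2).
Proof.
apply: cmfunM; first by apply: cmfun_real; exact: (mK e j).2.
by apply: (@cmfun_comp _ _ _ _ _ fk (fun q : (R * R) * R => q.2)) => //; exact: measurable_snd.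
Qed.

Lemma cmfun_kernel_y e j l x : cmfun setT (fun y => K l e j x y).
Proof.
apply: (@cmfun_comp _ _ _ _ _ (fun q : (R * R) * R => K q.1.1 e j q.1.2 q.2) (fun y => ((l, x), y))) => //.
exact: pair1_measurable.
Qed.

Lemma cmfun_ImK_y e j l x (A : set R) : cmfun A (fun y => (Im (K l e j x y))%:C * fk y).
Proof.
apply: cmfunTS; apply: cmfunM => //; apply: cmfun_real.
exact: (cmfun_kernel_y _ _ _ _).2.
Qed.

Lemma cmfun_density e j : cmfun setT (fun q : R * R => density e q.1 j q.2).
Proof.
by apply: (@cmfun_partial_int _ _ _ mD _ _ (fun (q : R * R) y => (Im (K q.1 e j q.2 y))%:C * fk y)); exact: measurable_ImK.
Qed.

Lemma integrableM_fk M : leb.-integrable D (EFin \o (fun y => M * normc (fk y))).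
Proof.
rewrite (_ : _ \o _ = (fun y => M%:E * (normc (fk y))%:E)%E); last by apply/funext.
exact: integrableZl.
Qed.

Lemma kernel_dom (a b : R) : 0 < a -> exists M, forall l e j x y, a < l < b -> 0 <= e <= 1 ->
  0 < x <= r -> 0 < y -> normc (K l e j x y * fk y) <= M * normc (fk y).
Proof.
move=> a0; have [M hM] := bK b r a0; exists M => l e j x y lab e01 xr y0.
have [yr|yr] := leP y r; last by rewrite fr// mulr0 normc0' mulr0.
by rewrite normcM' ler_wpM2r ?normc_ge0//; apply: hM => //; rewrite y0.
Qed.

Lemma ImK_dom (a b : R) : 0 < a -> exists M, forall l e j x y, a < l < b -> 0 <= e <= 1 ->
  0 < x <= r -> 0 < y -> normc ((Im (K l e j x y))%:C * fk y) <= M * normc (fk y).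
Proof.
move=> a0; have [M hM] := bK b r a0; exists M => l e j x y lab e01 xr y0.
have [yr|yr] := leP y r; last by rewrite fr// mulr0 normc0' mulr0.
rewrite normcM' ler_wpM2r ?normc_ge0// normcR (le_trans (absIm_le _))//.
by apply: hM => //; rewrite y0.
Qed.

Lemma edge_bounds (j : edge G) (x : R) : edge_set j x -> x <= r -> 0 < x <= r.
Proof. by move=> /edge_gt0 -> ->. Qed.

Lemma density_bounded (a b : R) : 0 < a -> exists M, forall l e j x, a < l < b -> 0 <= e <= 1 ->
  0 < x <= r -> normc (density e l j x) <= M.
Proof.
move=> a0; have [M hM] := ImK_dom b a0.
exists (2 * fine (\int[leb]_(y in D) (M * normc (fk y))%:E)%E) => l e j x lab e01 xr.
apply: (@normc_cint_le _ leb _ mD _ (fun y => M * normc (fk y))); last 2 first.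
- exact: integrableM_fk.
- by move=> y; rewrite /= in_itv/= andbT => y0; exact: hM.
exact: cmfun_ImK_y.
Qed.

Lemma density_cvg (l : R) j x : 0 < l -> 0 < x <= r ->
  ccvg \oo (fun n => density n.+1%:R^-1 l j x) (density 0 l j x).
Proof.
(* The bounds are stated on open intervals with positive left end; ]l / 2, l + 1[ is one that
   contains l. *)
move=> l0 xr; have l2 : 0 < l / 2 by rewrite divr_gt0.
have [M hM] := ImK_dom (l + 1) l2.
apply: (@cint_dct _ leb _ mD _ _ (fun y => M * normc (fk y))).
- by move=> n; exact: cmfun_ImK_y.
- exact: cmfun_ImK_y.
- exact: integrableM_fk.
- move=> n y; rewrite /= in_itv/= andbT => y0; apply: hM => //.
    by apply/andP; split; lra.
  by rewrite invr_ge0 ler0n/= invf_le1// ler1n.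
- move=> y _; apply: ccvgM; last exact: ccvg_cst.
  by apply: ccvg_real; exact: (cK _ _ _ l0).2.
Qed.

Lemma cig_kernel (l e : R) j x : 0 < l -> 0 <= e <= 1 -> 0 < x <= r ->
  cig leb D (fun y => K l e j x y * fk y).
Proof.
move=> l0 e01 xr; have l2 : 0 < l / 2 by rewrite divr_gt0.
have [M hM] := kernel_dom (l + 1) l2.
apply: (@cig_dom _ leb _ mD _ (fun y => M * normc (fk y))).
- by apply: cmfunTS; apply: cmfunM => //; exact: cmfun_kernel_y.
- exact: integrableM_fk.
- move=> y; rewrite /= in_itv/= andbT => y0; apply: hM => //.
  by apply/andP; split; lra.
Qed.

(** Im K = (K - conj K) / (2 i). In the second integral K is conjugated but f is not; that integral
    is the conjugate of K applied to conj f. *)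
Lemma densityE (l e : R) j x : 0 < l -> 0 <= e <= 1 -> 0 < x <= r ->
  density e l j x = (2 * Ci)^-1 * cint leb D (fun y => K l e j x y * fk y) +
    - (2 * Ci)^-1 * cint leb D (fun y => (K l e j x y)^*%R * fk y).
Proof.
move=> l0 e01 xr; have l2 : 0 < l / 2 by rewrite divr_gt0.
have [M hM] := kernel_dom (l + 1) l2.
have lab : l / 2 < l < l + 1 by apply/andP; split; lra.
have mKy := cmfun_kernel_y e j l x.
have c1 := cig_kernel j l0 e01 xr.
have c2 : cig leb D (fun y => (K l e j x y)^*%R * fk y).
  apply: (@cig_dom _ leb _ mD _ (fun y => M * normc (fk y))).
  - by apply: cmfunTS; apply: cmfunM => //; exact: cmfunJ.
  - exact: integrableM_fk.
  - move=> y; rewrite /= in_itv/= andbT => y0; rewrite normcM' normcJ' -normcM'; exact: hM.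
rewrite -(cintZ mD)// -(cintZ mD)// -(cintD mD); [|exact: cigZ|exact: cigZ].
apply: eq_cint => y _; rewrite !mulrA -mulrDl; congr (_ * _).
have C0 : 2 * Ci != 0 by rewrite mulf_neq0 ?pnatr_eq0 ?Ci_neq0.
apply: (mulfI C0); rewrite mulrDr !mulrA mulfV// mulrN mulNr mulfV// !mul1r.
case: (K _ _ _ _ _) => p q; apply: ceqP; rewrite ?ReM ?ImM ?ReB ?ImB /=; ring.
Qed.

Variable gg : gfun G.
Hypotheses (mg : forall j, cmfun setT (gg j))
  (ig : forall j, leb.-integrable (edge_set j) (EFin \o (fun x => normc (gg j x))))
  (g2 : inL2 predT gg) (gr : forall j x, r < x -> gg j x = 0).

Lemma cmfun_ginner_density e : cmfun setT (fun l => ginner (density e l) gg).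
Proof.
under eq_fun do rewrite ginnerE.
apply: cmfun_sum => j _.
apply: (@cmfun_partial_int _ leb _ (measurable_edge j) _ _ (fun l x => density e l j x * (gg j x)^*%R)).
apply: cmfunM; first exact: cmfun_density.
apply: cmfunJ; apply: (@cmfun_comp _ _ _ _ _ (gg j) (fun q : R * R => q.2)) => //.
exact: measurable_snd.
Qed.

Lemma cmfun_density_x e l j : cmfun setT (density e l j).
Proof.
apply: (@cmfun_comp _ _ _ _ _ (fun q : R * R => density e q.1 j q.2) (fun x => (l, x))).
  exact: cmfun_density.
exact: pair1_measurable.
Qed.

Lemma integrableM_gg j M : leb.-integrable (edge_set j) (EFin \o (fun x => M * normc (gg j x))).
Proof.
rewrite (_ : _ \o _ = (fun y => M%:E * (normc (gg j y))%:E)%E); last by apply/funext.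
by apply: integrableZl => //; exact: measurable_edge.
Qed.

Lemma density_gg_dom (a b : R) : 0 < a -> exists M, forall l e j x, a < l < b -> 0 <= e <= 1 ->
  edge_set j x -> normc (density e l j x * (gg j x)^*%R) <= M * normc (gg j x).
Proof.
move=> a0; have [M hM] := density_bounded b a0; exists M => l e j x lab e01 jx.
have [xr|xr] := leP x r; last by rewrite gr// rmorph0 mulr0 normc0' mulr0.
by rewrite normcM' normcJ' ler_wpM2r ?normc_ge0//; apply: hM => //; exact: (edge_bounds jx xr).
Qed.

Lemma cmfun_density_gg e l j (A : set R) : cmfun A (fun x => density e l j x * (gg j x)^*%R).
Proof. by apply: cmfunTS; apply: cmfunM; [exact: cmfun_density_x|exact: cmfunJ]. Qed.

Lemma ginner_density_bounded (a b : R) : 0 < a -> exists M, forall l e, a < l < b -> 0 <= e <= 1 ->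
  normc (ginner (density e l) gg) <= M.
Proof.
move=> a0; have [M hM] := density_gg_dom b a0.
exists (\sum_(j : edge G) 2 * fine (\int[leb]_(x in edge_set j) (M * normc (gg j x))%:E)%E) => l e lab e01.
rewrite ginnerE; apply: le_trans (normc_sum _ _ _) _; apply: ler_sum => j _.
apply: (@normc_cint_le _ leb _ (measurable_edge j) _ (fun x => M * normc (gg j x))).
- exact: cmfun_density_gg.
- exact: integrableM_gg.
- by move=> x jx; exact: hM.
Qed.

Lemma ginner_density_cvg (l : R) : 0 < l ->
  ccvg \oo (fun n => ginner (density n.+1%:R^-1 l) gg) (ginner (density 0 l) gg).
Proof.
move=> l0; have l2 : 0 < l / 2 by rewrite divr_gt0.
have [M hM] := density_gg_dom (l + 1) l2.
under [X in ccvg _ X]eq_fun do rewrite ginnerE.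
rewrite ginnerE; apply: ccvg_sum => j _.
apply: (@cint_dct _ leb _ (measurable_edge j) _ _ (fun x => M * normc (gg j x))).
- by move=> n; exact: cmfun_density_gg.
- exact: cmfun_density_gg.
- exact: integrableM_gg.
- move=> n x jx; apply: hM => //; first by apply/andP; split; lra.
  by rewrite invr_ge0 ler0n/= invf_le1// ler1n.
- move=> x jx; have [xr|xr] := leP x r; last first.
    by rewrite gr// rmorph0; under [X in ccvg _ X]eq_fun do rewrite mulr0; rewrite mulr0; exact: ccvg_cst.
  by apply: ccvgM; [apply: density_cvg => //; exact: (edge_bounds jx xr)|exact: ccvg_cst].
Qed.

End SpectralDensity.

(** * The spectral density through the kernel, and the order of integration *)

Section ExchangeIntegrals.
Context {R : realType} {G : metric_graph R}.
Local Notation C := R[i].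
Local Notation Ci := (Ci : C).
Local Notation leb := (@lebR R).
Local Notation D := (`]0, +oo[%classic : set R).
Variables (s : 'I_(dimN G) -> vcond G) (dd dc : C -> C)
  (Mc Mp : C -> 'M[C]_(dimN G)) (X : eU G -> C -> 'cV[C]_(dimN G))
  (E : set R -> gfun G -> gfun G) (k : eU G).
Hypotheses (hs : vertex_system s) (hA1 : A1 s dd dc Mc Mp) (hA2 : A2 s dc Mp X)
  (hR : resolution_of_identity E).
Variables (fk : R -> C) (gg : gfun G) (r : R).
Hypotheses (mf : cmfun setT fk) (intf : leb.-integrable D (EFin \o (fun y => normc (fk y))))
  (f2 : l2on D fk) (fr : forall y, r < y -> fk y = 0).
Hypotheses (mg : forall j, cmfun setT (gg j))
  (ig : forall j, leb.-integrable (edge_set j) (EFin \o (fun x => normc (gg j x))))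
  (g2 : inL2 predT gg) (gr : forall j x, r < x -> gg j x = 0).
Variables (a b : R) (h : R -> C).
Hypotheses (a0 : 0 < a) (ab : a < b) (ch : ccont h).
Local Notation I := (`]a, b[%classic : set R).
Let mD : measurable D. Proof. exact: measurable_itv. Qed.
Let mI : measurable I. Proof. exact: measurable_itv. Qed.

Lemma cbdd_resolvent (z : C) : Im z != 0 -> cbdd (fun x : R => (z - x%:C)^-1).
Proof.
move=> z0; split; first by apply: cmfunV; exact: cmfun_sub.
by exists `|Im z|^-1 => x; exact: normc_resolvent.
Qed.

Variable (K : R -> R -> edge G -> R -> R -> C).
Hypotheses
  (KE : forall l e j x y, 0 < l -> 0 <= e ->
        Kkernel_z s dc Mc X k j x y (zpath (l, e)) = K l e j x y)
  (mK : forall e j, cmfun setT (fun q : (R * R) * R => K q.1.1 e j q.1.2 q.2))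
  (bK : forall a b r : R, 0 < a -> exists M, forall l e j x y, a < l < b -> 0 <= e <= 1 ->
        0 < x <= r -> 0 < y <= r -> normc (K l e j x y) <= M)
  (cK : forall l j x y, 0 < l ->
        ccvg \oo (fun n => K l n.+1%:R^-1 j x y) (K l 0 j x y)).

(* [Im K] is half the difference of the resolvent kernels at [l + i e] and
   [l - i e]; the latter is obtained by conjugation. *)
Lemma poisson_density (l e : R) : 0 < l -> 0 < e -> e <= 1 ->
  spec_int E (fun x => (poisson e l x)%:C) (on_edge k fk) gg = - ginner (density K fk e l) gg.
Proof.
move=> l0 e0 e1; have e01 : 0 <= e <= 1 by rewrite (ltW e0).
have hE := hR.1; have hf := inL2_on_edge k f2.
pose z := zpath (l, e).
have z0 : 0 < Im z by exact: zpath_Im_gt0.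
have zz : z ^+ 2 = l +i* e by exact: zpath_sqr (ltW e0).
have z2 : Im (z ^+ 2) != 0 by rewrite zz /= gt_eqF.
pose u := resolvent_fun s dc Mc X k fk z.
have hu : opH u (fun j x => z ^+ 2 * u j x - on_edge k fk j x).
  exact: (opH_resolvent_fun k hs hA1 hA2 hR mf intf f2 fr z0 z2).
(* The resolvent at conj z^2 is obtained by applying the kernel at z to conj f and conjugating the
   result. *)
pose fk' y := (fk y)^*%R.
have mf' : cmfun setT fk' by exact: cmfunJ.
have intf' : leb.-integrable D (EFin \o (fun y => normc (fk' y))).
  by rewrite (_ : (fun y => normc (fk' y)) = fun y => normc (fk y))//; apply/funext => y; rewrite /fk' normcJ'.
have f2' : l2on D fk' by have /inL2J/inL2P/(_ (inr k) isT) := hf; rewrite /on_edge eqxx.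
have fr' y : r < y -> fk' y = 0 by move=> /fr yr; rewrite /fk' yr rmorph0.
pose u' : gfun G := fun j x => (resolvent_fun s dc Mc X k fk' z j x)^*%R.
have hu' : opH u' (fun j x => (z ^+ 2)^*%R * u' j x - on_edge k fk j x).
  have := opHJ (opH_resolvent_fun k hs hA1 hA2 hR mf' intf' f2' fr' z0 z2).
  congr opH; apply/funext => j; apply/funext => x; rewrite rmorphB rmorphM; congr (_ - _).
  by rewrite /on_edge /fk'; case: (j == inr k); [exact: conjCK|exact: rmorph0].
have z2' : Im ((z ^+ 2)^*%R) != 0 by rewrite ImJ oppr_eq0.
have e1' := resolvent_spec_int hR z2 hu hf g2.
have e2' := resolvent_spec_int hR z2' hu' hf g2.
have b1 := cbdd_resolvent z2; have b2 := cbdd_resolvent z2'.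
pose c : C := (2 * Ci)^-1.
have C0 : 2 * Ci != 0 by rewrite mulf_neq0 ?pnatr_eq0 ?Ci_neq0.
have pE x : (poisson e l x)%:C = - c * (z ^+ 2 - x%:C)^-1 + c * ((z ^+ 2)^*%R - x%:C)^-1.
  have -> : ((z ^+ 2)^*%R - x%:C)^-1 = ((z ^+ 2 - x%:C)^-1)^*%R.
    by rewrite fmorphV rmorphB; congr (_ - _)^-1; apply: ceqP => //=; rewrite oppr0.
  rewrite poissonE -zz; apply: (mulfI C0); rewrite mulrDr !mulrA mulrN mulNr mulfV// mul1r.
  case: (_^-1) => p q; apply: ceqP; rewrite ?ReM ?ImM ?ReB ?ImB /=; ring.
transitivity (- c * ginner u gg + c * ginner u' gg).
  rewrite (eq_spec_int _ _ _ pE) [LHS](spec_intD hE hf g2) ?e1' ?e2'; last 2 first.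
  - by apply: cbddM => //; exact: cbdd_cst.
  - by apply: cbddM => //; exact: cbdd_cst.
  by rewrite [X in X + _](spec_intZ hE _ hf g2 b1) [X in _ + X](spec_intZ hE _ hf g2 b2).
have iu : inL2 predT u by case: hu => ? [? []].
have iu' : inL2 predT u' by case: hu' => ? [? []].
have -> : ginner (density K fk e l) gg = ginner (fun j x => c * u j x + - c * u' j x) gg.
  rewrite !ginnerE; apply: eq_bigr => j _; apply: eq_cint => x jx.
  (* [densityE] needs x <= r; beyond r both products vanish with [gg]. *)
  have [xr|xr] := leP x r; last by rewrite gr// rmorph0 !mulr0.
  congr (_ * _); rewrite (densityE mK bK mf intf fr j l0 e01 (edge_bounds jx xr)).
  rewrite -/c /u /u' /resolvent_fun; congr (_ * _ + _ * _).
    by apply: eq_cint => y _; rewrite KE// ltW.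
  have cK' := cig_kernel mK bK mf' intf' fr' j l0 e01 (edge_bounds jx xr).
  transitivity ((cint leb D (fun y => K l e j x y * fk' y))^*%R).
    rewrite -(cintJ mD cK'); apply: eq_cint => y _.
    by rewrite rmorphM /fk'; congr (_ * _); exact/esym/conjCK.
  by congr (_^*%R); apply: eq_cint => y _; rewrite KE// ltW.
rewrite ginner_combl//; last exact: inL2Z.
rewrite ginnerZl//; ring.
Qed.

(** Fubini's theorem on each edge: the integrand is dominated by a bound of |h| on [a, b] times a
    multiple of |g|. *)
Lemma density_exchange :
  cint leb I (fun l => h l * ginner (density K fk 0 l) gg) =
  \sum_(j : edge G) cint leb (edge_set j) (fun x =>
    cint leb I (fun l => h l * density K fk 0 l j x) * (gg j x)^*%R).
Proof.
have mh := cmfun_ccont ch.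
have [Mh hMh] : exists M, forall l, `[a, b]%classic l -> normc (h l) <= M.
  by apply: ccvg_compact_bounded => [|l _]; [exact: segment_compact|exact: ch].
have hh l : a < l < b -> normc (h l) <= Mh.
  by move=> /andP[al lb]; apply: hMh; rewrite /= in_itv/= !ltW.
have e00 : 0 <= (0 : R) <= 1 by rewrite lexx ler01.
have [M hM] := density_gg_dom mK bK mf intf fr gr b a0.
have mJ j : cmfun setT (fun q : R * R => h q.1 * (density K fk 0 q.1 j q.2 * (gg j q.2)^*%R)).
  apply: cmfunM; first by apply: (@cmfun_comp _ _ _ _ _ h (fun q : R * R => q.1)) => //; exact: measurable_fst.
  apply: cmfunM; first exact: (cmfun_density mK mf).
  apply: cmfunJ; apply: (@cmfun_comp _ _ _ _ _ (gg j) (fun q : R * R => q.2)) => //; exact: measurable_snd.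
have bJ j l x : I l -> edge_set j x ->
    normc (h l * (density K fk 0 l j x * (gg j x)^*%R)) <= Mh * (M * normc (gg j x)).
  rewrite /= in_itv/= => lab jx; rewrite normcM'; apply: ler_pM; rewrite ?normc_ge0 ?hh//.
  exact: hM.
have iMh : leb.-integrable I (EFin \o (fun=> Mh)).
  by apply: (@bounded_itv_integrable _ _ _ _ `|Mh|).
have iM j : leb.-integrable (edge_set j) (EFin \o (fun x => M * normc (gg j x))).
  exact: integrableM_gg.
transitivity (cint leb I (fun l => \sum_(j : edge G) cint leb (edge_set j)
    (fun x => h l * (density K fk 0 l j x * (gg j x)^*%R)))).
  apply: eq_cint => l; rewrite /= in_itv/= => lab; rewrite ginnerE mulr_sumr; apply: eq_bigr => j _.
  rewrite (cintZ (measurable_edge j))//.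
  apply: (@cig_dom _ leb _ (measurable_edge j) _ (fun x => M * normc (gg j x))) => //.
    exact: (cmfun_density_gg mK mf mg).
  by move=> x jx; exact: hM.
rewrite (cint_sum mI) => [|j _]; last first.
  apply: (@cig_itv _ _ _ _ (2 * fine (\int[leb]_(x in edge_set j) (Mh * (M * normc (gg j x)))%:E)%E)).
    by apply: (@cmfun_partial_int _ leb _ (measurable_edge j) _ _ (fun l x => h l * (density K fk 0 l j x * (gg j x)^*%R))).
  move=> l lab; apply: (@normc_cint_le _ leb _ (measurable_edge j) _ (fun x => Mh * (M * normc (gg j x)))).
  - apply: cmfunTS; apply: cmfunM; first exact: cmfun_cst.
    exact: (cmfun_density_gg mK mf mg).
  - by under eq_fun do rewrite mulrA; exact: integrableM_gg.
  - by move=> x jx; apply: bJ => //; rewrite /= in_itv.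
apply: eq_bigr => j _.
rewrite (@cint_fubini _ leb leb I (edge_set j) mI (measurable_edge j) (fun=> Mh) _ iMh (iM j)
  (fun l x => h l * (density K fk 0 l j x * (gg j x)^*%R)))//; last by move=> l x; exact: bJ.
apply: eq_cint => x jx; have [xr|xr] := leP x r; last first.
  rewrite gr// rmorph0 mulr0; rewrite -[RHS](cint0 leb I); apply: eq_cint => l _.
  by rewrite !mulr0.
rewrite [RHS]mulrC -(cintZ mI); first by apply: eq_cint => l _; ring.
have [M' hM'] := density_bounded mK bK mf intf fr b a0.
apply: (@cig_itv _ _ _ _ (Mh * M')).
  apply: cmfunM => //.
  apply: (@cmfun_comp _ _ _ _ _ (fun q : R * R => density K fk 0 q.1 j q.2) (fun l => (l, x))).
    exact: (cmfun_density mK mf).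
  exact: pair2_measurable.
move=> l lab; rewrite normcM'; apply: ler_pM; rewrite ?normc_ge0 ?hh//.
by apply: hM' => //; exact: edge_bounds jx xr.
Qed.

Lemma density_formula :
  spec_int E (fun l => (\1_I l)%:C * h l) (on_edge k fk) gg =
  - (pi^-1)%:C * \sum_(j : edge G) cint leb (edge_set j) (fun x =>
    cint leb I (fun l => h l * density K fk 0 l j x) * (gg j x)^*%R).
Proof.
rewrite -density_exchange; have hf := inL2_on_edge k f2.
have eps01 n : 0 <= (n.+1%:R^-1 : R) <= 1 by rewrite invr_ge0 ler0n/= invf_le1// ler1n.
have [M hM] := ginner_density_bounded mK bK mf intf fr mg ig gr b a0.
apply: (stone_density hR.1 hf g2 ab (Gn := fun n l => ginner (density K fk n.+1%:R^-1 l) gg) (M := M)) => //.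
- move=> n l /andP[al _]; have /andP[_ e1] := eps01 n.
  by apply: poisson_density => //; exact: lt_trans al.
- by move=> n; exact: (cmfun_ginner_density mK mf mg).
- exact: (cmfun_ginner_density mK mf mg).
- by move=> n l lab; exact: hM.
- by move=> l /andP[al _]; apply: (ginner_density_cvg mK bK cK mf intf fr mg ig gr); exact: lt_trans al.
Qed.

End ExchangeIntegrals.

(** * Representatives with bounded support *)

Section Truncation.
Context {R : realType} {G : metric_graph R}.
Local Notation C := R[i].
Local Notation leb := (@lebR R).

(** A representative measurable on the whole line and zero at every point beyond r, whereas the
    support and membership conditions on f and g hold on the edges and up to null sets. *)
Definition trunc (D : set R) (r : R) (u : R -> C) (x : R) : C :=
  if x \in D `&` `]-oo, r]%classic then u x else 0.

Lemma trunc_out D r u (x : R) : r < x -> trunc D r u x = 0.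
Proof.
move=> rx; rewrite /trunc; case: ifPn => // /set_mem[_].
by rewrite /= in_itv/= leNgt rx.
Qed.

Section edge.
Variables (D : set R) (r : R) (u : R -> C).
Hypotheses (mD : measurable D) (D0 : forall x, D x -> 0 < x) (hu : l2on D u).
Let mDr : measurable (D `&` `]-oo, r]%classic : set R).
Proof. by apply: measurableI => //; exact: measurable_itv. Qed.

Lemma cmfun_trunc : cmfun setT (trunc D r u).
Proof.
have [[u1 u2] _] := hu.
have key (p : C -> R) : p 0 = 0 -> measurable_fun D (fun x => p (u x)) ->
    measurable_fun setT (fun x => p (trunc D r u x)).
  move=> p0 mp; rewrite (_ : (fun x => _) = (fun x => p (u x)) \_ (D `&` `]-oo, r]%classic)).
    apply/(measurable_restrict _ mDr measurableT); rewrite setTI.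
    exact: measurable_funS mp.
  by apply/funext => x; rewrite /trunc patchE; case: ifP.
by split; apply: key.
Qed.

Lemma l2on_trunc : l2on D (trunc D r u).
Proof.
apply: (l2on_dom mD (A := fun x => sqmod (u x))); first exact: cmfunTS cmfun_trunc.
  exact: l2on_integrable.
move=> x _; rewrite /trunc; case: ifP => // _.
by rewrite -!sqr_normc' normc0' expr0n/= sqr_ge0.
Qed.

(** On ]0, r] one has |u| <= 1 + |u|^2, and the truncation vanishes beyond r. *)
Lemma integrable_trunc : leb.-integrable D (EFin \o (fun x => normc (trunc D r u x))).
Proof.
have i1 : leb.-integrable D (EFin \o (fun x => \1_(`]0, r]%classic : set R) x)).
  apply/integrable_lebR => //; apply: (integrableS measurableT) => //.
  exact: integrable_indic_itv.
have i2 := l2on_integrable l2on_trunc.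
have i3 : leb.-integrable D (EFin \o (fun x => \1_(`]0, r]%classic : set R) x + sqmod (trunc D r u x))).
  exact: (integrableD mD i1 i2).
apply: (le_integrable mD _ _ i3).
  by apply/measurable_EFinP; apply: measurable_normc; exact: cmfunTS cmfun_trunc.
move=> x Dx; rewrite /= lee_fin ger0_norm ?normc_ge0//.
have s0 : 0 <= sqmod (trunc D r u x) by rewrite -sqr_normc' sqr_ge0.
rewrite ger0_norm; last by rewrite addr_ge0// indicE ler0n.
have [rx|xr] := ltP r x; first by rewrite [X in normc X]trunc_out// normc0' addr_ge0// indicE ler0n.
rewrite indicE mem_set/=; last by rewrite in_itv/= D0.
by rewrite -sqr_normc'; have := normc_ge0 (trunc D r u x); set n := normc _; nra.
Qed.

Lemma ae_trunc : {ae leb, forall x, D x -> r < x -> u x = 0} ->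
  {ae leb, forall x, D x -> u x = trunc D r u x}.
Proof.
apply: filterS => x hx Dx; rewrite /trunc; case: ifPn => // /negP xn.
apply: hx => //; rewrite ltNge; apply/negP => xr; apply: xn; apply/mem_set; split => //.
Qed.
End edge.

Lemma entire_ccont (h : C -> C) : entire h -> ccont (fun l : R => h l%:C).
Proof.
move=> hh l; have /derivable1_diffP/differentiable_continuous hc := hh l%:C.
apply/ccvg_normcP => e e0.
have ec : (0 : C) < e%:C by rewrite ltcR.
have /cvgrPdist_le/(_ _ ec) := hc.
move=> /nbhs_ballP[d /= d0 hd].
(* The radius is a positive element of [R[i]], hence real. *)
have [d1 dR] : 0 < Re d /\ d = (Re d)%:C.
  move: d0; case: (d) => p q; rewrite ltcE/= => /andP[/eqP q0 p0]; split => //.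
  by apply: ceqP => /=.
apply/nbhs_ballP; exists (Re d) => //= t lt.
have := hd t%:C; rewrite /ball /=.
have -> : `|l%:C - t%:C| = `|l - t|%:C by rewrite -rmorphB -normcR.
rewrite dR ltcR => /(_ lt); rewrite distrC => ht.
by move: ht; rewrite lecE => /andP[_].
Qed.

End Truncation.

Theorem theorem2p10 (R : realType) (G : metric_graph R)
    (s : 'I_(dimN G) -> vcond G) (dd dc : R[i] -> R[i])
    (Mc Mp : R[i] -> 'M[R[i]]_(dimN G)) (X : eU G -> R[i] -> 'cV[R[i]]_(dimN G))
    (E : set R -> gfun G -> gfun G)
    (k : eU G) (f g : gfun G) (a b : R) (h : R[i] -> R[i]) (w : gfun G) :
  graph_hyp G ->
  vertex_system s ->
  A1 s dd dc Mc Mp ->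
  A2 s dc Mp X ->
  resolution_of_identity E ->
  inY k f -> compact_support f ->
  inL2 predT g -> compact_support g ->
  0 < a -> a < b ->
  entire h ->
  (* w = h(H) E(a,b) f *)
  calc E (fun l => h l%:C) (E `]a, b[%classic f) w ->
  ginner w g =
  - (pi^-1)%:C *
  \sum_(j : edge G) cint (@lebesgue_measure R) (edge_set j) (fun x =>
    cint (@lebesgue_measure R) `]a, b[ (fun l =>
      h l%:C *
      cint (@lebesgue_measure R) (edge_set (inr k : edge G)) (fun y =>
        (complex.Im (Kkernel s dc Mc X k j x y l))%:C * f (inr k) y)) *
    (g j x)^*).
Proof.
move=> _ hs hA1 hA2 hR [f2 fk0] [r1 cf] g2 [r2 cg] a0 ab hh cw.
pose leb := @lebR R; pose D : set R := `]0, +oo[%classic.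
have mD : measurable D by exact: measurable_itv.
have mI : measurable (`]a, b[%classic : set R) by exact: measurable_itv.
pose r := Num.max r1 r2.
pose fk := trunc D r (f (inr k)).
pose gg : gfun G := fun j => trunc (edge_set j) r (g j).
have lf : l2on D (f (inr k)) by have /inL2P/(_ (inr k) isT) := f2.
have lg j : l2on (edge_set j) (g j) by have /inL2P/(_ j isT) := g2.
have D0 (y : R) : D y -> 0 < y by rewrite /D /= in_itv/= andbT.
have mfk : cmfun setT fk by exact: cmfun_trunc.
have ifk : leb.-integrable D (EFin \o (fun y => ComplexField.Normc.normc (fk y))).
  exact: integrable_trunc.
have f2k : l2on D fk by exact: l2on_trunc.
have fr (y : R) : r < y -> fk y = 0 by exact: trunc_out.
have mE := @measurable_edge R G.
have mgg j : cmfun setT (gg j) by exact: cmfun_trunc.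
have igg j : leb.-integrable (edge_set j) (EFin \o (fun x => ComplexField.Normc.normc (gg j x))).
  by apply: integrable_trunc => //; exact: edge_gt0.
have g2g : inL2 predT gg by apply/inL2P => j _; exact: l2on_trunc.
have gr j (x : R) : r < x -> gg j x = 0 by exact: trunc_out.
have cf' : {ae leb, forall y, D y -> f (inr k) y = fk y}.
  have h0 : {ae leb, forall y, D y -> r1 < y -> f (inr k) y = 0} := cf (inr k).
  apply: ae_trunc; apply: filterS h0 => y h1 Dy ry.
  by apply: h1 => //; apply: le_lt_trans ry; rewrite le_max lexx.
have cg' j : {ae leb, forall x, edge_set j x -> g j x = gg j x}.
  have h0 : {ae leb, forall x, edge_set j x -> r2 < x -> g j x = 0} := cg j.
  apply: ae_trunc; apply: filterS h0 => x h1 jx rx.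
  by apply: h1 => //; apply: le_lt_trans rx; rewrite le_max lexx orbT.
have ff : ae_eqf predT f (on_edge k fk).
  apply/ae_eqfP => j _; rewrite /on_edge; have [->|jk] := eqVneq j (inr k); first exact: cf'.
  exact: fk0.
have gg' : ae_eqf predT g gg by apply/ae_eqfP => j _; exact: cg'.
have ch := entire_ccont hh.
have hE := hR.1.
have fe := inL2_on_edge k f2k.
have bh (N : R) : exists M, forall x, `[- N, N]%classic x -> ComplexField.Normc.normc (h x%:C) <= M.
  by apply: ccvg_compact_bounded => [|l _]; [exact: segment_compact|exact: ch].
rewrite (ginner_calc hE (cmfun_ccont ch) bh f2 g2 cw).
rewrite (ae_spec_int hE _ f2 fe g2 g2g ff gg').
have [K [KE mK bK cK]] := kernel_path k hs hA1 hA2 hR.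
rewrite (density_formula hs hA1 hA2 hR mfk ifk f2k fr mgg igg g2g gr a0 ab ch KE mK bK cK).
congr (_ * _); apply: eq_bigr => j _.
(* At e = 0 the path is at the positive square root of l, so [K] is the kernel K_k at l; and [fk]
   goes back to f, to which it is equal almost everywhere on the edge. *)
have densE (l x : R) : 0 < l -> density K fk 0 l j x =
    cint leb D (fun y => (complex.Im (Kkernel s dc Mc X k j x y l))%:C * f (inr k) y).
  move=> l0; have mKl : cmfun D (fun y => (complex.Im (Kkernel s dc Mc X k j x y l))%:C).
    rewrite (_ : (fun y => _) = fun y => (complex.Im (K l 0 j x y))%:C).
      by apply: cmfunTS; apply: cmfun_real; exact: (cmfun_kernel_y mK _ _ _ _).2.
    by apply/funext => y; rewrite -KE// zpath0 ?ltW.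
  have -> : density K fk 0 l j x = cint leb D (fun y => (complex.Im (Kkernel s dc Mc X k j x y l))%:C * fk y).
    by apply: eq_cint => y _; rewrite -KE// zpath0 ?ltW.
  apply: ae_eq_cint => //.
  - by apply: cmfunM => //; exact: cmfunTS.
  - by apply: cmfunM => //; case: lf.
  - by apply: filterS cf' => y h1 Dy; rewrite h1.
(* [gg] goes back to g, equal to it almost everywhere; comparing the integrals requires the inner
   one to be measurable in x, which is [mP]. *)
transitivity (cint leb (edge_set j) (fun x =>
    cint leb `]a, b[%classic (fun l => h l%:C * density K fk 0 l j x) * (g j x)^*%R)).
  have mP : cmfun setT (fun x => cint leb `]a, b[%classic (fun l => h l%:C * density K fk 0 l j x)).
    apply: (@cmfun_partial_int _ leb _ mI _ _ (fun x l => h l%:C * density K fk 0 l j x)).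
    have m1 : cmfun setT (fun q : R * R => h q.2%:C).
      exact: (cmfun_comp (cmfun_ccont ch) measurable_snd).
    have m2 : cmfun setT (fun q : R * R => density K fk 0 q.2 j q.1).
      apply: (cmfun_comp (cmfun_density mK mfk 0 j) (g := fun q : R * R => (q.2, q.1))).
      by apply: measurable_fun_pair; [exact: measurable_snd|exact: measurable_fst].
    exact: cmfunM m1 m2.
  apply: ae_eq_cint => //.
  - by apply: cmfunTS; apply: cmfunM => //; exact: cmfunJ.
  - by apply: cmfunM; [exact: cmfunTS|apply: cmfunJ; case: (lg j)].
  - by apply: filterS (cg' j) => x h1 Dx; rewrite h1.
have e1 (x : R) : cint leb `]a, b[%classic (fun l => h l%:C * density K fk 0 l j x) =
    cint leb `]a, b[%classic (fun l => h l%:C *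
      cint leb D (fun y => (complex.Im (Kkernel s dc Mc X k j x y l))%:C * f (inr k) y)).
  apply: eq_cint => l; rewrite /= in_itv/= => /andP[al _].
  by rewrite densE// (lt_trans a0).
exact: (congr1 (cint leb (edge_set j)) (funext (fun x => congr1 ( *%R^~ ((g j x)^*%R)) (e1 x)))).
Qed.
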